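(* Let $w,v\in\mathbb{C}$ and let $R\geq1$ be an integer. As real $n\to\infty$: \begin{align*} T_n(1;v)&=\sum_{r=0}^{R-1}\frac{1}{n^r}\left(-\rho_r(v)+\frac{\gamma_r(v)}{2}\sqrt{2\pi n}\right)+O\!\left(\frac{1}{n^{R-1/2}}\right),\\ T_n(w;v)&=-\sum_{r=0}^{R-1}\frac{U_r(w;v)}{n^r}+O\!\left(\frac1{n^R}\right)\qquad (w\in\mathcal{X}\cup\mathcal{Z}\cup\mathcal{T}),\\ T_n(w;v)&=\sum_{r=0}^{R-1}\frac{1}{n^r}\left(-U_r(w;v)+\gamma_r(v)\frac{e^{ni\varphi(w)}}{w^v}\sqrt{2\pi n}\right)+O\!\left(\frac{1}{n^{R-1/2}}\right)\qquad (w\in\mathcal{S}),\\ T_n(w;v)&=\frac{\sqrt{2\pi n}}{(we^{1-w})^n w^v}\left(\sum_{r=0}^{R-1}\frac{\gamma_r(v)}{n^r}+O\!\left(\frac1{n^R}\right)\right)\qquad(w\in\mathcal{Y},\ w\neq0). \end{align*}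
   Context: Logarithms use the principal branch with arguments in $(-\pi,\pi]$; $w^v=e^{v\log w}$, $(nw)^{-(n+v)}=e^{-(n+v)\log n}e^{-(n+v)\log w}$, and $(we^{1-w})^n:=e^{n\log w+n(1-w)}$. For real $n>0$, $v\in\mathbb{C}$ with $\mathrm{Re}(n+v)>-1$, $w\in\mathbb{C}$, let $S_n(w;v)=1+nw\int_0^1 e^{nw(1-z)}z^{n+v}\,dz$ and, for $w\neq0$, $T_n(w;v)=e^{nw}(nw)^{-(n+v)}\Gamma(n+v+1)-S_n(w;v)$ (for integers $n\geq1$, $n+v\geq0$ this is the number with $\frac{(nw)^{n+v}}{(n+v)!}T_n(w;v)=\sum_{j=0}^{n+v-1}\frac{(nw)^j}{j!}$). Regions: $\mathcal{X}=\{|we^{1-w}|>1\}$; $\mathcal{Y}=\{|we^{1-w}|<1,\mathrm{Re}(w)<1\}$; $\mathcal{Z}=\{|we^{1-w}|<1,\mathrm{Re}(w)>1\}$; $\mathcal{S}=\{|we^{1-w}|=1,\mathrm{Re}(w)<1\}$; $\mathcal{T}=\{|we^{1-w}|=1,\mathrm{Re}(w)>1\}$. For $|we^{1-w}|=1$, $\varphi(w):=\mathrm{Im}(w)-\arg(w)$, so $we^{1-w}=e^{-i\varphi(w)}$. De Moivre polynomial $\mathcal{A}_{n,k}(a_1,a_2,\dots)$: coefficient of $x^n$ in $(a_1x+a_2x^2+\cdots)^k$. Double factorial usual with $0!!=(-1)!!=1$; $\binom{v}{j}=v(v-1)\cdots(v-j+1)/j!$. Coefficients: $\rho_r(v)=\delta_{r,0}-\sum_{m=0}^{2r+1}(-1)^m\binom{v}{2r+1-m}\sum_{k=0}^{m}\frac{(2r+2k)!!}{(-1)^k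 k!}\mathcal{A}_{m,k}(\frac13,\frac14,\dots)$; $\gamma_r(v)=\sum_{m=0}^{2r}(-1)^m\binom{v}{2r-m}\sum_{k=0}^{m}\frac{(2r+2k-1)!!}{(-1)^k k!}\mathcal{A}_{m,k}(\frac13,\frac14,\dots)$; $U_r(w;v)=\delta_{r,0}-\sum_{m=0}^{r}(-1)^m\binom{v}{r-m}\sum_{k=0}^{m}\frac{w}{(w-1)^{r+k+1}}\frac{(r+k)!}{k!}\mathcal{A}_{m,k}(\frac12,\frac13,\dots)$. *)

(* Defs.v *)
From Stdlib Require Import Reals Factorial.
From Coquelicot Require Import Coquelicot.

Open Scope C_scope.

Definition Cexp (z : C) : C :=
  (exp (fst z) * cos (snd z), exp (fst z) * sin (snd z))%R.

(** Principal argument, with values in (-PI, PI]  (Carg 0 := 0, irrelevant). *)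
Definition Carg (z : C) : R :=
  let x := fst z in let y := snd z in
  if Rlt_dec 0 x then atan (y / x)
  else if Rlt_dec x 0 then
    (if Rle_dec 0 y then atan (y / x) + PI else atan (y / x) - PI)%R
  else if Rlt_dec 0 y then (PI / 2)%R
  else if Rlt_dec y 0 then (- (PI / 2))%R
  else 0%R.

Definition Clog (z : C) : C := (ln (Cmod z), Carg z).

Definition Ccpow (w v : C) : C := Cexp (v * Clog w).

Definition Rcpow (t : R) (s : C) : C := Cexp (s * RtoC (ln t)).

(** Gamma(s) = int_0^oo t^{s-1} e^{-t} dt  (used only for Re s > 0). *)
Definition CGamma (s : C) : C :=
  @RInt_gen C_R_CompleteNormedModule
    (fun t => Rcpow t (s - 1) * RtoC (exp (- t)))
    (at_right 0) (Rbar_locally p_infty).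

(** S_n(w;v) = 1 + n w int_0^1 e^{n w (1-z)} z^{n+v} dz
    (improper at 0 in case -1 < Re(n+v) < 0). *)
Definition S_n (n : R) (w v : C) : C :=
  1 + RtoC n * w *
    @RInt_gen C_R_CompleteNormedModule
      (fun z => Cexp (RtoC n * w * RtoC (1 - z)) * Rcpow z (RtoC n + v))
      (at_right 0) (at_left 1).

Definition nw_pow (n : R) (w v : C) : C :=
  Cexp (- (RtoC n + v) * RtoC (ln n)) * Cexp (- (RtoC n + v) * Clog w).

Definition T_n (n : R) (w v : C) : C :=
  Cexp (RtoC n * w) * nw_pow n w v * CGamma (RtoC n + v + 1) - S_n n w v.

Definition wpow_n (n : R) (w : C) : C :=
  Cexp (RtoC n * Clog w + RtoC n * (1 - w)).

Definition modwe (w : C) : R := Cmod (w * Cexp (1 - w)).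

Definition regX (w : C) : Prop := (modwe w > 1)%R.
Definition regY (w : C) : Prop := (modwe w < 1)%R /\ (fst w < 1)%R.
Definition regZ (w : C) : Prop := (modwe w < 1)%R /\ (fst w > 1)%R.
Definition regS (w : C) : Prop := modwe w = 1%R /\ (fst w < 1)%R.
Definition regT (w : C) : Prop := modwe w = 1%R /\ (fst w > 1)%R.

Definition phi (w : C) : R := (snd w - Carg w)%R.

Fixpoint Csum (m : nat) (f : nat -> C) : C :=
  match m with
  | O => f O
  | S m' => Csum m' f + f (S m')
  end.

Fixpoint Csum_lt (m : nat) (f : nat -> C) : C :=
  match m with
  | O => 0
  | S m' => Csum_lt m' f + f m'
  end.

(** De Moivre polynomial A_{m,k}(a_1,a_2,...) : the coefficient of x^m in
    (a_1 x + a_2 x^2 + ...)^k, computed by expanding the k-th power as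
    f * f^(k-1) (Cauchy product):
      A_{m,0} = [m = 0],  A_{m,k+1} = sum_{j=1}^{m} a_j A_{m-j,k}. *)
Fixpoint deMoivre (a : nat -> R) (m k : nat) {struct k} : R :=
  match k with
  | O => match m with O => 1%R | S _ => 0%R end
  | S k' => sum_f_R0 (fun j => if Nat.eqb j 0 then 0%R
                              else (a j * deMoivre a (m - j) k')%R) m
  end.

(** the sequences (1/3, 1/4, ...) and (1/2, 1/3, ...), indexed from a_1 *)
Definition a3 (j : nat) : R := (/ INR (j + 2))%R.
Definition a2 (j : nat) : R := (/ INR (j + 1))%R.

Fixpoint dfact (n : nat) : nat :=
  match n with
  | O => 1
  | S O => 1
  | S (S p as q) => (S q * dfact p)%nat
  end.
(** (2r+2k-1)!! is written dfact (2r+2k-1) with truncated nat subtraction: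
    the only case 2r+2k-1 = -1 (r=k=0) becomes dfact 0 = 1 = (-1)!!. *)

Fixpoint fallC (v : C) (j : nat) : C :=
  match j with
  | O => 1
  | S j' => fallC v j' * (v - RtoC (INR j'))
  end.
Definition Cbinom (v : C) (j : nat) : C := fallC v j / RtoC (INR (fact j)).

Definition delta0 (r : nat) : C := if Nat.eqb r 0 then 1 else 0.

Definition rho (r : nat) (v : C) : C :=
  delta0 r -
  Csum (2 * r + 1) (fun m =>
    RtoC ((-1) ^ m) * Cbinom v (2 * r + 1 - m) *
    Csum m (fun k =>
      RtoC (INR (dfact (2 * r + 2 * k)) / ((-1) ^ k * INR (fact k))
            * deMoivre a3 m k)%R)).

Definition gamma_c (r : nat) (v : C) : C :=
  Csum (2 * r) (fun m =>
    RtoC ((-1) ^ m) * Cbinom v (2 * r - m) *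
    Csum m (fun k =>
      RtoC (INR (dfact (2 * r + 2 * k - 1)) / ((-1) ^ k * INR (fact k))
            * deMoivre a3 m k)%R)).

Definition U_r (r : nat) (w v : C) : C :=
  delta0 r -
  Csum r (fun m =>
    RtoC ((-1) ^ m) * Cbinom v (r - m) *
    Csum m (fun k =>
      w / (w - 1) ^ (r + k + 1)
        * RtoC (INR (fact (r + k)) / INR (fact k) * deMoivre a2 m k)%R)).

(* Main.v *)
Require Import Defs.
From Stdlib Require Import Reals Factorial Lra Lia.
From Coquelicot Require Import Coquelicot.
Open Scope C_scope.

(** Write [s = n + v].  For [Re w < 1] the substitution [z = 1 - t] turns
    [S_n - 1] into [n w] times the integral of [e^{n w t} (1 - t)^s] over [[0,1]],
    whose phase decreases linearly from [t = 0].  For [Re w >= 1], rotating the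
    contour of the upper incomplete gamma function gives
    [T_n + 1 = n * int_0^oo e^{-n t} (1 + t / w)^s dt]; the phase is linear with
    rate [1 - 1 / w] if [w <> 1], so that the line [Re w = 1] needs no special
    treatment, and quadratic if [w = 1].  The two integrals with [w = 1] add up to
    [e^n n^{-s} Gamma(s + 1)], which yields the Stirling series; the remaining
    regions follow by comparing the sizes of [(w e^{1-w})^{-n}] and [S_n].

    All these integrals are covered by one form of Laplace's method: the integrand
    is [exp (nu^l (L t - b t) + v L t)] with [L t = log (1 + d t)], [n = nu^l],
    [l = 1] or [2], and it is expanded as [e^{-c x}] times
    [e^{x eta(t)} (1 + d t)^v] with [x = (nu t)^l], where [eta] vanishes at [0].
    No complex integration theory is used: the rotation of the contour rests on
    the explicit primitive [P_int] of [e^{-n z} z^s]. *)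

(** * Calculus of complex-valued functions of a real variable *)

(** The two integrals are complementary. For Re w < 1 the integral in [S_n] is dominated by its
    endpoint z = 1; for Re w > 1 its integrand first grows away from that endpoint, and the part of
    the gamma integral beyond [w] is the one that decays from its start. In both cases the modulus
    already decreases along a real parameter, so complex phases call for no steepest descent path.
    The delicate point is uniformity: [t] stays small while x = (nu t)^l is unbounded. Hence [t] and
    [x] are estimated as independent variables, with a factor e^{kap x} in the error that the decay
    e^{-c x} absorbs. For w = 1 one has nu = sqrt n, and the expansion in 1/nu separates by parity:
    even orders carry [gamma_c] and sqrt n, odd orders carry [rho]; this is why 2K terms in nu give
    K terms in n. Tails are always compared with an exponential whose exponent is linear in t, even
    for the quadratic phase, since log (1 + t) - t decreases only linearly at infinity. All
    thresholds on n ensure Re (n + v) >= 2, so that z^{n+v} is differentiable at 0 and the integrals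
    near 0 become ordinary ones. *)

Notation is_CInt := (@is_RInt C_R_NormedModule).

(** Componentwise, so that the real derivative rules, the real fundamental theorem and the real mean
    value theorem apply to each coordinate. *)
Definition is_cderive (f : R -> C) (t : R) (l : C) : Prop :=
  is_derive (fun x => fst (f x)) t (fst l) /\ is_derive (fun x => snd (f x)) t (snd l).

Definition ex_cderive (f : R -> C) (t : R) : Prop := exists l, is_cderive f t l.

Lemma is_cderive_ext_loc (f g : R -> C) t l :
  locally t (fun x => f x = g x) -> is_cderive f t l -> is_cderive g t l.
Proof.
  intros H [H1 H2]; split.
  - apply is_derive_ext_loc with (2 := H1).
    apply filter_imp with (2 := H); now intros x ->.
  - apply is_derive_ext_loc with (2 := H2).
    apply filter_imp with (2 := H); now intros x ->.
Qed.

Lemma is_cderive_ext (f g : R -> C) t l :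
  (forall x, f x = g x) -> is_cderive f t l -> is_cderive g t l.
Proof. intros H; apply is_cderive_ext_loc, filter_forall, H. Qed.

Lemma is_cderive_const (c : C) t : is_cderive (fun _ => c) t 0.
Proof. split; apply (@is_derive_const R_AbsRing). Qed.

Lemma is_cderive_RtoC (f : R -> R) (t l : R) :
  is_derive f t l -> is_cderive (fun x => RtoC (f x)) t (RtoC l).
Proof. intros H; split; [exact H|]. exact (@is_derive_const R_AbsRing R_NormedModule 0%R t). Qed.

Lemma is_cderive_id t : is_cderive (fun x => RtoC x) t 1.
Proof. apply is_cderive_RtoC, (@is_derive_id R_AbsRing). Qed.

Lemma is_cderive_plus (f g : R -> C) t a b :
  is_cderive f t a -> is_cderive g t b -> is_cderive (fun x => f x + g x) t (a + b).
Proof. intros [H1 H2] [H3 H4]; split; now apply (@is_derive_plus R_AbsRing). Qed.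

Lemma is_cderive_opp (f : R -> C) t a :
  is_cderive f t a -> is_cderive (fun x => - f x) t (- a).
Proof. intros [H1 H2]; split; now apply (@is_derive_opp R_AbsRing). Qed.

Lemma is_cderive_minus (f g : R -> C) t a b :
  is_cderive f t a -> is_cderive g t b -> is_cderive (fun x => f x - g x) t (a - b).
Proof. intros H1 H2; apply is_cderive_plus; [|apply is_cderive_opp]; assumption. Qed.

Lemma is_cderive_mult (f g : R -> C) t a b :
  is_cderive f t a -> is_cderive g t b ->
  is_cderive (fun x => f x * g x) t (a * g t + f t * b).
Proof.
  intros [H1 H2] [H3 H4]; split; simpl.
  - replace (fst a * fst (g t) - snd a * snd (g t) + (fst (f t) * fst b - snd (f t) * snd b))%R
      with ((fst a * fst (g t) + fst (f t) * fst b) - (snd a * snd (g t) + snd (f t) * snd b))%R by ring.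
    apply (@is_derive_minus R_AbsRing R_NormedModule
      (fun x => fst (f x) * fst (g x))%R (fun x => snd (f x) * snd (g x))%R).
    + apply (is_derive_mult (fun x => fst (f x)) (fun x => fst (g x))); auto using Rmult_comm.
    + apply (is_derive_mult (fun x => snd (f x)) (fun x => snd (g x))); auto using Rmult_comm.
  - replace (fst a * snd (g t) + snd a * fst (g t) + (fst (f t) * snd b + snd (f t) * fst b))%R
      with ((fst a * snd (g t) + fst (f t) * snd b) + (snd a * fst (g t) + snd (f t) * fst b))%R by ring.
    apply (@is_derive_plus R_AbsRing R_NormedModule
      (fun x => fst (f x) * snd (g x))%R (fun x => snd (f x) * fst (g x))%R).
    + apply (is_derive_mult (fun x => fst (f x)) (fun x => snd (g x))); auto using Rmult_comm.
    + apply (is_derive_mult (fun x => snd (f x)) (fun x => fst (g x))); auto using Rmult_comm.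
Qed.

Lemma is_cderive_scal (c : C) (f : R -> C) t a :
  is_cderive f t a -> is_cderive (fun x => c * f x) t (c * a).
Proof.
  intros H; replace (c * a) with (0 * f t + c * a) by ring.
  apply is_cderive_mult; [apply is_cderive_const | assumption].
Qed.

Lemma is_cderive_eq (f : R -> C) t a b : is_cderive f t a -> a = b -> is_cderive f t b.
Proof. now intros H <-. Qed.

Lemma is_cderive_linear (c : C) t : is_cderive (fun x => c * RtoC x) t c.
Proof. eapply is_cderive_eq; [apply is_cderive_scal, is_cderive_id|ring]. Qed.

Lemma is_cderive_Cexp (f : R -> C) t l :
  is_cderive f t l -> is_cderive (fun x => Cexp (f x)) t (l * Cexp (f t)).
Proof.
  intros [H1 H2]; split; simpl.
  - replace (_ - _)%R with
      (fst l * exp (fst (f t)) * cos (snd (f t)) + exp (fst (f t)) * (snd l * - sin (snd (f t))))%R by ring.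
    apply (is_derive_mult (fun x => exp (fst (f x))) (fun x => cos (snd (f x)))); [| |exact Rmult_comm].
    + apply (is_derive_comp exp (fun x => fst (f x))); [apply is_derive_exp|assumption].
    + apply (is_derive_comp cos (fun x => snd (f x))); [apply is_derive_cos|assumption].
  - replace (fst l * _ + _)%R with
      (fst l * exp (fst (f t)) * sin (snd (f t)) + exp (fst (f t)) * (snd l * cos (snd (f t))))%R by ring.
    apply (is_derive_mult (fun x => exp (fst (f x))) (fun x => sin (snd (f x)))); [| |exact Rmult_comm].
    + apply (is_derive_comp exp (fun x => fst (f x))); [apply is_derive_exp|assumption].
    + apply (is_derive_comp sin (fun x => snd (f x))); [apply is_derive_sin|assumption].
Qed.

Lemma is_derive_ln_hypot (x y : R -> R) (t dx dy : R) :
  (0 < x t)%R -> is_derive x t dx -> is_derive y t dy ->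
  is_derive (fun u => ln (sqrt (x u ^ 2 + y u ^ 2))) t
    ((dx * x t + dy * y t) / (x t ^ 2 + y t ^ 2))%R.
Proof.
  intros Hp H1 H2.
  assert (Hq : (0 < x t ^ 2 + y t ^ 2)%R) by nra.
  assert (Hs := sqrt_lt_R0 _ Hq).
  assert (Hss := sqrt_sqrt _ (Rlt_le _ _ Hq)).
  auto_derive.
  - repeat split; try (eexists; eassumption); simpl in *; assumption.
  - change (fun u => x u) with x; change (fun u => y u) with y.
    rewrite (is_derive_unique x _ _ H1), (is_derive_unique y _ _ H2).
    simpl in *. set (r := sqrt _) in *. rewrite <- Hss. field. lra.
Qed.

Lemma is_derive_atan_quot (x y : R -> R) (t dx dy : R) :
  (0 < x t)%R -> is_derive x t dx -> is_derive y t dy ->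
  is_derive (fun u => atan (y u / x u)) t
    ((dy * x t - dx * y t) / (x t ^ 2 + y t ^ 2))%R.
Proof.
  intros Hp H1 H2.
  auto_derive.
  - repeat split; try (eexists; eassumption); lra.
  - change (fun u => x u) with x; change (fun u => y u) with y.
    rewrite (is_derive_unique x _ _ H1), (is_derive_unique y _ _ H2).
    unfold Rsqr; field; repeat split; nra.
Qed.

(** In the right half-plane [Carg] is the single branch [atan (y / x)] near the point, so the
    logarithm is differentiated through its real and imaginary parts. All contours below stay in
    that half-plane. *)
Lemma is_cderive_Clog (z : R -> C) t l :
  (0 < fst (z t))%R -> is_cderive z t l ->
  is_cderive (fun x => Clog (z x)) t (l / z t).
Proof.
  intros Hp [H1 H2]. split.
  - replace (fst (l / z t)) with
      ((fst l * fst (z t) + snd l * snd (z t)) / (fst (z t) ^ 2 + snd (z t) ^ 2))%R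
      by (simpl; field; nra).
    apply (is_derive_ln_hypot (fun u => fst (z u)) (fun u => snd (z u))); assumption.
  - replace (snd (l / z t)) with
      ((snd l * fst (z t) - fst l * snd (z t)) / (fst (z t) ^ 2 + snd (z t) ^ 2))%R
      by (simpl; field; nra).
    apply is_derive_ext_loc with (fun x => atan (snd (z x) / fst (z x)))%R.
    + assert (L : locally t (fun x => 0 < fst (z x))%R).
      { assert (Cn : continuous (fun x => fst (z x)) t).
        { apply (@ex_derive_continuous R_AbsRing R_NormedModule); eexists; exact H1. }
        apply (Cn (fun u => 0 < u)%R), (open_gt 0), Hp. }
      apply filter_imp with (2 := L); intros x Hx; simpl; unfold Carg.
      destruct (Rlt_dec 0 (fst (z x))); [reflexivity|contradiction].
    + apply (is_derive_atan_quot (fun u => fst (z u)) (fun u => snd (z u))); assumption.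
Qed.

(** * The complex exponential and the modulus *)

Lemma Cexp_plus a b : Cexp (a + b) = Cexp a * Cexp b.
Proof.
  unfold Cexp; simpl; rewrite exp_plus, cos_plus, sin_plus.
  apply injective_projections; simpl; ring.
Qed.

Lemma Cexp_0 : Cexp 0 = 1.
Proof. unfold Cexp; simpl; rewrite exp_0, cos_0, sin_0. apply injective_projections; simpl; ring. Qed.

Lemma Cmod_Cexp z : Cmod (Cexp z) = exp (fst z).
Proof.
  unfold Cmod, Cexp; simpl.
  replace (_ + _)%R with (exp (fst z) * exp (fst z) * (Rsqr (sin (snd z)) + Rsqr (cos (snd z))))%R
    by (unfold Rsqr; ring).
  rewrite sin2_cos2, Rmult_1_r. apply sqrt_square, Rlt_le, exp_pos.
Qed.

Lemma Cexp_neq_0 z : Cexp z <> 0.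
Proof.
  intros H. assert (H1 := Cmod_Cexp z). rewrite H, Cmod_0 in H1.
  assert (H2 := exp_pos (fst z)). lra.
Qed.

Lemma Cexp_opp z : Cexp (- z) = / Cexp z.
Proof.
  assert (H : Cexp z * Cexp (- z) = 1) by now rewrite <- Cexp_plus, Cplus_opp_r, Cexp_0.
  rewrite <- (Cmult_1_l (Cexp (- z))), <- (Cinv_l (Cexp z)) by apply Cexp_neq_0.
  rewrite <- Cmult_assoc, H. ring.
Qed.

Lemma Cexp_RtoC x : Cexp (RtoC x) = RtoC (exp x).
Proof.
  unfold Cexp, RtoC; simpl; rewrite cos_0, sin_0. apply injective_projections; simpl; ring.
Qed.

Lemma Cmod_fst z : (fst z <= Cmod z)%R.
Proof. eapply Rle_trans; [apply Rle_abs|apply (re_le_Cmod z)]. Qed.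

Lemma Cmod_snd z : (Rabs (snd z) <= Cmod z)%R.
Proof. eapply Rle_trans; [|apply Rmax_Cmod]; apply Rmax_r. Qed.

Lemma Cmod_minus_le a b : (Cmod (a - b) <= Cmod a + Cmod b)%R.
Proof. unfold Cminus; rewrite <- (Cmod_opp b); apply Cmod_triangle. Qed.

Lemma Cmod_sqr z : (Cmod z * Cmod z = fst z * fst z + snd z * snd z)%R.
Proof. unfold Cmod; rewrite sqrt_sqrt; nra. Qed.

Lemma norm_C_R (z : C) : @norm _ C_R_NormedModule z = Cmod z.
Proof.
  change (sqrt (Rabs (fst z) ^ 2 + Rabs (snd z) ^ 2) = Cmod z).
  now rewrite 2!pow2_abs.
Qed.

(* Apply the real mean value theorem to the scalar product of [f] with [f b - f a]. *)
Lemma Cmod_mean_value (f df : R -> C) (a b D : R) :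
  (a <= b)%R -> (forall t, (a <= t <= b)%R -> is_cderive f t (df t)) ->
  (forall t, (a <= t <= b)%R -> Cmod (df t) <= D)%R ->
  (Cmod (f b - f a) <= D * (b - a))%R.
Proof.
  intros Hab Hd HD.
  set (u := f b - f a).
  assert (HD0 : (0 <= D)%R).
  { eapply Rle_trans; [apply Cmod_ge_0|apply (HD a); lra]. }
  set (g := fun t => (fst u * fst (f t) + snd u * snd (f t))%R).
  set (dg := fun t => (fst u * fst (df t) + snd u * snd (df t))%R).
  destruct (MVT_gen g a b dg) as [c [Hc Hg]].
  - intros x Hx. rewrite Rmin_left, Rmax_right in Hx by lra.
    destruct (Hd x) as [H1 H2]; [lra|].
    apply (@is_derive_plus R_AbsRing R_NormedModule
      (fun t => fst u * fst (f t))%R (fun t => snd u * snd (f t))%R);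
    apply is_derive_scal; assumption.
  - intros x Hx. rewrite Rmin_left, Rmax_right in Hx by lra.
    destruct (Hd x) as [H1 H2]; [lra|].
    apply continuity_pt_filterlim, (@ex_derive_continuous R_AbsRing R_NormedModule).
    exists (dg x).
    apply (@is_derive_plus R_AbsRing R_NormedModule
      (fun t => fst u * fst (f t))%R (fun t => snd u * snd (f t))%R);
    apply is_derive_scal; assumption.
  - rewrite Rmin_left, Rmax_right in Hc by lra.
    assert (E : (g b - g a = Cmod u * Cmod u)%R).
    { rewrite Cmod_sqr. unfold g, u; simpl; ring. }
    rewrite E in Hg.
    assert (B : (dg c <= Cmod u * D)%R).
    { apply Rle_trans with (Cmod u * Cmod (df c))%R.
      - unfold dg. assert (A1 := Cmod_sqr u). assert (A2 := Cmod_sqr (df c)).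
        assert (A3 := Cmod_ge_0 u). assert (A4 := Cmod_ge_0 (df c)).
        apply Rsqr_incr_0_var; [|nra]. unfold Rsqr.
        replace (Cmod u * Cmod (df c) * (Cmod u * Cmod (df c)))%R with
          ((Cmod u * Cmod u) * (Cmod (df c) * Cmod (df c)))%R by ring.
        rewrite A1, A2.
        assert (0 <= (fst u * snd (df c) - snd u * fst (df c)) ^ 2)%R by apply pow2_ge_0.
        nra.
      - apply Rmult_le_compat_l; [apply Cmod_ge_0|apply HD; lra]. }
    destruct (Req_dec (Cmod u) 0) as [H0|H0].
    + rewrite H0; nra.
    + assert (0 < Cmod u)%R by (assert (A := Cmod_ge_0 u); lra).
      apply Rmult_le_reg_l with (Cmod u); [assumption|].
      rewrite Hg. nra.
Qed.

(** * Integrals of complex-valued functions *)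

Lemma is_CInt_pair f a b (l : C) :
  is_RInt (fun t => fst (f t)) a b (fst l) -> is_RInt (fun t => snd (f t)) a b (snd l) ->
  is_CInt f a b l.
Proof.
  intros H1 H2. rewrite (surjective_pairing l).
  apply (@is_RInt_fct_extend_pair R_NormedModule R_NormedModule); assumption.
Qed.

Lemma is_CInt_fst f a b (l : C) : is_CInt f a b l -> is_RInt (fun t => fst (f t)) a b (fst l).
Proof. intros H; apply (@is_RInt_fct_extend_fst R_NormedModule R_NormedModule); exact H. Qed.

Lemma is_CInt_snd f a b (l : C) : is_CInt f a b l -> is_RInt (fun t => snd (f t)) a b (snd l).
Proof. intros H; apply (@is_RInt_fct_extend_snd R_NormedModule R_NormedModule); exact H. Qed.

Lemma is_CInt_cmult (c : C) f a b l : is_CInt f a b l -> is_CInt (fun t => c * f t) a b (c * l).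
Proof.
  intros H; assert (H1 := is_CInt_fst _ _ _ _ H); assert (H2 := is_CInt_snd _ _ _ _ H).
  apply is_CInt_pair; simpl.
  - apply (@is_RInt_minus R_NormedModule (fun t => fst c * fst (f t))%R (fun t => snd c * snd (f t))%R);
    apply (@is_RInt_scal R_NormedModule); assumption.
  - apply (@is_RInt_plus R_NormedModule (fun t => fst c * snd (f t))%R (fun t => snd c * fst (f t))%R);
    apply (@is_RInt_scal R_NormedModule); assumption.
Qed.

Lemma is_CInt_cplus f g a b l m :
  is_CInt f a b l -> is_CInt g a b m -> is_CInt (fun t => f t + g t) a b (l + m).
Proof. intros H1 H2; exact (is_RInt_plus _ _ _ _ _ _ H1 H2). Qed.

Lemma is_CInt_cminus f g a b l m :
  is_CInt f a b l -> is_CInt g a b m -> is_CInt (fun t => f t - g t) a b (l - m).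
Proof. intros H1 H2; exact (is_RInt_minus _ _ _ _ _ _ H1 H2). Qed.

Lemma is_CInt_RtoC (f : R -> R) (a b l : R) :
  is_RInt f a b l -> is_CInt (fun t => RtoC (f t)) a b (RtoC l).
Proof.
  intros H; apply is_CInt_pair; simpl; [exact H|].
  assert (K := @is_RInt_const R_NormedModule a b 0%R).
  change (is_RInt (fun _ => 0%R) a b ((b - a) * 0)%R) in K.
  rewrite Rmult_0_r in K; exact K.
Qed.

Lemma ex_CInt (f : R -> C) (a b : R) :
  (forall t, (Rmin a b <= t <= Rmax a b)%R -> ex_cderive f t) -> exists l, is_CInt f a b l.
Proof.
  intros H.
  assert (H1 : ex_RInt (fun t => fst (f t)) a b).
  { apply (@ex_RInt_continuous R_CompleteNormedModule). intros z Hz.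
    destruct (H z Hz) as [l [D _]].
    apply (@ex_derive_continuous R_AbsRing R_NormedModule); eexists; exact D. }
  assert (H2 : ex_RInt (fun t => snd (f t)) a b).
  { apply (@ex_RInt_continuous R_CompleteNormedModule). intros z Hz.
    destruct (H z Hz) as [l [_ D]].
    apply (@ex_derive_continuous R_AbsRing R_NormedModule); eexists; exact D. }
  destruct H1 as [l1 H1], H2 as [l2 H2].
  exists (l1, l2). apply is_CInt_pair; assumption.
Qed.

Lemma is_CInt_derive (f df : R -> C) (a b : R) :
  (forall t, (Rmin a b <= t <= Rmax a b)%R -> is_cderive f t (df t)) ->
  (forall t, (Rmin a b <= t <= Rmax a b)%R -> ex_cderive df t) ->
  is_CInt df a b (f b - f a).
Proof.
  intros H1 H2; apply is_CInt_pair.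
  - apply (@is_RInt_derive R_CompleteNormedModule (fun t => fst (f t)) (fun t => fst (df t))).
    + intros x Hx; apply (H1 x Hx).
    + intros x Hx. destruct (H2 x Hx) as [l [D _]].
      apply (@ex_derive_continuous R_AbsRing R_NormedModule); eexists; exact D.
  - apply (@is_RInt_derive R_CompleteNormedModule (fun t => snd (f t)) (fun t => snd (df t))).
    + intros x Hx; apply (H1 x Hx).
    + intros x Hx. destruct (H2 x Hx) as [l [_ D]].
      apply (@ex_derive_continuous R_AbsRing R_NormedModule); eexists; exact D.
Qed.

Lemma Cmod_CInt_le (f : R -> C) (g : R -> R) (a b : R) (l : C) (m : R) :
  (a <= b)%R -> (forall t, (a <= t <= b)%R -> (Cmod (f t) <= g t)%R) ->
  is_CInt f a b l -> is_RInt g a b m -> (Cmod l <= m)%R.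
Proof.
  intros Hab H Hf Hg. rewrite <- norm_C_R.
  apply (@norm_RInt_le C_R_NormedModule f g a b l m Hab); try assumption.
  intros x Hx; rewrite norm_C_R; auto.
Qed.

Lemma is_CInt_unique f a b (l m : C) : is_CInt f a b l -> is_CInt f a b m -> l = m.
Proof.
  intros H1 H2.
  rewrite <- (@is_RInt_unique C_R_CompleteNormedModule f a b l H1).
  exact (@is_RInt_unique C_R_CompleteNormedModule f a b m H2).
Qed.

Lemma is_CInt_comp_lin (f : R -> C) (u v a b : R) (l : C) :
  is_CInt f (u * a + v) (u * b + v) l -> is_CInt (fun y => RtoC u * f (u * y + v)%R) a b l.
Proof.
  intros H. eapply is_RInt_ext; [|exact (@is_RInt_comp_lin C_R_NormedModule f u v a b l H)].
  intros x _. change ((u * fst (f (u * x + v)%R), u * snd (f (u * x + v)%R))%R = RtoC u * f (u * x + v)%R).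
  apply injective_projections; simpl; ring.
Qed.

(** * Finite Taylor expansions *)

Lemma RtoC_neq_0 (x : R) : x <> 0%R -> RtoC x <> 0.
Proof. intros H E; apply H; now apply RtoC_inj. Qed.

Lemma Csum_lt_ext m f g : (forall i, (i < m)%nat -> f i = g i) -> Csum_lt m f = Csum_lt m g.
Proof.
  induction m as [|m IH]; intros H; simpl; [reflexivity|].
  rewrite IH, (H m) by auto with arith. reflexivity.
Qed.

Lemma Csum_Csum_lt m f : Csum m f = Csum_lt (S m) f.
Proof. induction m as [|m IH]; simpl; [ring|]. simpl in IH. now rewrite IH. Qed.

Lemma Csum_lt_plus m f g : Csum_lt m (fun i => f i + g i) = Csum_lt m f + Csum_lt m g.
Proof. induction m as [|m IH]; simpl; [ring|]. rewrite IH; ring. Qed.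

Lemma Csum_lt_opp m f : Csum_lt m (fun i => - f i) = - Csum_lt m f.
Proof. induction m as [|m IH]; simpl; [ring|]. rewrite IH; ring. Qed.

Lemma Csum_lt_minus m f g : Csum_lt m (fun i => f i - g i) = Csum_lt m f - Csum_lt m g.
Proof. unfold Cminus. now rewrite Csum_lt_plus, Csum_lt_opp. Qed.

Lemma Csum_lt_mult_l c m f : Csum_lt m (fun i => c * f i) = c * Csum_lt m f.
Proof. induction m as [|m IH]; simpl; [ring|]. rewrite IH; ring. Qed.

Lemma Csum_lt_mult_r c m f : Csum_lt m (fun i => f i * c) = Csum_lt m f * c.
Proof. induction m as [|m IH]; simpl; [ring|]. rewrite IH; ring. Qed.

Lemma Csum_lt_zero m (f : nat -> C) : (forall i, (i < m)%nat -> f i = 0) -> Csum_lt m f = 0.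
Proof.
  induction m as [|m IH]; intros H; simpl; [reflexivity|].
  rewrite IH, (H m) by auto with arith. ring.
Qed.

Lemma Csum_lt_S_l m f : Csum_lt (S m) f = f O + Csum_lt m (fun i => f (S i)).
Proof. induction m as [|m IH]; [simpl; ring|]. change (Csum_lt (S m) f + f (S m) = f O + (Csum_lt m (fun i => f (S i)) + f (S m))). rewrite IH; ring. Qed.

Lemma Csum_lt_exchange m p f :
  Csum_lt m (fun i => Csum_lt p (f i)) = Csum_lt p (fun j => Csum_lt m (fun i => f i j)).
Proof.
  induction m as [|m IH]; simpl.
  - symmetry; apply Csum_lt_zero; reflexivity.
  - now rewrite IH, Csum_lt_plus.
Qed.

Lemma Csum_lt_trunc m p (f : nat -> C) :
  (m <= p)%nat -> (forall i, (m <= i < p)%nat -> f i = 0) -> Csum_lt p f = Csum_lt m f.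
Proof.
  induction 1 as [|p Hp IH]; intros H; [reflexivity|].
  simpl. rewrite IH, (H p) by (intros; try apply H; lia). ring.
Qed.

Lemma Cmod_Csum_lt_le m f (b : R) :
  (forall i, (i < m)%nat -> (Cmod (f i) <= b)%R) -> (Cmod (Csum_lt m f) <= INR m * b)%R.
Proof.
  induction m as [|m IH]; intros H.
  - simpl; rewrite Cmod_0; lra.
  - rewrite S_INR. change (Csum_lt (S m) f) with (Csum_lt m f + f m).
    eapply Rle_trans; [apply Cmod_triangle|].
    assert (Cmod (Csum_lt m f) <= INR m * b)%R by (apply IH; auto with arith).
    assert (Cmod (f m) <= b)%R by auto with arith. lra.
Qed.

(** * Truncated polynomials and expansions to the right of 0 *)

Lemma RtoC_pow_S (t : R) q : RtoC (t ^ S q) = RtoC t * RtoC (t ^ q).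
Proof. simpl; apply RtoC_mult. Qed.

Definition cpoly (a : nat -> C) (Q : nat) (t : R) : C := Csum_lt Q (fun q => a q * RtoC (t ^ q)).

Lemma cpoly_S_l a Q t : cpoly a (S Q) t = a O + RtoC t * cpoly (fun q => a (S q)) Q t.
Proof.
  unfold cpoly. rewrite Csum_lt_S_l, <- Csum_lt_mult_l.
  f_equal; [simpl; ring|]. apply Csum_lt_ext; intros i _. rewrite RtoC_pow_S; ring.
Qed.

Lemma cpoly_S_r a Q t : cpoly a (S Q) t = cpoly a Q t + a Q * RtoC (t ^ Q).
Proof. reflexivity. Qed.

Lemma pow_le_1 (t : R) q : (0 <= t <= 1)%R -> (0 <= t ^ q <= 1)%R.
Proof.
  intros H; split; [apply pow_le; lra|]. rewrite <- (pow1 q). apply pow_incr; lra.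
Qed.

Lemma Cmod_RtoC_nonneg (x : R) : (0 <= x)%R -> Cmod (RtoC x) = x.
Proof. intros H; rewrite Cmod_R; now apply Rabs_pos_eq. Qed.

Lemma cpoly_bounded a Q : exists G, (0 <= G)%R /\ forall t, (0 <= t <= 1)%R -> (Cmod (cpoly a Q t) <= G)%R.
Proof.
  induction Q as [|Q [G [HG0 HG]]].
  - exists 0%R; split; [lra|]. intros; unfold cpoly; simpl; rewrite Cmod_0; lra.
  - exists (G + Cmod (a Q))%R; split; [assert (H := Cmod_ge_0 (a Q)); lra|].
    intros t Ht. rewrite cpoly_S_r. eapply Rle_trans; [apply Cmod_triangle|].
    apply Rplus_le_compat; [auto|]. rewrite Cmod_mult, Cmod_RtoC_nonneg by apply (pow_le_1 t Q Ht).
    assert (H := pow_le_1 t Q Ht). assert (H' := Cmod_ge_0 (a Q)). nra.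
Qed.

Definition conv (a b : nat -> C) (q : nat) : C := Csum q (fun j => a j * b (q - j)%nat).

Lemma conv_S a b q : conv a b (S q) = a O * b (S q) + conv (fun j => a (S j)) b q.
Proof. unfold conv. rewrite !Csum_Csum_lt, Csum_lt_S_l. reflexivity. Qed.

Lemma cpoly_plus a b Q t : cpoly (fun q => a q + b q) Q t = cpoly a Q t + cpoly b Q t.
Proof. unfold cpoly. rewrite <- Csum_lt_plus. apply Csum_lt_ext; intros; ring. Qed.

Lemma cpoly_scal c b Q t : cpoly (fun q => c * b q) Q t = c * cpoly b Q t.
Proof. unfold cpoly. rewrite <- Csum_lt_mult_l. apply Csum_lt_ext; intros; ring. Qed.

Lemma cpoly_ext a b Q t : (forall q, a q = b q) -> cpoly a Q t = cpoly b Q t.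
Proof. intros H; unfold cpoly. apply Csum_lt_ext; intros; now rewrite H. Qed.

(** Splitting [a] into its constant term and [t] times its shift leaves [t] times the defect of
    order [Q] for the shifted sequence, and one stray product with the factor [t ^ S Q]. *)
Lemma cpoly_mult a b Q :
  exists M, (0 <= M)%R /\ forall t, (0 <= t <= 1)%R ->
    (Cmod (cpoly a Q t * cpoly b Q t - cpoly (conv a b) Q t) <= M * t ^ Q)%R.
Proof.
  revert a; induction Q as [|Q IH]; intros a.
  - exists 0%R; split; [lra|]. intros t _; unfold cpoly; simpl.
    replace (0 * 0 - 0) with (RtoC 0) by ring. rewrite Cmod_0; lra.
  - destruct (IH (fun q => a (S q))) as [M [HM0 HM]].
    destruct (cpoly_bounded (fun q => a (S q)) Q) as [G [HG0 HG]].
    exists (M + Cmod (b Q) * G)%R. split; [assert (H := Cmod_ge_0 (b Q)); nra|].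
    intros t Ht.
    replace (cpoly a (S Q) t * cpoly b (S Q) t - cpoly (conv a b) (S Q) t)
      with (RtoC t * (cpoly (fun q => a (S q)) Q t * cpoly b Q t - cpoly (conv (fun q => a (S q)) b) Q t)
            + RtoC (t ^ S Q) * (b Q * cpoly (fun q => a (S q)) Q t)).
    + eapply Rle_trans; [apply Cmod_triangle|].
      rewrite !Cmod_mult, !Cmod_RtoC_nonneg by (try apply pow_le; lra).
      specialize (HM t Ht); specialize (HG t Ht).
      assert (H0 := pow_le t Q (proj1 Ht)). assert (H1 := Cmod_ge_0 (b Q)).
      assert (H2 := Cmod_ge_0 (cpoly (fun q => a (S q)) Q t)). simpl (t ^ S Q)%R.
      apply Rle_trans with (t * (M * t ^ Q) + t * t ^ Q * (Cmod (b Q) * G))%R; [|right; ring].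
      apply Rplus_le_compat; [apply Rmult_le_compat_l; lra|].
      apply Rmult_le_compat_l; [nra|]. apply Rmult_le_compat_l; lra.
    + rewrite (cpoly_S_l a), (cpoly_S_l (conv a b)).
      rewrite (cpoly_ext (fun q => conv a b (S q)) (fun q => a O * b (S q) + conv (fun j => a (S j)) b q))
        by (intros; apply conv_S).
      rewrite cpoly_plus, cpoly_scal.
      rewrite RtoC_pow_S.
      replace (conv a b 0) with (a O * b O) by (unfold conv; simpl; ring).
      assert (E1 := cpoly_S_l b Q t). assert (E2 := cpoly_S_r b Q t).
      rewrite E2 in E1. set (X := cpoly (fun q => b (S q)) Q t) in *.
      rewrite E2.
      (* The added multiple of [a O] vanishes: it compares [cpoly b (S Q) t] with its last term
         split off and with its first term split off. *)
      match goal with |- ?L = _ =>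
        transitivity (L + a O * ((cpoly b Q t + b Q * RtoC (t ^ Q)) - (b O + RtoC t * X))) end.
      * rewrite E1; ring.
      * ring.
Qed.

(** A one-sided Taylor expansion of finite order with its own radius and constant: no series has to
    converge, and [d <= 1] keeps the powers of [t] bounded. *)
Definition expands (f : R -> C) (a : nat -> C) (Q : nat) : Prop :=
  exists M d, (0 < d <= 1)%R /\ (0 <= M)%R /\
    forall t, (0 <= t <= d)%R -> (Cmod (f t - cpoly a Q t) <= M * t ^ Q)%R.

Lemma expands_ext f a b Q : (forall q, a q = b q) -> expands f a Q -> expands f b Q.
Proof.
  intros H (M & d & Hd & HM & HE). exists M, d; repeat split; try tauto.
  intros t Ht. rewrite <- (cpoly_ext a b) by assumption. auto.
Qed.

Lemma expands_bounded f a Q :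
  expands f a Q -> exists G d, (0 < d <= 1)%R /\ (0 <= G)%R /\
    forall t, (0 <= t <= d)%R -> (Cmod (f t) <= G)%R.
Proof.
  intros (M & d & Hd & HM & HE). destruct (cpoly_bounded a Q) as [G [HG0 HG]].
  exists (M + G)%R, d; repeat split; try tauto; [lra|].
  intros t Ht. replace (f t) with ((f t - cpoly a Q t) + cpoly a Q t) by ring.
  eapply Rle_trans; [apply Cmod_triangle|].
  assert (Ht1 : (0 <= t <= 1)%R) by lra.
  specialize (HE t Ht). specialize (HG t Ht1). assert (H := pow_le_1 t Q Ht1). nra.
Qed.

Lemma expands_mult f g a b Q :
  expands f a Q -> expands g b Q -> expands (fun t => f t * g t) (conv a b) Q.
Proof.
  intros Hf Hg.
  destruct (expands_bounded _ _ _ Hg) as (G & d3 & Hd3 & HG0 & HG).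
  destruct Hf as (M1 & d1 & Hd1 & HM1 & H1), Hg as (M2 & d2 & Hd2 & HM2 & H2).
  destruct (cpoly_bounded a Q) as [A [HA0 HA]].
  destruct (cpoly_mult a b Q) as [M3 [HM3 H3]].
  exists (M1 * G + A * M2 + M3)%R, (Rmin d1 (Rmin d2 d3)).
  assert (m1 := Rmin_l d1 (Rmin d2 d3)). assert (m2 := Rmin_r d1 (Rmin d2 d3)).
  assert (m3 := Rmin_l d2 d3). assert (m4 := Rmin_r d2 d3).
  repeat split.
  - repeat apply Rmin_glb_lt; lra.
  - lra.
  - nra.
  - intros t Ht. assert (Ht1 : (0 <= t <= 1)%R) by lra.
    replace (f t * g t - cpoly (conv a b) Q t) with
      ((f t - cpoly a Q t) * g t + cpoly a Q t * (g t - cpoly b Q t)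
       + (cpoly a Q t * cpoly b Q t - cpoly (conv a b) Q t)) by ring.
    specialize (H1 t ltac:(lra)). specialize (H2 t ltac:(lra)). specialize (H3 t Ht1).
    specialize (HG t ltac:(lra)). specialize (HA t Ht1).
    assert (Hp := pow_le t Q (proj1 Ht)).
    eapply Rle_trans; [apply Cmod_triangle|].
    rewrite !Rmult_plus_distr_r. apply Rplus_le_compat; [|exact H3].
    eapply Rle_trans; [apply Cmod_triangle|]. rewrite !Cmod_mult.
    apply Rplus_le_compat.
    + replace (M1 * G * t ^ Q)%R with (M1 * t ^ Q * G)%R by ring.
      apply Rmult_le_compat; auto using Cmod_ge_0.
    + rewrite Rmult_assoc. apply Rmult_le_compat; auto using Cmod_ge_0.
Qed.

Lemma expands_const c Q : expands (fun _ => c) (fun q => match q with O => c | _ => 0 end) Q.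
Proof.
  exists (Cmod c), 1%R. repeat split; try lra; [apply Cmod_ge_0|].
  intros t Ht. destruct Q as [|Q].
  - unfold cpoly; simpl. replace (c - 0) with c by ring. lra.
  - rewrite cpoly_S_l.
    replace (cpoly _ Q t) with (RtoC 0).
    + replace (c - (c + RtoC t * 0)) with (RtoC 0) by ring. rewrite Cmod_0.
      apply Rmult_le_pos; [apply Cmod_ge_0|apply pow_le; lra].
    + unfold cpoly; rewrite Csum_lt_zero; [reflexivity|intros; ring].
Qed.

(** Coefficients of the [k]-th power of a series with coefficients [kap * sig ^ j * a j]: the De
    Moivre polynomial is homogeneous of degree [k] and isobaric of weight [m], so both factors come
    out. *)
Definition Cpow_coef (a : nat -> R) (kap sig : C) (k m : nat) : C :=
  kap ^ k * sig ^ m * RtoC (deMoivre a m k).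

Lemma Csum_RtoC m (f : nat -> R) : Csum m (fun j => RtoC (f j)) = RtoC (sum_f_R0 f m).
Proof. induction m as [|m IH]; simpl; [reflexivity|]. now rewrite IH, RtoC_plus. Qed.

Lemma Csum_mult_l c m f : Csum m (fun i => c * f i) = c * Csum m f.
Proof. rewrite !Csum_Csum_lt; apply Csum_lt_mult_l. Qed.

Lemma Csum_ext m f g : (forall i, (i <= m)%nat -> f i = g i) -> Csum m f = Csum m g.
Proof. intros H; rewrite !Csum_Csum_lt; apply Csum_lt_ext; intros; apply H; lia. Qed.

(** The recursion of [deMoivre] is a Cauchy product with one more factor, which is exactly the
    induction step given by [expands_mult]. *)
Lemma expands_pow (eta : R -> C) (a : nat -> R) kap sig Q k :
  expands eta (fun j => match j with O => 0 | _ => kap * sig ^ j * RtoC (a j) end) Q ->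
  expands (fun t => (eta t) ^ k) (Cpow_coef a kap sig k) Q.
Proof.
  intros H; induction k as [|k IH].
  - eapply expands_ext; [|apply (expands_const 1)].
    intros [|q]; unfold Cpow_coef; simpl; ring.
  - eapply expands_ext; [|apply (expands_mult _ _ _ _ _ H IH)].
    intros q. unfold conv, Cpow_coef. simpl deMoivre.
    rewrite <- Csum_RtoC, <- Csum_mult_l. apply Csum_ext; intros [|j] Hj.
    + simpl Nat.eqb. cbv iota. ring.
    + change (Nat.eqb (S j) 0) with false; cbv iota. rewrite RtoC_mult.
      replace (sig ^ q) with (sig ^ S j * sig ^ (q - S j)) by (rewrite <- Cpow_add_r; f_equal; lia).
      simpl (kap ^ S k). ring.
Qed.

(** The [k]-th power of a series without constant term starts in degree [k]. This later cuts the sum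
    over [k] at [m]. *)
Lemma deMoivre_zero a m k : (m < k)%nat -> deMoivre a m k = 0%R.
Proof.
  revert m; induction k as [|k IH]; intros m Hm; [lia|].
  simpl. rewrite (sum_eq _ (fun _ => 0%R)).
  - induction m as [|m IHm]; simpl; [reflexivity|]. rewrite IHm by lia; ring.
  - intros [|i] Hi; simpl; [reflexivity|]. rewrite IH by lia. ring.
Qed.

Lemma is_cderive_pow (c : C) (q : nat) (t : R) :
  is_cderive (fun x => c * RtoC (x ^ S q)) t (c * (RtoC (INR (S q)) * RtoC (t ^ q))).
Proof.
  apply is_cderive_scal. rewrite <- RtoC_mult. apply is_cderive_RtoC.
  replace (INR (S q) * t ^ q)%R with (INR (S q) * 1 * t ^ pred (S q))%R by (simpl pred; ring).
  apply (is_derive_pow (fun x => x)), (@is_derive_id R_AbsRing).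
Qed.

(** The [t]-derivative of the remainder with [S Q] terms is [z] times the remainder with [Q] terms,
    so the mean value inequality along the segment from 0 to [z] raises the order by one. *)
Lemma Cexp_taylor_bound (z : C) Q : forall t, (0 <= t <= 1)%R ->
  (Cmod (Cexp (RtoC t * z) - Csum_lt Q (fun k => (RtoC t * z) ^ k / RtoC (INR (fact k))))%C
   <= Cmod z ^ Q * exp (Cmod z))%R.
Proof.
  induction Q as [|Q IH]; intros t Ht.
  - simpl. unfold Cminus; rewrite Copp_0, Cplus_0_r, Cmod_Cexp, Rmult_1_l.
    assert (H := Cmod_ge_0 z). assert (H1 := Cmod_fst z).
    assert (E : (fst (RtoC t * z)%C <= Cmod z)%R) by (simpl; nra).
    destruct E as [E|E]; [left; now apply exp_increasing|right; now rewrite E].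
  - set (P := fun Q t => Csum_lt Q (fun k => (RtoC t * z) ^ k / RtoC (INR (fact k)))).
    assert (HP : forall Q t, is_cderive (P (S Q)) t (z * P Q t)).
    { intros q x. induction q as [|q IHq].
      - unfold P; simpl. replace (z * 0) with (RtoC 0) by ring.
        apply is_cderive_ext with (fun _ => 1); [intros; simpl; field; apply RtoC_neq_0; lra|].
        apply is_cderive_const.
      - change (P (S (S q))) with (fun x => P (S q) x + (RtoC x * z) ^ (S q) / RtoC (INR (fact (S q)))).
        replace (z * P (S q) x) with (z * P q x + z ^ S q / RtoC (INR (fact (S q))) * RtoC (INR (S q) * x ^ q)%R).
        + apply is_cderive_plus; [exact IHq|].
          apply is_cderive_ext with (fun x => z ^ S q / RtoC (INR (fact (S q))) * RtoC (x ^ S q)).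
          { intros y. rewrite Cpow_mult_l, RtoC_pow. unfold Cdiv; ring. }
          rewrite RtoC_mult. apply is_cderive_pow.
        + change (P (S q) x) with (P q x + (RtoC x * z) ^ q / RtoC (INR (fact q))).
          rewrite Cpow_mult_l, RtoC_mult, <- RtoC_pow.
          change (fact (S q)) with (S q * fact q)%nat. rewrite mult_INR, RtoC_mult.
          simpl (z ^ S q). field.
          split; apply RtoC_neq_0; [apply INR_fact_neq_0|apply not_0_INR; lia]. }
    assert (HD := Cmod_mean_value (fun x => Cexp (RtoC x * z) - P (S Q) x)
                    (fun x => z * (Cexp (RtoC x * z) - P Q x)) 0 t (Cmod z * (Cmod z ^ Q * exp (Cmod z)))).
    assert (E0 : Cexp (RtoC 0 * z) - P (S Q) 0%R = 0).
    { replace (P (S Q) 0%R) with (RtoC 1).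
      - rewrite Cmult_0_l, Cexp_0; ring.
      - unfold P; rewrite Csum_lt_S_l. rewrite Csum_lt_zero.
        + simpl; field; apply RtoC_neq_0; lra.
        + intros i _. rewrite Cpow_mult_l. simpl. unfold Cdiv; ring. }
    cbv beta in HD. rewrite E0 in HD.
    replace (Cexp (RtoC t * z) - P (S Q) t - 0) with (Cexp (RtoC t * z) - P (S Q) t) in HD by ring.
    eapply Rle_trans; [apply HD|].
    + lra.
    + intros x Hx. replace (z * (Cexp (RtoC x * z) - P Q x)) with (z * Cexp (RtoC x * z) - z * P Q x) by ring.
      apply is_cderive_minus; [|apply HP]. apply is_cderive_Cexp.
      apply is_cderive_ext with (fun x => z * RtoC x); [intros; ring|].
      apply is_cderive_linear.
    + intros x Hx. rewrite Cmod_mult. apply Rmult_le_compat_l; [apply Cmod_ge_0|].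
      apply IH; lra.
    + assert (H := Cmod_ge_0 z). assert (H1 := exp_pos (Cmod z)). assert (H2 := pow_le _ Q H).
      simpl pow. rewrite Rminus_0_r.
      assert (0 <= Cmod z * (Cmod z ^ Q * exp (Cmod z)))%R by (repeat apply Rmult_le_pos; lra).
      nra.
Qed.

(** * The logarithm and the binomial series *)

Lemma exp_le (x y : R) : (x <= y)%R -> (exp x <= exp y)%R.
Proof. intros [H|H]; [left; now apply exp_increasing|right; now rewrite H]. Qed.

Lemma pow_le_exp (m : nat) : forall kap, (0 < kap)%R ->
  exists M, (0 <= M)%R /\ forall y, (0 <= y)%R -> (y ^ m <= M * exp (kap * y))%R.
Proof.
  induction m as [|m IH]; intros kap Hk.
  - exists 1%R; split; [lra|]. intros y Hy; simpl.
    assert (H := exp_le 0 (kap * y)). rewrite exp_0 in H. specialize (H ltac:(nra)). lra.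
  - destruct (IH (kap / 2)%R) as [M [HM0 HM]]; [lra|].
    exists (2 / kap * M)%R.
    assert (Hi : (0 < 2 / kap)%R) by (apply Rdiv_lt_0_compat; lra).
    split; [nra|]. intros y Hy; simpl.
    assert (H1 : (y <= 2 / kap * exp (kap / 2 * y))%R).
    { assert (H := exp_ineq1_le (kap / 2 * y)).
      apply Rle_trans with (2 / kap * (kap / 2 * y))%R; [right; field; lra|].
      apply Rmult_le_compat_l; lra. }
    specialize (HM y Hy).
    replace (kap * y)%R with (kap / 2 * y + kap / 2 * y)%R by field.
    rewrite exp_plus.
    apply Rle_trans with ((2 / kap * exp (kap / 2 * y)) * (M * exp (kap / 2 * y)))%R; [|right; ring].
    apply Rmult_le_compat; auto. now apply pow_le.
Qed.

Lemma pow_exp_le_inv (m p : nat) kap : (0 < kap)%R ->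
  exists M, (0 <= M)%R /\ forall y, (0 < y)%R -> (y ^ m * exp (- (kap * y)) <= M / y ^ p)%R.
Proof.
  intros Hk. destruct (pow_le_exp (m + p) kap Hk) as [M [HM0 HM]].
  exists M; split; [assumption|]. intros y Hy. specialize (HM y (Rlt_le _ _ Hy)).
  assert (Hp := pow_lt y p Hy). assert (He := exp_pos (kap * y)).
  rewrite exp_Ropp. apply Rmult_le_reg_r with (y ^ p * exp (kap * y))%R; [nra|].
  rewrite pow_add in HM.
  replace (y ^ m * / exp (kap * y) * (y ^ p * exp (kap * y)))%R with (y ^ m * y ^ p)%R by (field; lra).
  replace (M / y ^ p * (y ^ p * exp (kap * y)))%R with (M * exp (kap * y))%R by (field; lra).
  assumption.
Qed.

(** Half of the exponent absorbs the polynomial factors, by [y <= 1 + y ^ l]; the other half becomes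
    linear in [y], so that every [l] leads to the same kind of majorant. *)
Lemma pow_exp_decay (Q l : nat) kap : (0 < kap)%R -> (1 <= l)%nat ->
  exists M, (0 <= M)%R /\ forall y, (0 <= y)%R ->
    (y ^ Q * (1 + y ^ l) ^ Q * exp (- (kap * y ^ l)) <= M * exp (- (kap / 2 * y)))%R.
Proof.
  intros Hk Hl. destruct (pow_le_exp (Q + Q) (kap / 2)) as [M [HM0 HM]]; [lra|].
  (* One factor [exp (kap / 2)] comes from passing to [1 + z], the other from replacing [z] by
     [y - 1]. *)
  exists (M * exp (kap / 2) * exp (kap / 2))%R.
  split; [repeat apply Rmult_le_pos; auto using Rlt_le, exp_pos|].
  intros y Hy. set (z := (y ^ l)%R).
  assert (Hz : (0 <= z)%R) by now apply pow_le.
  assert (Hyz : (y <= 1 + z)%R).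
  { destruct (Rle_dec y 1) as [H|H]; [lra|].
    assert (y ^ 1 <= y ^ l)%R by (apply Rle_pow; [lra|lia]). unfold z; simpl in *; lra. }
  specialize (HM (1 + z)%R ltac:(lra)). rewrite pow_add in HM.
  assert (H1 : (y ^ Q <= (1 + z) ^ Q)%R) by (apply pow_incr; lra).
  assert (H2 : (0 <= (1 + z) ^ Q)%R) by (apply pow_le; lra).
  apply Rle_trans with (M * exp (kap / 2 * (1 + z)) * exp (- (kap * z)))%R.
  - apply Rmult_le_compat_r; [apply Rlt_le, exp_pos|].
    eapply Rle_trans; [|exact HM]. now apply Rmult_le_compat_r.
  - rewrite !Rmult_assoc. apply Rmult_le_compat_l; [assumption|].
    rewrite <- !exp_plus. apply exp_le. nra.
Qed.

Lemma is_RInt_exp_decay (k a b : R) : (k <> 0)%R ->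
  is_RInt (fun t => exp (- (k * t))) a b ((exp (- (k * a)) - exp (- (k * b))) / k)%R.
Proof.
  intros Hk.
  replace ((exp (- (k * a)) - exp (- (k * b))) / k)%R with
    (minus (- exp (- (k * b)) / k) (- exp (- (k * a)) / k))%R
    by (unfold minus, plus, opp; simpl; field; assumption).
  apply (@is_RInt_derive R_CompleteNormedModule (fun t => - exp (- (k * t)) / k)%R).
  - intros x _. auto_derive; [trivial|]. field; assumption.
  - intros x _. apply (@ex_derive_continuous R_AbsRing R_NormedModule). now auto_derive.
Qed.

Lemma Cmod_CInt_exp_le f (a b k M : R) (I : C) :
  (0 < k)%R -> (0 <= M)%R -> (a <= b)%R ->
  (forall t, (a <= t <= b)%R -> (Cmod (f t) <= M * exp (- (k * t)))%R) ->
  is_CInt f a b I -> (Cmod I <= M * exp (- (k * a)) / k)%R.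
Proof.
  intros Hk HM Hab H HI.
  apply Rle_trans with (M * ((exp (- (k * a)) - exp (- (k * b))) / k))%R.
  - apply (Cmod_CInt_le f (fun t => M * exp (- (k * t)))%R a b); try assumption.
    apply (@is_RInt_scal R_NormedModule), is_RInt_exp_decay; lra.
  - unfold Rdiv. rewrite Rmult_assoc. apply Rmult_le_compat_l; [assumption|].
    apply Rmult_le_compat_r; [left; now apply Rinv_0_lt_compat|].
    assert (H1 := exp_pos (- (k * b))). lra.
Qed.

Lemma Cmod_1_plus_ge (d : C) (t : R) :
  (0 <= t)%R -> (Cmod d * t <= / 2)%R -> (/ 2 <= Cmod (1 + d * RtoC t))%R.
Proof.
  intros Ht H.
  assert (H1 : (Cmod 1 <= Cmod (1 + d * RtoC t) + Cmod (d * RtoC t))%R).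
  { replace (RtoC 1) with ((1 + d * RtoC t) - d * RtoC t) at 1 by ring. apply Cmod_minus_le. }
  rewrite Cmod_1, Cmod_mult, (Cmod_RtoC_nonneg t Ht) in H1. lra.
Qed.

Definition log_poly (d : C) (N : nat) (t : R) : C :=
  Csum_lt N (fun j => d * (- d) ^ j / RtoC (INR (S j)) * RtoC (t ^ S j)).

(** A branch of log (1 + d t) is determined by its value at 0 and its derivative; this lets
    [log_shift w] and [ln (1 - t)] be treated alike. *)
Definition is_log (d : C) (L : R -> C) (r : R) : Prop :=
  L 0%R = 0 /\ forall t, (0 <= t <= r)%R -> is_cderive L t (d / (1 + d * RtoC t)).

(** A finite geometric sum. The subtracted tail is the derivative of the remainder of the
    logarithm. *)
Lemma is_cderive_log_poly d N t : 1 + d * RtoC t <> 0 ->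
  is_cderive (log_poly d N) t (d / (1 + d * RtoC t) - d * (- d) ^ N * RtoC (t ^ N) / (1 + d * RtoC t)).
Proof.
  intros Hn; induction N as [|N IH].
  - unfold log_poly; simpl.
    replace (d / _ - _) with (RtoC 0) by (field; exact Hn). apply is_cderive_const.
  - change (log_poly d (S N)) with
      (fun x => log_poly d N x + d * (- d) ^ N / RtoC (INR (S N)) * RtoC (x ^ S N)).
    replace (d / (1 + d * RtoC t) - d * (- d) ^ S N * RtoC (t ^ S N) / (1 + d * RtoC t)) with
      ((d / (1 + d * RtoC t) - d * (- d) ^ N * RtoC (t ^ N) / (1 + d * RtoC t)) +
       d * (- d) ^ N / RtoC (INR (S N)) * (RtoC (INR (S N)) * RtoC (t ^ N))).
    + apply is_cderive_plus; [exact IH|apply is_cderive_pow].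
    + rewrite RtoC_pow_S. simpl (_ ^ S N). field.
      split; [exact Hn|apply RtoC_neq_0, not_0_INR; lia].
Qed.

Lemma small_radius (d : C) (r : R) : (0 < r)%R ->
  exists e, (0 < e <= 1)%R /\ (e <= r)%R /\
    forall t, (0 <= t <= e)%R -> (/ 2 <= Cmod (1 + d * RtoC t))%R.
Proof.
  intros Hr. assert (Hd := Cmod_ge_0 d).
  assert (Hp : (0 < / (2 * Cmod d + 1))%R) by (apply Rinv_0_lt_compat; lra).
  (* The last bound forces [Cmod d * t <= / 2]; the [+ 1] in it covers [d = 0]. *)
  exists (Rmin (Rmin 1 r) (/ (2 * Cmod d + 1))).
  assert (m1 := Rmin_l (Rmin 1 r) (/ (2 * Cmod d + 1))).
  assert (m2 := Rmin_r (Rmin 1 r) (/ (2 * Cmod d + 1))).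
  assert (m3 := Rmin_l 1 r). assert (m4 := Rmin_r 1 r).
  repeat split; try lra.
  - repeat apply Rmin_glb_lt; lra.
  - intros t Ht. apply Cmod_1_plus_ge; [lra|].
    assert (t <= / (2 * Cmod d + 1))%R by lra.
    assert ((2 * Cmod d + 1) * t <= 1)%R.
    { apply Rle_trans with ((2 * Cmod d + 1) * / (2 * Cmod d + 1))%R;
        [apply Rmult_le_compat_l; lra|right; field; lra]. }
    lra.
Qed.

Lemma Cmod_div_half_le (x y : C) : (/ 2 <= Cmod y)%R -> (Cmod (x / y) <= 2 * Cmod x)%R.
Proof.
  intros Hy. rewrite Cmod_div by (apply Cmod_gt_0; lra).
  assert (Hx := Cmod_ge_0 x).
  apply Rmult_le_reg_r with (Cmod y); [lra|].
  unfold Rdiv; rewrite Rmult_assoc, Rinv_l by lra. nra.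
Qed.

Lemma log_expands d L r N : (0 < r)%R -> is_log d L r ->
  exists M e, (0 < e <= 1)%R /\ (0 <= M)%R /\ forall t, (0 <= t <= e)%R ->
    (Cmod (L t - log_poly d N t) <= M * t ^ S N)%R.
Proof.
  intros Hr [HL0 HL]. destruct (small_radius d r Hr) as [e [He [Her Hb]]].
  assert (Hd := Cmod_ge_0 d).
  exists (2 * Cmod (d * (- d) ^ N))%R, e.
  repeat split; try tauto; [assert (H := Cmod_ge_0 (d * (- d) ^ N)); lra|].
  intros t Ht.
  assert (Hn : forall x, (0 <= x <= t)%R -> 1 + d * RtoC x <> 0).
  { intros x Hx. apply Cmod_gt_0. specialize (Hb x ltac:(lra)). lra. }
  assert (H := Cmod_mean_value (fun x => L x - log_poly d N x)
    (fun x => d * (- d) ^ N * RtoC (x ^ N) / (1 + d * RtoC x)) 0 t (2 * Cmod (d * (- d) ^ N) * t ^ N)).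
  cbv beta in H.
  replace (L 0%R - log_poly d N 0) with (RtoC 0) in H.
  2: { rewrite HL0. unfold log_poly. rewrite Csum_lt_zero; [ring|].
       intros i _. simpl. rewrite Rmult_0_l. ring. }
  replace (L t - log_poly d N t - 0) with (L t - log_poly d N t) in H by ring.
  eapply Rle_trans; [apply H|].
  - lra.
  - intros x Hx.
    replace (d * (- d) ^ N * RtoC (x ^ N) / (1 + d * RtoC x)) with
      (d / (1 + d * RtoC x) - (d / (1 + d * RtoC x) - d * (- d) ^ N * RtoC (x ^ N) / (1 + d * RtoC x))) by ring.
    apply is_cderive_minus; [apply HL; lra|]. apply is_cderive_log_poly. apply Hn; lra.
  - intros x Hx. eapply Rle_trans; [apply Cmod_div_half_le, Hb; lra|].
    rewrite Cmod_mult, (Cmod_RtoC_nonneg (x ^ N)) by (apply pow_le; lra).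
    assert (x ^ N <= t ^ N)%R by (apply pow_incr; lra).
    assert (H1 := Cmod_ge_0 (d * (- d) ^ N)). nra.
  - right; simpl; ring.
Qed.

(* [log_rem d L l 0 = 0], since [/ 0 = 0] in [C]. *)
Definition log_rem (d : C) (L : R -> C) (l : nat) (t : R) : C :=
  (L t - log_poly d l t) / RtoC (t ^ l).

(** What the logarithmic series leaves after its first [l] terms: the sequence is [a2] for [l = 1]
    and [a3] for [l = 2], the origin of the two kinds of De Moivre polynomials in the
    coefficients. *)
Definition log_rem_coef (l j : nat) : R := (/ INR (j + l))%R.

Lemma Csum_lt_add m p f : Csum_lt (m + p) f = Csum_lt m f + Csum_lt p (fun i => f (m + i)%nat).
Proof.
  induction p as [|p IH]; [rewrite Nat.add_0_r; simpl; ring|].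
  rewrite Nat.add_succ_r; simpl. rewrite IH. ring.
Qed.

Lemma log_rem_expands d L r l Q : (0 < r)%R -> is_log d L r -> (1 <= l)%nat ->
  expands (log_rem d L l)
    (fun j => match j with O => 0 | _ => d * (- d) ^ (l - 1) * (- d) ^ j * RtoC (log_rem_coef l j) end) Q.
Proof.
  intros Hr HL Hl. destruct Q as [|Q].
  - destruct (log_expands d L r l Hr HL) as (M & e & He & HM & H).
    exists M, e. repeat split; try tauto. intros t Ht. unfold cpoly; simpl.
    unfold Cminus at 1; rewrite Copp_0, Cplus_0_r, Rmult_1_r.
    destruct (Req_dec t 0) as [->|Hn].
    + unfold log_rem. rewrite (proj1 HL). unfold log_poly. rewrite Csum_lt_zero.
      * unfold Cdiv, Cminus. rewrite Copp_0, Cplus_0_l, Cmult_0_l, Cmod_0. assumption.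
      * intros i _. simpl. rewrite Rmult_0_l. ring.
    + unfold log_rem. assert (Hp : (0 < t ^ l)%R) by (apply pow_lt; lra).
      rewrite Cmod_div by (apply RtoC_neq_0; lra). rewrite (Cmod_RtoC_nonneg (t ^ l)) by lra.
      apply Rle_trans with (M * t ^ S l / t ^ l)%R.
      * apply Rmult_le_compat_r; [left; now apply Rinv_0_lt_compat|auto].
      * simpl. replace (M * (t * t ^ l) / t ^ l)%R with (M * t)%R by (field; lra). nra.
  (* The remainder of order [S (l + Q)] loses [l] powers of [t] in the division and keeps exactly
     [S Q]. *)
  - destruct (log_expands d L r (l + Q) Hr HL) as (M & e & He & HM & H).
    exists M, e. repeat split; try tauto. intros t Ht.
    destruct (Req_dec t 0) as [->|Hn].
    + rewrite cpoly_S_l, Cmult_0_l. unfold log_rem. rewrite (proj1 HL). unfold log_poly.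
      rewrite Csum_lt_zero.
      * match goal with |- (Cmod ?X <= _)%R => replace X with (RtoC 0) by (unfold Cdiv; ring) end.
        rewrite Cmod_0; simpl; lra.
      * intros i _. simpl. rewrite Rmult_0_l. ring.
    + assert (Hp : (0 < t ^ l)%R) by (apply pow_lt; lra).
      assert (Hpc : RtoC (t ^ l) <> 0) by (apply RtoC_neq_0; lra).
      match goal with |- (Cmod ?X <= _)%R =>
        replace X with ((L t - log_poly d (l + Q) t) / RtoC (t ^ l)) end.
      * rewrite Cmod_div, (Cmod_RtoC_nonneg (t ^ l)) by (assumption || lra).
        apply Rle_trans with (M * t ^ S (l + Q) / t ^ l)%R.
        -- apply Rmult_le_compat_r; [left; now apply Rinv_0_lt_compat|auto].
        -- right. simpl. rewrite pow_add. field. lra.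
      * rewrite cpoly_S_l. unfold log_rem, log_poly, cpoly. rewrite Csum_lt_add.
        rewrite Cplus_0_l, <- Csum_lt_mult_l.
        replace (Csum_lt Q (fun i => d * (- d) ^ (l + i) / RtoC (INR (S (l + i))) * RtoC (t ^ S (l + i))))
          with (RtoC (t ^ l) * Csum_lt Q (fun i => RtoC t *
             (d * (- d) ^ (l - 1) * (- d) ^ S i * RtoC (log_rem_coef l (S i)) * RtoC (t ^ i)))).
        -- field; assumption.
        -- rewrite <- Csum_lt_mult_l. apply Csum_lt_ext; intros i _.
           unfold log_rem_coef. replace (S i + l)%nat with (S (l + i)) by lia.
           rewrite RtoC_inv by (apply not_0_INR; lia).
           replace ((- d) ^ (l + i)) with ((- d) ^ (l - 1) * (- d) ^ S i)
             by (rewrite <- Cpow_add_r; f_equal; lia).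
           replace (t ^ S (l + i))%R with (t * (t ^ l * t ^ i))%R by (simpl; rewrite pow_add; ring).
           rewrite !RtoC_mult. unfold Cdiv; ring.
Qed.

Lemma Cbinom_S v q : RtoC (INR (S q)) * Cbinom v (S q) = (v - RtoC (INR q)) * Cbinom v q.
Proof.
  unfold Cbinom. change (fact (S q)) with (S q * fact q)%nat.
  rewrite mult_INR, RtoC_mult. simpl fallC. field.
  split; apply RtoC_neq_0; [apply INR_fact_neq_0|apply not_0_INR; lia].
Qed.

Definition binom_coef (v d : C) (q : nat) : C := Cbinom v q * d ^ q.

(** The function (1 + d t)^v solves (1 + d t) y' = v d y; the truncated binomial series solves it up
    to a single term of top degree, because the recursion of [Cbinom] cancels all others. *)
Lemma binom_poly_derive v d Q t : exists dP,
  is_cderive (cpoly (binom_coef v d) (S Q)) t dP /\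
  (1 + d * RtoC t) * dP - v * d * cpoly (binom_coef v d) (S Q) t
  = - ((v - RtoC (INR Q)) * d * binom_coef v d Q * RtoC (t ^ Q)).
Proof.
  induction Q as [|Q [dP [HdP HE]]].
  - exists 0; split.
    + apply is_cderive_ext with (fun _ => binom_coef v d 0); [|apply is_cderive_const].
      intros x; unfold cpoly; simpl; ring.
    + unfold cpoly; simpl. ring.
  - exists (dP + binom_coef v d (S Q) * (RtoC (INR (S Q)) * RtoC (t ^ Q))); split.
    + apply is_cderive_plus; [exact HdP|apply is_cderive_pow].
    + rewrite (cpoly_S_r _ (S Q)), RtoC_pow_S.
      assert (HB : RtoC (INR (S Q)) * binom_coef v d (S Q) = (v - RtoC (INR Q)) * d * binom_coef v d Q).
      { unfold binom_coef. rewrite Cmult_assoc, Cbinom_S. simpl (d ^ S Q). ring. }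
      transitivity (((1 + d * RtoC t) * dP - v * d * cpoly (binom_coef v d) (S Q) t)
        + (1 + d * RtoC t) * RtoC (t ^ Q) * (RtoC (INR (S Q)) * binom_coef v d (S Q))
        - v * d * binom_coef v d (S Q) * (RtoC t * RtoC (t ^ Q))); [ring|].
      rewrite HE, HB.
      transitivity (d * RtoC t * RtoC (t ^ Q) * ((v - RtoC (INR Q)) * d * binom_coef v d Q)
        - v * d * binom_coef v d (S Q) * (RtoC t * RtoC (t ^ Q))); [ring|].
      rewrite <- HB. ring.
Qed.

Lemma binom_coef_0 v d : binom_coef v d 0 = 1.
Proof. unfold binom_coef, Cbinom; simpl. field. Qed.

(** With [P] the truncated series, [P] times e^{-v L} equals 1 at 0 and, by the approximate
    differential equation, has a derivative of order [t ^ Q]; the mean value inequality and a factor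
    e^{v L} finish. *)
Lemma binom_expands d L r v Q : (0 < r)%R -> is_log d L r ->
  expands (fun t => Cexp (v * L t)) (binom_coef v d) Q.
Proof.
  intros Hr HL. destruct (log_expands d L r 0 Hr HL) as (ML & e1 & He1 & HML & HLb).
  assert (Hb : forall u t, (0 <= t <= e1)%R -> (Cmod (Cexp (u * L t)) <= exp (Cmod u * ML))%R).
  { intros u t Ht. rewrite Cmod_Cexp. apply exp_le.
    eapply Rle_trans; [apply Cmod_fst|]. rewrite Cmod_mult.
    apply Rmult_le_compat_l; [apply Cmod_ge_0|].
    specialize (HLb t Ht). unfold log_poly in HLb; simpl in HLb.
    unfold Cminus in HLb; rewrite Copp_0, Cplus_0_r in HLb. nra. }
  destruct (small_radius d r Hr) as [e2 [He2 [Her Hb2]]].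
  destruct Q as [|Q].
  - exists (exp (Cmod v * ML)), e1. repeat split; try tauto; [left; apply exp_pos|].
    intros t Ht. unfold cpoly; simpl. unfold Cminus; rewrite Copp_0, Cplus_0_r, Rmult_1_r. auto.
  - set (c := (v - RtoC (INR Q)) * d * binom_coef v d Q).
    set (G := exp (Cmod v * ML)).
    assert (HG : (0 < G)%R) by apply exp_pos.
    exists (G * (2 * Cmod c * G))%R, (Rmin e1 e2).
    assert (m1 := Rmin_l e1 e2). assert (m2 := Rmin_r e1 e2).
    assert (Hc := Cmod_ge_0 c).
    repeat split; try lra; [apply Rmin_glb_lt; lra|nra|].
    intros t Ht.
    set (P := cpoly (binom_coef v d) (S Q)).
    set (H := fun x => P x * Cexp (- v * L x)).
    assert (HD : forall x, (0 <= x <= t)%R -> exists dH, is_cderive H x dH /\ (Cmod dH <= 2 * Cmod c * G * t ^ Q)%R).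
    { intros x Hx. destruct (binom_poly_derive v d Q x) as [dP [HdP HE]].
      assert (Hn : 1 + d * RtoC x <> 0).
      { apply Cmod_gt_0. specialize (Hb2 x ltac:(lra)). lra. }
      eexists; split.
      - apply is_cderive_mult; [exact HdP|]. apply is_cderive_Cexp, is_cderive_scal.
        apply (proj2 HL); lra.
      - fold P in HE. fold c in HE. cbv beta.
        replace (dP * Cexp (- v * L x) + P x * (- v * (d / (1 + d * RtoC x)) * Cexp (- v * L x)))
          with (((1 + d * RtoC x) * dP - v * d * P x) / (1 + d * RtoC x) * Cexp (- v * L x))
          by (field; exact Hn).
        rewrite HE, Cmod_mult.
        apply Rle_trans with (2 * (Cmod c * t ^ Q) * G)%R; [|right; ring].
        apply Rmult_le_compat; try apply Cmod_ge_0.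
        + eapply Rle_trans; [apply Cmod_div_half_le, Hb2; lra|].
          rewrite Cmod_opp, Cmod_mult, (Cmod_RtoC_nonneg (x ^ Q)) by (apply pow_le; lra).
          assert (x ^ Q <= t ^ Q)%R by (apply pow_incr; lra). nra.
        + unfold G. rewrite <- (Cmod_opp v). apply Hb; lra. }
    assert (HH : (Cmod (H t - H 0%R) <= 2 * Cmod c * G * t ^ Q * (t - 0))%R).
    (* [Cmod_mean_value] takes a derivative function; [Derive] yields one from pointwise existence,
       without choice. *)
    { assert (Hch : exists dH, forall x, (0 <= x <= t)%R ->
         is_cderive H x (dH x) /\ (Cmod (dH x) <= 2 * Cmod c * G * t ^ Q)%R).
      { exists (fun x => (Derive (fun y => fst (H y)) x, Derive (fun y => snd (H y)) x)).
        intros x Hx. destruct (HD x Hx) as [dH [[D1 D2] B]]. cbv beta.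
        replace (_, _) with dH; [exact (conj (conj D1 D2) B)|].
        apply injective_projections; symmetry; apply is_derive_unique; assumption. }
      destruct Hch as [dH HdH].
      apply (Cmod_mean_value H dH); [lra| |]; intros x Hx; apply HdH; lra. }
    assert (H0 : H 0%R = 1).
    { unfold H, P. rewrite (proj1 HL), cpoly_S_l, Cmult_0_l, binom_coef_0, Cmult_0_r, Cexp_0. ring. }
    rewrite H0 in HH.
    replace (Cexp (v * L t) - P t) with (- (Cexp (v * L t) * (H t - 1))).
    + rewrite Cmod_opp, Cmod_mult, Rmult_assoc.
      apply Rmult_le_compat; try apply Cmod_ge_0; [apply Hb; lra|].
      eapply Rle_trans; [exact HH|]. right; simpl; ring.
    + unfold H. assert (E : Cexp (v * L t) * Cexp (- v * L t) = 1).
      { rewrite <- Cexp_plus. replace (v * L t + - v * L t) with (RtoC 0) by ring. apply Cexp_0. }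
      transitivity (Cexp (v * L t) - P t * (Cexp (v * L t) * Cexp (- v * L t))); [ring|].
      rewrite E; ring.
Qed.

(** * Laplace's method *)

(** Coefficient of [t ^ q] in the product of the [k]-th power of [log_rem] and (1 + d t)^v. *)
Definition laplace_coef (l : nat) (v d : C) (q k : nat) : C :=
  conv (Cpow_coef (log_rem_coef l) (d * (- d) ^ (l - 1)) (- d) k) (binom_coef v d) q.

Lemma expands_family_uniform (f : nat -> R -> C) (a : nat -> nat -> C) Q m :
  (forall k, (k < m)%nat -> expands (f k) (a k) Q) ->
  exists M e, (0 < e <= 1)%R /\ (0 <= M)%R /\ forall k t, (k < m)%nat -> (0 <= t <= e)%R ->
    (Cmod (f k t - cpoly (a k) Q t) <= M * t ^ Q)%R.
Proof.
  induction m as [|m IH]; intros H.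
  - exists 0%R, 1%R. repeat split; try lra. intros; lia.
  - destruct IH as (M1 & e1 & He1 & HM1 & H1); [auto with arith|].
    destruct (H m) as (M2 & e2 & He2 & HM2 & H2); [lia|].
    assert (m1 := Rmin_l e1 e2). assert (m2 := Rmin_r e1 e2).
    assert (m3 := Rmax_l M1 M2). assert (m4 := Rmax_r M1 M2).
    exists (Rmax M1 M2), (Rmin e1 e2). repeat split; try lra; [apply Rmin_glb_lt; lra|].
    intros k t Hk Ht. assert (Hp := pow_le t Q (proj1 Ht)).
    destruct (Nat.eq_dec k m) as [->|].
    + specialize (H2 t ltac:(lra)). nra.
    + specialize (H1 k t ltac:(lia) ltac:(lra)). nra.
Qed.

(** The exponential series is cut after [Q] terms with a remainder governed by |x eta| <= B t x, and
    each power of eta is cut at degree [Q]. Both errors carry [t ^ Q]; the growth in [x] is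
    polynomial up to [exp (kap * x)] with [kap] at will. *)
Lemma integrand_expands d L r v l Q kap : (0 < r)%R -> is_log d L r -> (1 <= l)%nat -> (0 < kap)%R ->
  exists M e, (0 < e <= 1)%R /\ (e <= r)%R /\ (0 <= M)%R /\
  forall t x, (0 <= t <= e)%R -> (0 <= x)%R ->
    (Cmod (Cexp (RtoC x * log_rem d L l t) * Cexp (v * L t)
       - Csum_lt Q (fun k => RtoC (x ^ k) / RtoC (INR (fact k)) * cpoly (fun q => laplace_coef l v d q k) Q t))%C
     <= M * t ^ Q * (1 + x) ^ Q * exp (kap * x))%R.
Proof.
  intros Hr HL Hl Hk.
  (* Order 1 with vanishing constant term: [log_rem] is at most [B * t]. *)
  destruct (log_rem_expands d L r l 1 Hr HL Hl) as (B & e1 & He1 & HB & H1).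
  destruct (expands_bounded _ _ _ (binom_expands d L r v 0 Hr HL)) as (G & e2 & He2 & HG & H2).
  destruct (expands_family_uniform (fun k t => log_rem d L l t ^ k * Cexp (v * L t))
    (fun k q => laplace_coef l v d q k) Q Q) as (M3 & e3 & He3 & HM3 & H3).
  { intros k _. apply expands_mult; [|now apply binom_expands with r].
    apply expands_pow. now apply log_rem_expands with r. }
  assert (Hkb : (0 < kap / (B + 1))%R) by (apply Rdiv_lt_0_compat; lra).
  (* The bound [kap / (B + 1)] on the radius gives [B * t <= kap], which turns the growth of the
     exponential remainder into [exp (kap * x)]. *)
  set (e := Rmin (Rmin e1 (Rmin e2 e3)) (Rmin r (kap / (B + 1)))).
  assert (m1 := Rmin_l (Rmin e1 (Rmin e2 e3)) (Rmin r (kap / (B + 1)))).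
  assert (m2 := Rmin_r (Rmin e1 (Rmin e2 e3)) (Rmin r (kap / (B + 1)))).
  assert (m3 := Rmin_l e1 (Rmin e2 e3)). assert (m4 := Rmin_r e1 (Rmin e2 e3)).
  assert (m5 := Rmin_l e2 e3). assert (m6 := Rmin_r e2 e3).
  assert (m7 := Rmin_l r (kap / (B + 1))). assert (m8 := Rmin_r r (kap / (B + 1))).
  fold e in m1, m2.
  assert (He0 : (0 < e)%R) by (unfold e; repeat apply Rmin_glb_lt; lra).
  assert (HBe : (B * e <= kap)%R).
  { apply Rle_trans with ((B + 1) * (kap / (B + 1)))%R; [|right; field; lra].
    apply Rmult_le_compat; lra. }
  exists (B ^ Q * G + INR Q * M3)%R, e.
  assert (HBQ := pow_le B Q HB). assert (HQ := pos_INR Q).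
  repeat split; try lra; [nra|].
  intros t x Ht Hx. set (z := RtoC x * log_rem d L l t).
  assert (Hz : (Cmod z <= B * t * x)%R).
  { unfold z. rewrite Cmod_mult, (Cmod_RtoC_nonneg x Hx).
    specialize (H1 t ltac:(lra)). unfold cpoly in H1; simpl in H1.
    replace (log_rem d L l t - _) with (log_rem d L l t) in H1 by ring. nra. }
  assert (Hx1 : (1 <= (1 + x) ^ Q)%R) by (apply pow_R1_Rle; lra).
  assert (Het : (1 <= exp (kap * x))%R).
  { rewrite <- exp_0. apply exp_le. nra. }
  assert (Htq := pow_le t Q (proj1 Ht)).
  assert (HA : (Cmod (Cexp z - Csum_lt Q (fun k => z ^ k / RtoC (INR (fact k))))%C
             <= B ^ Q * t ^ Q * (1 + x) ^ Q * exp (kap * x))%R).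
  { assert (HT := Cexp_taylor_bound z Q 1 ltac:(lra)).
    rewrite Cmult_1_l in HT. eapply Rle_trans; [exact HT|].
    apply Rmult_le_compat; [apply pow_le, Cmod_ge_0|left; apply exp_pos| |].
    - rewrite <- !Rpow_mult_distr. apply pow_incr. split; [apply Cmod_ge_0|].
      eapply Rle_trans; [exact Hz|]. apply Rmult_le_compat_l; nra.
    - apply exp_le. eapply Rle_trans; [exact Hz|]. apply Rmult_le_compat_r; nra. }
  match goal with |- (Cmod ?X <= _)%R =>
    replace X with ((Cexp z - Csum_lt Q (fun k => z ^ k / RtoC (INR (fact k)))) * Cexp (v * L t)
      + Csum_lt Q (fun k => RtoC (x ^ k) / RtoC (INR (fact k)) *
          (log_rem d L l t ^ k * Cexp (v * L t) - cpoly (fun q => laplace_coef l v d q k) Q t))) end.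
  - eapply Rle_trans; [apply Cmod_triangle|].
    rewrite !Rmult_plus_distr_r. apply Rplus_le_compat.
    + rewrite Cmod_mult. specialize (H2 t ltac:(lra)).
      replace (B ^ Q * G * t ^ Q * (1 + x) ^ Q * exp (kap * x))%R with
        ((B ^ Q * t ^ Q * (1 + x) ^ Q * exp (kap * x)) * G)%R by ring.
      apply Rmult_le_compat; auto using Cmod_ge_0.
    + replace (INR Q * M3 * t ^ Q * (1 + x) ^ Q * exp (kap * x))%R with
        (INR Q * ((1 + x) ^ Q * (M3 * t ^ Q) * exp (kap * x)))%R by ring.
      apply Cmod_Csum_lt_le. intros k Hkq. rewrite Cmod_mult.
      specialize (H3 k t Hkq ltac:(lra)).
      apply Rle_trans with ((1 + x) ^ Q * (M3 * t ^ Q))%R.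
      * apply Rmult_le_compat; auto using Cmod_ge_0.
        rewrite Cmod_div by (apply RtoC_neq_0, INR_fact_neq_0).
        rewrite !Cmod_RtoC_nonneg by (try apply pos_INR; now apply pow_le).
        assert (Hf : (1 <= INR (fact k))%R).
        { replace 1%R with (INR 1) by reflexivity. apply le_INR, lt_O_fact. }
        apply Rle_trans with (x ^ k)%R.
        -- assert (Hxk := pow_le x k Hx). apply Rmult_le_reg_r with (INR (fact k)); [lra|].
           unfold Rdiv; rewrite Rmult_assoc, Rinv_l by lra. nra.
        -- apply Rle_trans with ((1 + x) ^ k)%R; [apply pow_incr; lra|].
           apply Rle_pow; [lra|lia].
      * assert (0 <= (1 + x) ^ Q * (M3 * t ^ Q))%R by (repeat apply Rmult_le_pos; lra). nra.
  - rewrite (Csum_lt_ext Q (fun k => RtoC (x ^ k) / RtoC (INR (fact k)) *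
          (log_rem d L l t ^ k * Cexp (v * L t) - cpoly (fun q => laplace_coef l v d q k) Q t))
      (fun k => z ^ k / RtoC (INR (fact k)) * Cexp (v * L t) -
         RtoC (x ^ k) / RtoC (INR (fact k)) * cpoly (fun q => laplace_coef l v d q k) Q t)).
    + rewrite Csum_lt_minus, Csum_lt_mult_r. ring.
    + intros k _. unfold z. rewrite Cpow_mult_l, <- RtoC_pow. unfold Cdiv; ring.
Qed.

Definition approx_int (e : R) (p : nat) (f : R -> R -> C) (T : R -> C) : Prop :=
  exists M, (0 <= M)%R /\ forall nu, (1 <= nu)%R ->
    exists I : C, is_CInt (f nu) 0 e I /\ (Cmod (I - T nu) <= M / nu ^ p)%R.

Lemma approx_int_sum e p m (f : nat -> R -> R -> C) (T : nat -> R -> C) :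
  (forall k, (k < m)%nat -> approx_int e p (f k) (T k)) ->
  approx_int e p (fun nu t => Csum_lt m (fun k => f k nu t)) (fun nu => Csum_lt m (fun k => T k nu)).
Proof.
  induction m as [|m IH]; intros H.
  - exists 0%R; split; [lra|]. intros nu Hnu; exists (RtoC 0); split.
    + apply is_CInt_RtoC. assert (K := @is_RInt_const R_NormedModule 0 e 0%R).
      change (is_RInt (fun _ => 0%R) 0 e ((e - 0) * 0)%R) in K.
      rewrite Rmult_0_r in K; exact K.
    + simpl. replace (0 - 0) with (RtoC 0) by ring. rewrite Cmod_0. unfold Rdiv; lra.
  - destruct IH as [M1 [HM1 H1]]; [auto with arith|]. destruct (H m) as [M2 [HM2 H2]]; [lia|].
    exists (M1 + M2)%R; split; [lra|]. intros nu Hnu.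
    destruct (H1 nu Hnu) as [I1 [HI1 B1]], (H2 nu Hnu) as [I2 [HI2 B2]].
    exists (I1 + I2); split; [now apply is_CInt_cplus|].
    simpl. replace (_ - _) with ((I1 - Csum_lt m (fun k => T k nu)) + (I2 - T m nu)) by ring.
    eapply Rle_trans; [apply Cmod_triangle|]. unfold Rdiv in *. lra.
Qed.

(** [mu s] is the integral of u^s e^{-c u^l} over the half-line, after u = nu t. Asking for
    truncated integrals with exponentially small error avoids improper integrals and makes the value
    independent of [e]. *)
Definition has_moments (l : nat) (c : C) (mu : nat -> C) : Prop :=
  forall s e, (0 < e)%R -> exists M kap, (0 < kap)%R /\ (0 <= M)%R /\ forall nu, (1 <= nu)%R ->
    exists I : C, is_CInt (fun t => RtoC (t ^ s) * Cexp (- (c * RtoC ((nu * t) ^ l)))) 0 e I /\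
      (Cmod (I - mu s / RtoC (nu ^ S s)) <= M * exp (- (kap * nu)))%R.

(** The factor [nu ^ (l * k)] is compensated by the moment of order [l * k + q], so the power of
    [nu] depends on [q] alone. The exponentially small errors of the moments survive multiplication
    by [nu ^ (l * k)]. *)
Lemma laplace_main_terms l c mu v d Q e : has_moments l c mu -> (0 < e)%R ->
  approx_int e (S Q)
    (fun nu t => Csum_lt Q (fun k => Csum_lt Q (fun q =>
       RtoC (nu ^ (l * k)) / RtoC (INR (fact k)) * laplace_coef l v d q k *
       (RtoC (t ^ (l * k + q)) * Cexp (- (c * RtoC ((nu * t) ^ l)))))))
    (fun nu => Csum_lt Q (fun k => Csum_lt Q (fun q =>
       laplace_coef l v d q k / RtoC (INR (fact k)) * mu (l * k + q)%nat / RtoC (nu ^ S q)))).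
Proof.
  intros Hm He.
  apply (approx_int_sum e (S Q) Q (fun k nu t => Csum_lt Q (fun q =>
       RtoC (nu ^ (l * k)) / RtoC (INR (fact k)) * laplace_coef l v d q k *
       (RtoC (t ^ (l * k + q)) * Cexp (- (c * RtoC ((nu * t) ^ l))))))
    (fun k nu => Csum_lt Q (fun q =>
       laplace_coef l v d q k / RtoC (INR (fact k)) * mu (l * k + q)%nat / RtoC (nu ^ S q)))).
  intros k _.
  apply (approx_int_sum e (S Q) Q (fun q nu t =>
       RtoC (nu ^ (l * k)) / RtoC (INR (fact k)) * laplace_coef l v d q k *
       (RtoC (t ^ (l * k + q)) * Cexp (- (c * RtoC ((nu * t) ^ l)))))
    (fun q nu => laplace_coef l v d q k / RtoC (INR (fact k)) * mu (l * k + q)%nat / RtoC (nu ^ S q))).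
  intros q _.
  destruct (Hm (l * k + q)%nat e He) as (M & kap & Hk & HM & H).
  destruct (pow_exp_le_inv (l * k) (S Q) kap Hk) as [M' [HM' H']].
  assert (Hfk : RtoC (INR (fact k)) <> 0) by (apply RtoC_neq_0, INR_fact_neq_0).
  set (A := laplace_coef l v d q k / RtoC (INR (fact k))).
  assert (HA := Cmod_ge_0 A).
  exists (Cmod A * M * M')%R; split; [repeat apply Rmult_le_pos; lra|].
  intros nu Hnu. destruct (H nu Hnu) as [I [HI HB]].
  exists (RtoC (nu ^ (l * k)) / RtoC (INR (fact k)) * laplace_coef l v d q k * I); split.
  - now apply is_CInt_cmult.
  - assert (Hn0 : (0 < nu)%R) by lra.
    replace (_ - _) with (A * RtoC (nu ^ (l * k)) * (I - mu (l * k + q)%nat / RtoC (nu ^ S (l * k + q)))).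
    + rewrite !Cmod_mult, (Cmod_RtoC_nonneg (nu ^ (l * k))) by (apply pow_le; lra).
      specialize (H' nu Hn0). assert (Hp := pow_le nu (l * k) (Rlt_le _ _ Hn0)).
      apply Rle_trans with (Cmod A * nu ^ (l * k) * (M * exp (- (kap * nu))))%R.
      * apply Rmult_le_compat_l; [nra|exact HB].
      * replace (Cmod A * nu ^ (l * k) * (M * exp (- (kap * nu))))%R with
          (Cmod A * M * (nu ^ (l * k) * exp (- (kap * nu))))%R by ring.
        unfold Rdiv in *. rewrite (Rmult_assoc (Cmod A * M)). apply Rmult_le_compat_l; [nra|exact H'].
    + unfold A. assert (N1 : RtoC nu <> 0) by (apply RtoC_neq_0; lra).
      replace (nu ^ S (l * k + q))%R with (nu ^ (l * k) * nu ^ S q)%R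
        by (rewrite <- pow_add; f_equal; lia).
      rewrite RtoC_mult. field. repeat split; try assumption; apply RtoC_neq_0, pow_nonzero; lra.
Qed.

Lemma log_rem_eq d L r l t : is_log d L r -> (1 <= l)%nat ->
  L t = log_poly d l t + RtoC (t ^ l) * log_rem d L l t.
Proof.
  intros HL Hl. destruct (Req_dec t 0) as [->|Hn].
  - rewrite pow_i by lia. rewrite (proj1 HL). unfold log_poly. rewrite Csum_lt_zero; [ring|].
    intros i _. simpl. rewrite Rmult_0_l. ring.
  - unfold log_rem. field. apply RtoC_neq_0, pow_nonzero, Hn.
Qed.

(** The range is cut at the radius [e] of the local expansion. [D] describes the admissible upper
    ends, and the bound does not depend on the upper end [A], so a limit in [A] may be taken
    afterwards. The condition on [log_poly] says that the phase starts with -c t^l. *)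
Lemma laplace_expansion (l : nat) (b c d v : C) (L : R -> C) (r : R) (mu : nat -> C) (D : R -> Prop) Q :
  (1 <= l)%nat -> (0 < fst c)%R -> (0 < r)%R -> is_log d L r -> has_moments l c mu ->
  (forall t, log_poly d l t - b * RtoC t = - (c * RtoC (t ^ l))) ->
  (forall x y, (0 <= x <= y)%R -> D y -> D x) ->
  (forall e, (0 < e)%R -> exists M kap N, (0 < kap)%R /\ (0 <= M)%R /\
     forall nu t, (N <= nu)%R -> (e <= t)%R -> D t ->
     (Cmod (Cexp (RtoC (nu ^ l) * (L t - b * RtoC t) + v * L t)) <= M * exp (- (kap * nu * t)))%R) ->
  exists M N e, (0 < e <= r)%R /\ forall nu A I, (N <= nu)%R -> (e <= A)%R -> D A ->
    is_CInt (fun t => Cexp (RtoC (nu ^ l) * (L t - b * RtoC t) + v * L t)) 0 A I ->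
    (Cmod (I - Csum_lt Q (fun q =>
        Csum_lt Q (fun k => laplace_coef l v d q k / RtoC (INR (fact k)) * mu (l * k + q)%nat)
        / RtoC (nu ^ S q)))%C <= M / nu ^ S Q)%R.
Proof.
  intros Hl Hc Hr HL Hmu Hb HD Htail.
  (* Half of Re c pays for the factor e^{kap x}; the other half is left to [pow_exp_decay]. *)
  destruct (integrand_expands d L r v l Q (fst c / 2) Hr HL Hl) as (M1 & e & He & Her & HM1 & H1); [lra|].
  destruct (laplace_main_terms l c mu v d Q e Hmu (proj1 He)) as [M2 [HM2 H2]].
  destruct (Htail e (proj1 He)) as (M3 & k3 & N3 & Hk3 & HM3 & H3).
  destruct (pow_exp_decay Q l (fst c / 2)) as [M4 [HM4 H4]]; [lra|assumption|].
  destruct (pow_exp_le_inv 0 (S Q) (k3 * e)) as [M5 [HM5 H5]]; [apply Rmult_lt_0_compat; lra|].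
  set (k4 := (fst c / 2 / 2)%R) in *.
  assert (Hk4 : (0 < k4)%R) by (unfold k4; lra).
  exists (M1 * M4 / k4 + M2 + M3 * M5 / k3)%R, (Rmax 1 N3), e. split; [lra|].
  intros nu A I Hnu HA HDA HI.
  assert (n1 := Rmax_l 1 N3). assert (n2 := Rmax_r 1 N3).
  set (f := fun t => Cexp (RtoC (nu ^ l) * (L t - b * RtoC t) + v * L t)) in *.
  destruct (H2 nu ltac:(lra)) as [I2 [HI2 B2]].
  assert (Hex : @ex_RInt C_R_NormedModule f 0 A) by now exists I.
  destruct (@ex_RInt_Chasles_1 C_R_CompleteNormedModule f 0 e A ltac:(lra) Hex) as [Ia HIa].
  destruct (@ex_RInt_Chasles_2 C_R_CompleteNormedModule f 0 e A ltac:(lra) Hex) as [Ib HIb].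
  assert (EI : I = Ia + Ib).
  { apply (is_CInt_unique f 0 A); [exact HI|].
    exact (@is_RInt_Chasles C_R_NormedModule f 0 e A Ia Ib HIa HIb). }
  assert (Hn0 : (0 < nu)%R) by lra.
  assert (HpS := pow_lt nu (S Q) Hn0). assert (HpQ := pow_lt nu Q Hn0).
  assert (Bb : (Cmod Ib <= M3 * M5 / k3 / nu ^ S Q)%R).
  { assert (HB := Cmod_CInt_exp_le f e A (k3 * nu) M3 Ib).
    eapply Rle_trans; [apply HB; try assumption|].
    - apply Rmult_lt_0_compat; lra.
    - intros t Ht. apply H3; try lra. apply HD with A; [lra|assumption].
    - specialize (H5 nu Hn0). simpl pow in H5 at 1. rewrite Rmult_1_l in H5.
      replace (k3 * nu * e)%R with (k3 * e * nu)%R by ring.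
      apply Rle_trans with (M3 * (M5 / nu ^ S Q) / (k3 * 1))%R.
      + unfold Rdiv at 1 3. apply Rmult_le_compat.
        * apply Rmult_le_pos; [assumption|left; apply exp_pos].
        * left; apply Rinv_0_lt_compat, Rmult_lt_0_compat; lra.
        * now apply Rmult_le_compat_l.
        * apply Rinv_le_contravar; nra.
      + right. field. split; lra. }
  assert (Ba : (Cmod (Ia - I2) <= M1 * M4 / k4 / nu ^ S Q)%R).
  { eapply Rle_trans.
    (* Rewriting [t ^ Q] through nu t gives the factor 1 / nu^Q, and integrating the remaining
       linear exponential gives one more 1 / nu. *)
    - eapply (Cmod_CInt_exp_le _ 0 e (k4 * nu) (M1 * M4 / nu ^ Q) (Ia - I2)).
      + apply Rmult_lt_0_compat; lra.
      + apply Rmult_le_pos; [nra|left; now apply Rinv_0_lt_compat].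
      + lra.
      + 2: exact (is_CInt_cminus _ _ _ _ _ _ HIa HI2).
        intros t Ht. cbv beta. unfold f. clear HI2 HIa HIb HI.
        set (x := ((nu * t) ^ l)%R).
        assert (Hx : (0 <= x)%R) by (apply pow_le; nra).
        assert (E1 : Cexp (RtoC (nu ^ l) * (L t - b * RtoC t) + v * L t) =
           Cexp (- (c * RtoC x)) * (Cexp (RtoC x * log_rem d L l t) * Cexp (v * L t))).
        { rewrite <- !Cexp_plus. f_equal. unfold x. rewrite Rpow_mult_distr, RtoC_mult.
          rewrite (log_rem_eq d L r l t HL Hl) at 1.
          replace (log_poly d l t + RtoC (t ^ l) * log_rem d L l t - b * RtoC t) with
            ((log_poly d l t - b * RtoC t) + RtoC (t ^ l) * log_rem d L l t) by ring.
          rewrite Hb. ring. }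
        assert (E2 : Csum_lt Q (fun k => Csum_lt Q (fun q =>
            RtoC (nu ^ (l * k)) / RtoC (INR (fact k)) * laplace_coef l v d q k *
            (RtoC (t ^ (l * k + q)) * Cexp (- (c * RtoC x))))) =
          Cexp (- (c * RtoC x)) * Csum_lt Q (fun k => RtoC (x ^ k) / RtoC (INR (fact k)) *
             cpoly (fun q => laplace_coef l v d q k) Q t)).
        { rewrite <- Csum_lt_mult_l. apply Csum_lt_ext; intros k _. unfold cpoly.
          rewrite <- !Csum_lt_mult_l. apply Csum_lt_ext; intros q _.
          replace (x ^ k)%R with (nu ^ (l * k) * t ^ (l * k))%R
            by (unfold x; rewrite <- pow_mult, Rpow_mult_distr; reflexivity).
          rewrite pow_add, !RtoC_mult. unfold Cdiv; ring. }
        rewrite E2, E1.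
        match goal with |- (Cmod (?u * ?a - ?u * ?b) <= _)%R =>
          replace (u * a - u * b) with (u * (a - b)) by ring end.
        rewrite Cmod_mult, Cmod_Cexp.
        replace (fst (- (c * RtoC x))) with (- (fst c * x))%R by (simpl; ring).
        specialize (H1 t x Ht Hx). specialize (H4 (nu * t)%R ltac:(nra)). fold x in H4.
        eapply Rle_trans; [apply Rmult_le_compat_l; [left; apply exp_pos|exact H1]|].
        replace (- (fst c * x))%R with (- (fst c / 2 * x) + - (fst c / 2 * x))%R by field.
        rewrite exp_plus.
        assert (E3 : (exp (- (fst c / 2 * x)) * exp (fst c / 2 * x) = 1)%R).
        { rewrite <- exp_plus, Rplus_opp_l. apply exp_0. }
        rewrite Rpow_mult_distr in H4.
        apply Rle_trans with (M1 / nu ^ Q * (nu ^ Q * t ^ Q * (1 + x) ^ Q * exp (- (fst c / 2 * x))))%R.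
        * right. transitivity (M1 * t ^ Q * (1 + x) ^ Q * exp (- (fst c / 2 * x)) *
             (exp (- (fst c / 2 * x)) * exp (fst c / 2 * x)))%R; [ring|].
          rewrite E3. field. lra.
        * replace (M1 * M4 / nu ^ Q * exp (- (k4 * nu * t)))%R with
            (M1 / nu ^ Q * (M4 * exp (- (fst c / 2 / 2 * (nu * t)))))%R.
          -- apply Rmult_le_compat_l; [|exact H4].
             apply Rmult_le_pos; [assumption|left; now apply Rinv_0_lt_compat].
          -- unfold k4. replace (fst c / 2 / 2 * nu * t)%R with (fst c / 2 / 2 * (nu * t))%R by ring.
             field. lra.
    - rewrite Rmult_0_r, Ropp_0, exp_0, Rmult_1_r. right. simpl. field. repeat split; lra. }
  rewrite EI.
  match goal with |- (Cmod (_ - ?T) <= _)%R => replace T with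
    (Csum_lt Q (fun k => Csum_lt Q (fun q =>
       laplace_coef l v d q k / RtoC (INR (fact k)) * mu (l * k + q)%nat / RtoC (nu ^ S q)))) end.
  - replace (Ia + Ib - _) with ((Ia - I2) + (I2 - Csum_lt Q (fun k => Csum_lt Q (fun q =>
       laplace_coef l v d q k / RtoC (INR (fact k)) * mu (l * k + q)%nat / RtoC (nu ^ S q)))) + Ib) by ring.
    eapply Rle_trans; [apply Cmod_triangle|].
    unfold Rdiv in *. rewrite !Rmult_plus_distr_r. apply Rplus_le_compat; [|exact Bb].
    eapply Rle_trans; [apply Cmod_triangle|]. apply Rplus_le_compat; assumption.
  - rewrite Csum_lt_exchange. apply Csum_lt_ext; intros q _.
    unfold Cdiv at 3. rewrite <- Csum_lt_mult_r. apply Csum_lt_ext; intros; reflexivity.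
Qed.

(** * Moments and the Gaussian integral *)

Definition has_moment (l : nat) (c : C) (s : nat) (m : C) : Prop :=
  forall e, (0 < e)%R -> exists M kap, (0 < kap)%R /\ (0 <= M)%R /\ forall nu, (1 <= nu)%R ->
    exists I : C, is_CInt (fun t => RtoC (t ^ s) * Cexp (- (c * RtoC ((nu * t) ^ l)))) 0 e I /\
      (Cmod (I - m / RtoC (nu ^ S s)) <= M * exp (- (kap * nu)))%R.

Lemma is_cderive_Cexp_pow l c nu t :
  is_cderive (fun x => Cexp (- (c * RtoC ((nu * x) ^ S l)))) t
    (- (c * RtoC (INR (S l) * nu ^ S l * t ^ l)) * Cexp (- (c * RtoC ((nu * t) ^ S l)))).
Proof.
  apply is_cderive_Cexp, is_cderive_opp, is_cderive_scal, is_cderive_RtoC.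
  replace (INR (S l) * nu ^ S l * t ^ l)%R with (INR (S l) * nu * (nu * t) ^ pred (S l))%R
    by (simpl pred; rewrite Rpow_mult_distr; simpl; ring).
  apply (is_derive_pow (fun x => nu * x)%R). auto_derive; [trivial|ring].
Qed.

Lemma ex_CInt_pow_exp l c s nu a b :
  exists I, is_CInt (fun t => RtoC (t ^ s) * Cexp (- (c * RtoC ((nu * t) ^ S l)))) a b I.
Proof.
  apply ex_CInt. intros t _. eexists. apply is_cderive_mult; [|apply is_cderive_Cexp_pow].
  apply is_cderive_RtoC, Derive_correct. auto_derive; trivial.
Qed.

Lemma Cmod_boundary_le (c : C) l nu e : (0 < fst c)%R -> (0 < e)%R -> (1 <= nu)%R ->
  (Cmod (Cexp (- (c * RtoC ((nu * e) ^ S l)))) <= exp (- (fst c * e ^ S l * nu)))%R.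
Proof.
  intros Hc He Hn. rewrite Cmod_Cexp. apply exp_le.
  replace (fst (- (c * RtoC ((nu * e) ^ S l)))) with (- (fst c * (nu * e) ^ S l))%R
    by (generalize ((nu * e) ^ S l)%R; intros x; simpl; ring).
  assert (Hp := pow_lt e (S l) He).
  assert (Hn1 : (nu <= nu ^ S l)%R).
  { rewrite <- (pow_1 nu) at 1. apply Rle_pow; [lra|lia]. }
  rewrite Rpow_mult_distr.
  assert (0 <= fst c * e ^ S l)%R by nra.
  replace (fst c * (nu ^ S l * e ^ S l))%R with (fst c * e ^ S l * nu ^ S l)%R by ring.
  apply Ropp_le_contravar. apply Rmult_le_compat_l; assumption.
Qed.

Lemma C_coef_neq_0 (c : C) l : (0 < fst c)%R -> c * RtoC (INR (S l)) <> 0.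
Proof.
  intros Hc. apply Cmult_neq_0; [|apply RtoC_neq_0, not_0_INR; lia].
  intros E; rewrite E in Hc; simpl in Hc; lra.
Qed.

(** One power below the exponent [S l], the integrand is a multiple of the derivative of the
    exponential; only a boundary term at [e] remains. *)
Lemma has_moment_base l (c : C) : (0 < fst c)%R -> has_moment (S l) c l (/ (c * RtoC (INR (S l)))).
Proof.
  intros Hc e He. assert (Hcl := C_coef_neq_0 c l Hc).
  set (cl := c * RtoC (INR (S l))) in *. assert (Hm := proj1 (Cmod_gt_0 _) Hcl).
  exists (/ Cmod cl)%R, (fst c * e ^ S l)%R.
  split; [apply Rmult_lt_0_compat; [assumption|now apply pow_lt]|].
  split; [left; now apply Rinv_0_lt_compat|]. intros nu Hn.
  destruct (ex_CInt_pow_exp l c l nu 0 e) as [I HI]. exists I; split; [exact HI|].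
  assert (Hnz : RtoC (nu ^ S l) <> 0) by (apply RtoC_neq_0, pow_nonzero; lra).
  set (E := fun t => Cexp (- (c * RtoC ((nu * t) ^ S l)))).
  assert (H1 : is_CInt (fun t => - (cl * RtoC (nu ^ S l)) * (RtoC (t ^ l) * E t)) 0 e (E e - E 0%R)).
  { apply (is_CInt_derive E).
    - intros t _. eapply is_cderive_eq; [apply is_cderive_Cexp_pow|].
      unfold E, cl. rewrite !RtoC_mult. ring.
    - intros t _. eexists. apply is_cderive_scal.
      apply is_cderive_mult; [|apply is_cderive_Cexp_pow].
      apply is_cderive_RtoC, Derive_correct. auto_derive; trivial. }
  assert (H2 := is_CInt_unique _ _ _ _ _ H1 (is_CInt_cmult (- (cl * RtoC (nu ^ S l))) _ _ _ _ HI)).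
  assert (E0 : E 0%R = 1).
  { unfold E. rewrite Rmult_0_r, pow_i by lia. rewrite Cmult_0_r.
    replace (- 0) with (RtoC 0) by ring. apply Cexp_0. }
  rewrite E0 in H2.
  replace (I - / cl / RtoC (nu ^ S l)) with (- (E e / (cl * RtoC (nu ^ S l)))).
  - rewrite Cmod_opp, Cmod_div by (now apply Cmult_neq_0). rewrite Cmod_mult.
    rewrite (Cmod_RtoC_nonneg (nu ^ S l)) by (apply pow_le; lra).
    assert (Hb := Cmod_boundary_le c l nu e Hc He Hn). fold (E e) in Hb.
    assert (Hp : (1 <= nu ^ S l)%R) by (apply pow_R1_Rle; lra).
    rewrite (Rmult_comm (/ Cmod cl)). unfold Rdiv. apply Rmult_le_compat; auto using Cmod_ge_0.
    + left; apply Rinv_0_lt_compat; nra.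
    + apply Rinv_le_contravar; nra.
  - replace (E e) with (1 + - (cl * RtoC (nu ^ S l)) * I) by (rewrite <- H2; ring).
    field. split; assumption.
Qed.

(** Integration by parts applied to t^{s+1} times the exponential; the boundary term at [e] is
    exponentially small and joins the error. *)
Lemma has_moment_step l (c : C) s m : (0 < fst c)%R -> has_moment (S l) c s m ->
  has_moment (S l) c (s + S l) (RtoC (INR (S s)) / (c * RtoC (INR (S l))) * m).
Proof.
  intros Hc Hs e He. destruct (Hs e He) as (M & kap & Hk & HM & H).
  assert (Hcl := C_coef_neq_0 c l Hc).
  set (cl := c * RtoC (INR (S l))) in *. assert (Hm := proj1 (Cmod_gt_0 _) Hcl).
  assert (Hi := Rinv_0_lt_compat _ Hm).
  set (k2 := (fst c * e ^ S l)%R).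
  assert (Hk2 : (0 < k2)%R) by (apply Rmult_lt_0_compat; [assumption|now apply pow_lt]).
  assert (Hss := pos_INR (S s)). assert (Hes := pow_lt e (S s) He).
  exists (/ Cmod cl * (INR (S s) * M + e ^ S s))%R, (Rmin kap k2).
  split; [now apply Rmin_glb_lt|]. split; [apply Rmult_le_pos; nra|].
  intros nu Hn. destruct (H nu Hn) as [I [HI HB]].
  destruct (ex_CInt_pow_exp l c (s + S l) nu 0 e) as [J HJ]. exists J; split; [exact HJ|].
  assert (Hnz : RtoC (nu ^ S l) <> 0) by (apply RtoC_neq_0, pow_nonzero; lra).
  assert (Hns : RtoC (nu ^ S s) <> 0) by (apply RtoC_neq_0, pow_nonzero; lra).
  set (E := fun t => Cexp (- (c * RtoC ((nu * t) ^ S l)))).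
  set (F := fun t => RtoC (t ^ S s) * E t).
  assert (H1 : is_CInt (fun t => RtoC (INR (S s)) * (RtoC (t ^ s) * E t)
      - cl * RtoC (nu ^ S l) * (RtoC (t ^ (s + S l)) * E t)) 0 e (F e - F 0%R)).
  { apply (is_CInt_derive F).
    - intros t _. eapply is_cderive_eq.
      + apply is_cderive_mult; [|apply is_cderive_Cexp_pow].
        eapply is_cderive_ext; [|apply (is_cderive_pow 1)]. intros; apply Cmult_1_l.
      + unfold E, cl. replace (s + S l)%nat with (S s + l)%nat by lia.
        rewrite pow_add, !RtoC_mult. ring.
    - intros t _. eexists. apply is_cderive_minus; apply is_cderive_scal;
      (apply is_cderive_mult; [|apply is_cderive_Cexp_pow]);
      apply is_cderive_RtoC, Derive_correct; auto_derive; trivial. }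
  assert (H2 := is_CInt_unique _ _ _ _ _ H1 (is_CInt_cminus _ _ _ _ _ _
     (is_CInt_cmult (RtoC (INR (S s))) _ _ _ _ HI) (is_CInt_cmult (cl * RtoC (nu ^ S l)) _ _ _ _ HJ))).
  assert (F0 : F 0%R = 0) by (unfold F; rewrite pow_i by lia; ring).
  rewrite F0 in H2.
  set (D := I - m / RtoC (nu ^ S s)) in *.
  replace (J - _) with ((RtoC (INR (S s)) * D - F e) / (cl * RtoC (nu ^ S l))).
  - rewrite Cmod_div by (now apply Cmult_neq_0). rewrite Cmod_mult.
    rewrite (Cmod_RtoC_nonneg (nu ^ S l)) by (apply pow_le; lra).
    assert (Hb := Cmod_boundary_le c l nu e Hc He Hn). fold (E e) in Hb. fold k2 in Hb.
    assert (Hp : (1 <= nu ^ S l)%R) by (apply pow_R1_Rle; lra).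
    replace (/ Cmod cl * (INR (S s) * M + e ^ S s) * exp (- (Rmin kap k2 * nu)))%R with
      ((INR (S s) * M + e ^ S s) * exp (- (Rmin kap k2 * nu)) * / Cmod cl)%R by ring.
    unfold Rdiv. apply Rmult_le_compat; auto using Cmod_ge_0.
    + left; apply Rinv_0_lt_compat; nra.
    + eapply Rle_trans; [apply Cmod_minus_le|]. rewrite Rmult_plus_distr_r.
      assert (m1 := Rmin_l kap k2). assert (m2 := Rmin_r kap k2).
      apply Rplus_le_compat.
      * rewrite Cmod_mult, (Cmod_RtoC_nonneg (INR (S s))) by assumption.
        rewrite Rmult_assoc. apply Rmult_le_compat_l; [assumption|].
        eapply Rle_trans; [exact HB|]. apply Rmult_le_compat_l; [assumption|]. apply exp_le; nra.
      * unfold F. rewrite Cmod_mult, (Cmod_RtoC_nonneg (e ^ S s)) by lra.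
        apply Rmult_le_compat_l; [lra|]. eapply Rle_trans; [exact Hb|]. apply exp_le; nra.
    + apply Rinv_le_contravar; nra.
  - replace (F e) with (RtoC (INR (S s)) * I - cl * RtoC (nu ^ S l) * J) by (rewrite <- H2; ring).
    unfold D. replace (nu ^ S (s + S l))%R with (nu ^ S s * nu ^ S l)%R
      by (rewrite <- pow_add; f_equal; lia).
    rewrite RtoC_mult. field. repeat split; assumption.
Qed.

Lemma has_moments_linear (c : C) : (0 < fst c)%R ->
  has_moments 1 c (fun s => RtoC (INR (fact s)) / c ^ S s).
Proof.
  intros Hc s. assert (Hn : c <> 0) by (intros E; rewrite E in Hc; simpl in Hc; lra).
  change (has_moment 1 c s (RtoC (INR (fact s)) / c ^ S s)).
  induction s as [|s IH].
  - replace (RtoC (INR (fact 0)) / c ^ 1) with (/ (c * RtoC (INR 1))); [now apply has_moment_base|].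
    simpl. field. exact Hn.
  - replace (S s) with (s + 1)%nat at 1 by lia.
    replace (RtoC (INR (fact (S s))) / c ^ S (S s)) with
      (RtoC (INR (S s)) / (c * RtoC (INR 1)) * (RtoC (INR (fact s)) / c ^ S s)).
    + now apply has_moment_step.
    + change (fact (S s)) with (S s * fact s)%nat. rewrite mult_INR, RtoC_mult.
      simpl (c ^ S (S s)). simpl (c ^ S s). simpl (INR 1). field.
      split; [now apply Cpow_nz|exact Hn].
Qed.

(** * Differentiation under the integral sign *)

Lemma is_derive_quadratic (f : R -> R) (t l K : R) :
  (forall h, (Rabs h <= 1)%R -> (Rabs (f (t + h) - f t - h * l) <= K * (h * h))%R) -> is_derive f t l.
Proof.
  intros H. apply is_derive_Reals. intros eps He.
  assert (HK : (0 <= K)%R).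
  { specialize (H 1%R). rewrite Rabs_R1 in H. specialize (H ltac:(lra)).
    assert (A := Rabs_pos (f (t + 1) - f t - 1 * l)%R). lra. }
  assert (Hd : (0 < Rmin 1 (eps / (K + 1)))%R).
  { apply Rmin_glb_lt; [lra|apply Rdiv_lt_0_compat; lra]. }
  exists (mkposreal _ Hd). intros h Hh0 Hh. simpl in Hh.
  assert (m1 := Rmin_l 1 (eps / (K + 1))). assert (m2 := Rmin_r 1 (eps / (K + 1))).
  specialize (H h ltac:(lra)).
  assert (Ha := Rabs_pos_lt h Hh0).
  replace ((f (t + h) - f t) / h - l)%R with ((f (t + h) - f t - h * l) / h)%R by (field; assumption).
  rewrite Rabs_div by assumption.
  replace (h * h)%R with (Rabs h * Rabs h)%R in H by (rewrite <- Rabs_mult; apply Rabs_pos_eq; nra).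
  apply Rle_lt_trans with (K * Rabs h)%R.
  - apply Rmult_le_reg_r with (Rabs h); [assumption|].
    unfold Rdiv; rewrite Rmult_assoc, Rinv_l by lra. lra.
  - apply Rle_lt_trans with ((K + 1) * Rabs h - Rabs h)%R; [right; ring|].
    assert ((K + 1) * Rabs h <= (K + 1) * (eps / (K + 1)))%R by (apply Rmult_le_compat_l; lra).
    replace ((K + 1) * (eps / (K + 1)))%R with eps in H0 by (field; lra). lra.
Qed.

Lemma is_cderive_quadratic (f : R -> C) (t : R) (l : C) (K : R) :
  (forall h, (Rabs h <= 1)%R -> (Cmod (f (t + h)%R - f t - RtoC h * l) <= K * (h * h))%R) ->
  is_cderive f t l.
Proof.
  intros H; split; apply is_derive_quadratic with K; intros h Hh.
  - eapply Rle_trans; [|apply (H h Hh)].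
    eapply Rle_trans; [|apply re_le_Cmod]. right; f_equal. simpl; ring.
  - eapply Rle_trans; [|apply (H h Hh)].
    eapply Rle_trans; [|apply Cmod_snd]. right; f_equal. simpl; ring.
Qed.

(** The second order Taylor bound of the exponential is uniform in [z], so it integrates to a
    quadratic bound in [h], and [is_cderive_quadratic] concludes. *)
Lemma is_cderive_exp_param (al g : R -> C) (A G : R) (K K1 : R -> C) :
  (forall z, (0 <= z <= 1)%R -> (Cmod (al z) <= A)%R /\ (Cmod (g z) <= G)%R) ->
  (forall tau, is_CInt (fun z => Cexp (RtoC tau * al z) * g z) 0 1 (K tau)) ->
  (forall tau, is_CInt (fun z => al z * (Cexp (RtoC tau * al z) * g z)) 0 1 (K1 tau)) ->
  forall tau, is_cderive K tau (K1 tau).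
Proof.
  intros Hb HK HK1 tau.
  assert (HA : (0 <= A)%R).
  { eapply Rle_trans; [apply Cmod_ge_0|apply (Hb 0%R); lra]. }
  assert (HG : (0 <= G)%R).
  { eapply Rle_trans; [apply Cmod_ge_0|apply (Hb 0%R); lra]. }
  apply is_cderive_quadratic with (exp (Rabs tau * A) * G * (A * A * exp A))%R.
  intros h Hh.
  assert (HI := is_CInt_cminus _ _ _ _ _ _ (is_CInt_cminus _ _ _ _ _ _ (HK (tau + h)%R) (HK tau))
     (is_CInt_cmult (RtoC h) _ _ _ _ (HK1 tau))).
  cbv beta in HI.
  set (B := (exp (Rabs tau * A) * G * (A * A * exp A) * (h * h))%R).
  replace B with ((1 - 0) * B)%R by ring.
  eapply (Cmod_CInt_le _ (fun _ => B) 0 1); [lra| |exact HI|apply (@is_RInt_const R_NormedModule)].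
  intros z Hz. destruct (Hb z Hz) as [Ha Hg]. cbv beta.
  replace (_ - _) with (Cexp (RtoC tau * al z) * g z * (Cexp (RtoC h * al z) - (1 + RtoC h * al z))).
  2: { rewrite RtoC_plus, Cmult_plus_distr_r, Cexp_plus. ring. }
  assert (HT := Cexp_taylor_bound (RtoC h * al z) 2 1 ltac:(lra)).
  rewrite Cmult_1_l in HT.
  replace (Csum_lt 2 _) with (1 + RtoC h * al z) in HT by (simpl; field).
  rewrite !Cmod_mult.
  assert (Hma : (Cmod (RtoC h * al z) <= Rabs h * A)%R).
  { rewrite Cmod_mult, Cmod_R. apply Rmult_le_compat_l; [apply Rabs_pos|exact Ha]. }
  assert (Hr := Rabs_pos h).
  unfold B. rewrite 4!Rmult_assoc. apply Rmult_le_compat.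
  - rewrite Cmod_Cexp; left; apply exp_pos.
  - apply Rmult_le_pos; apply Cmod_ge_0.
  - rewrite Cmod_Cexp. apply exp_le. eapply Rle_trans; [apply Cmod_fst|].
    rewrite Cmod_mult, Cmod_R. apply Rmult_le_compat_l; [apply Rabs_pos|exact Ha].
  - apply Rmult_le_compat; try apply Cmod_ge_0; [exact Hg|].
    eapply Rle_trans; [exact HT|].
    assert (H0 := Cmod_ge_0 (RtoC h * al z)).
    apply Rle_trans with ((Rabs h * A) ^ 2 * exp A)%R.
    + apply Rmult_le_compat; [apply pow_le, Cmod_ge_0|left; apply exp_pos| |].
      * apply pow_incr; lra.
      * apply exp_le; nra.
    + replace (h * h)%R with (Rabs h * Rabs h)%R by (rewrite <- Rabs_mult; apply Rabs_pos_eq; nra).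
      right; ring.
Qed.

(** * The Gaussian integral *)

Definition gauss (x : R) : R := RInt (fun t => exp (- (t ^ 2 / 2))) 0 x.

Lemma is_RInt_gauss a b : is_RInt (fun t => exp (- (t ^ 2 / 2))) a b (RInt (fun t => exp (- (t ^ 2 / 2))) a b).
Proof.
  apply (@RInt_correct R_CompleteNormedModule), (@ex_RInt_continuous R_CompleteNormedModule).
  intros z _. apply (@ex_derive_continuous R_AbsRing R_NormedModule). auto_derive; trivial.
Qed.

Lemma is_derive_gauss x : is_derive gauss x (exp (- (x ^ 2 / 2))).
Proof.
  apply (@is_derive_RInt R_NormedModule (fun t => exp (- (t ^ 2 / 2))) gauss 0 x).
  - apply filter_forall. intros y. apply is_RInt_gauss.
  - apply (@ex_derive_continuous R_AbsRing R_NormedModule). auto_derive; trivial.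
Qed.

(** The companion function in the elementary evaluation of the Gaussian integral. Differentiating in
    [p] removes the denominator, and at p = x^2 / 2 the scaling t = x s turns the result into a
    multiple of [gauss x]; at p = 0 it is an arctangent integral. *)
Definition gauss_aux (p : R) : R := RInt (fun s => exp (- (p * (1 + s ^ 2))) * / (1 + s ^ 2))%R 0 1.

Lemma is_RInt_gauss_aux p :
  is_RInt (fun s => exp (- (p * (1 + s ^ 2))) * / (1 + s ^ 2))%R 0 1 (gauss_aux p).
Proof.
  apply (@RInt_correct R_CompleteNormedModule), (@ex_RInt_continuous R_CompleteNormedModule).
  intros z _. apply (@ex_derive_continuous R_AbsRing R_NormedModule). auto_derive; simpl; nra.
Qed.

Lemma is_RInt_gauss_aux1 p :
  is_RInt (fun s => - (exp (- (p * (1 + s ^ 2)))))%R 0 1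
    (RInt (fun s => - (exp (- (p * (1 + s ^ 2)))))%R 0 1).
Proof.
  apply (@RInt_correct R_CompleteNormedModule), (@ex_RInt_continuous R_CompleteNormedModule).
  intros z _. apply (@ex_derive_continuous R_AbsRing R_NormedModule). auto_derive; trivial.
Qed.

Lemma is_derive_gauss_aux p :
  is_derive gauss_aux p (RInt (fun s => - (exp (- (p * (1 + s ^ 2)))))%R 0 1).
Proof.
  destruct (is_cderive_exp_param (fun z => RtoC (- (1 + z ^ 2))) (fun z => RtoC (/ (1 + z ^ 2)))
    2 1 (fun p => RtoC (gauss_aux p))
    (fun p => RtoC (RInt (fun s => - (exp (- (p * (1 + s ^ 2)))))%R 0 1))) with (tau := p) as [H _].
  - intros z Hz. rewrite !Cmod_R. split.
    + rewrite Rabs_Ropp, Rabs_pos_eq; nra.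
    + assert (1 <= 1 + z ^ 2)%R by nra. rewrite Rabs_pos_eq.
      * apply Rle_trans with (/ 1)%R; [apply Rinv_le_contravar; lra|right; apply Rinv_1].
      * left; apply Rinv_0_lt_compat; lra.
  - intros tau. eapply is_RInt_ext; [|apply is_CInt_RtoC, is_RInt_gauss_aux].
    intros x _. cbv beta. rewrite <- RtoC_mult, Cexp_RtoC, <- RtoC_mult. do 3 f_equal. ring.
  - intros tau. eapply is_RInt_ext; [|apply is_CInt_RtoC, is_RInt_gauss_aux1].
    intros x _. cbv beta. rewrite <- RtoC_mult, Cexp_RtoC, <- !RtoC_mult. f_equal.
    replace (- (tau * (1 + x ^ 2)))%R with (tau * - (1 + x ^ 2))%R by ring. field. nra.
  - exact H.
Qed.

Lemma gauss_aux_0 : gauss_aux 0 = (PI / 4)%R.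
Proof.
  apply (@is_RInt_unique R_CompleteNormedModule).
  replace (PI / 4)%R with (minus (atan 1) (atan 0))
    by (unfold minus, plus, opp; simpl; rewrite atan_1, atan_0; ring).
  apply (@is_RInt_derive R_CompleteNormedModule atan).
  - intros x _. replace (exp (- (0 * (1 + x ^ 2))) * / (1 + x ^ 2))%R with (/ (1 + x ^ 2))%R.
    + rewrite <- Rsqr_pow2. apply is_derive_atan.
    + rewrite Rmult_0_l, Ropp_0, exp_0. ring.
  - intros x _. apply (@ex_derive_continuous R_AbsRing R_NormedModule). auto_derive; simpl; nra.
Qed.

(* The left-hand side has zero derivative and equals [2 * (PI / 4)] at [x = 0]. *)
Lemma gauss_identity x : (0 <= x)%R -> (gauss x ^ 2 + 2 * gauss_aux (x ^ 2 / 2) = PI / 2)%R.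
Proof.
  intros Hx.
  set (Phi := fun x => (gauss x ^ 2 + 2 * gauss_aux (x ^ 2 / 2))%R).
  assert (E0 : Phi 0%R = (PI / 2)%R).
  { unfold Phi, gauss. rewrite (@RInt_point R_CompleteNormedModule).
    replace (0 ^ 2 / 2)%R with 0%R by field. rewrite gauss_aux_0. unfold zero; simpl. field. }
  assert (HD : forall y, is_derive Phi y 0%R).
  { intros y.
    replace 0%R with (INR 2 * exp (- (y ^ 2 / 2)) * gauss y ^ 1 +
       2 * (y * RInt (fun s => - (exp (- (y ^ 2 / 2 * (1 + s ^ 2)))))%R 0 1))%R.
    - apply (@is_derive_plus R_AbsRing R_NormedModule (fun x => gauss x ^ 2)%R
        (fun x => 2 * gauss_aux (x ^ 2 / 2))%R).
      + apply (is_derive_pow gauss 2), is_derive_gauss.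
      + apply is_derive_scal.
        apply (is_derive_comp gauss_aux (fun x => x ^ 2 / 2)%R); [apply is_derive_gauss_aux|].
        auto_derive; [trivial|field].
    - assert (H1 : is_RInt (fun s => y * exp (- ((y * s + 0) ^ 2 / 2)))%R 0 1 (gauss y)).
      { apply (@is_RInt_comp_lin R_NormedModule (fun t => exp (- (t ^ 2 / 2))) y 0 0 1 (gauss y)).
        rewrite Rmult_0_r, Rmult_1_r, !Rplus_0_r. apply is_RInt_gauss. }
      assert (H2 : is_RInt (fun s => y * - (exp (- (y ^ 2 / 2 * (1 + s ^ 2)))))%R 0 1
         (- exp (- (y ^ 2 / 2)) * gauss y)%R).
      { eapply is_RInt_ext; [|apply (@is_RInt_scal R_NormedModule _ _ _ (- exp (- (y ^ 2 / 2)))%R _ H1)].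
        intros s _. unfold scal; simpl; unfold mult; simpl.
        replace (- (y * (y * 1) / 2 * (1 + s * (s * 1))))%R with
          (- (y * (y * 1) / 2) + - ((y * s + 0) * ((y * s + 0) * 1) / 2))%R by field.
        rewrite exp_plus. ring. }
      assert (H3 := @is_RInt_scal R_NormedModule _ _ _ y _ (is_RInt_gauss_aux1 (y ^ 2 / 2))).
      assert (H4 : (y * RInt (fun s => - (exp (- (y ^ 2 / 2 * (1 + s ^ 2)))))%R 0 1
                    = - exp (- (y ^ 2 / 2)) * gauss y)%R).
      { rewrite <- (@is_RInt_unique R_CompleteNormedModule _ _ _ _ H2). symmetry.
        exact (@is_RInt_unique R_CompleteNormedModule _ _ _ _ H3). }
      rewrite H4. simpl. ring. }
  destruct Hx as [Hx|<-]; [|exact E0].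
  rewrite <- E0. symmetry. apply (eq_is_derive Phi 0 x); [|assumption].
  intros t _. apply HD.
Qed.

Lemma gauss_aux_bounds p : (0 <= p)%R -> (0 <= gauss_aux p <= exp (- p))%R.
Proof.
  intros Hp. split.
  - apply (is_RInt_ge_0 (fun s => exp (- (p * (1 + s ^ 2))) * / (1 + s ^ 2))%R 0 1); [lra|apply is_RInt_gauss_aux|].
    intros x _. apply Rmult_le_pos; [left; apply exp_pos|left; apply Rinv_0_lt_compat; nra].
  - replace (exp (- p)) with ((1 - 0) * exp (- p))%R by ring.
    apply (is_RInt_le (fun s => exp (- (p * (1 + s ^ 2))) * / (1 + s ^ 2))%R (fun _ => exp (- p)) 0 1);
      [lra|apply is_RInt_gauss_aux|apply (@is_RInt_const R_NormedModule)|].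
    intros x _. assert (H1 : (1 <= 1 + x ^ 2)%R) by nra.
    rewrite <- (Rmult_1_r (exp (- p))). apply Rmult_le_compat.
    + left; apply exp_pos.
    + left; apply Rinv_0_lt_compat; lra.
    + apply exp_le. nra.
    + rewrite <- Rinv_1. apply Rinv_le_contravar; lra.
Qed.

(** By [gauss_identity] the difference times the sum of sqrt (PI / 2) and [gauss x] is
    [2 * gauss_aux (x ^ 2 / 2)], and the sum is at least 1. *)
Lemma gauss_limit_bound x : (0 <= x)%R -> (Rabs (gauss x - sqrt (PI / 2)) <= 2 * exp (- (x ^ 2 / 2)))%R.
Proof.
  intros Hx. assert (E := gauss_identity x Hx).
  assert (B := gauss_aux_bounds (x ^ 2 / 2)). specialize (B ltac:(nra)).
  assert (HG : (0 <= gauss x)%R).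
  { apply (is_RInt_ge_0 (fun t => exp (- (t ^ 2 / 2))) 0 x); [assumption|apply is_RInt_gauss|].
    intros; left; apply exp_pos. }
  assert (HP := PI2_1).
  assert (HS := sqrt_sqrt (PI / 2) ltac:(lra)).
  assert (H1 : (1 <= sqrt (PI / 2))%R) by (rewrite <- sqrt_1 at 1; apply sqrt_le_1; lra).
  assert (H2 : ((sqrt (PI / 2) - gauss x) * (sqrt (PI / 2) + gauss x) = 2 * gauss_aux (x ^ 2 / 2))%R) by nra.
  assert (H3 : (0 <= sqrt (PI / 2) - gauss x)%R) by nra.
  rewrite Rabs_minus_sym, Rabs_pos_eq by assumption. nra.
Qed.

Lemma has_moment_gauss : has_moment 2 (RtoC (/ 2)) 0 (RtoC (sqrt (PI / 2))).
Proof.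
  (* The 2 is that of [gauss_limit_bound]; the rate [e ^ 2 / 2] uses (nu e)^2 >= nu e^2 for nu >=
     1. *)
  intros e He. exists 2%R, (e ^ 2 / 2)%R.
  split; [apply Rdiv_lt_0_compat; [now apply pow_lt|lra]|]. split; [lra|].
  intros nu Hn. exists (RtoC (gauss (nu * e) / nu)). split.
  - assert (H1 : is_RInt (fun s => / nu * (nu * exp (- ((nu * s + 0) ^ 2 / 2))))%R 0 e (/ nu * gauss (nu * e))%R).
    { apply (@is_RInt_scal R_NormedModule).
      apply (@is_RInt_comp_lin R_NormedModule (fun t => exp (- (t ^ 2 / 2))) nu 0 0 e (gauss (nu * e))).
      rewrite Rmult_0_r, !Rplus_0_r. apply is_RInt_gauss. }
    replace (gauss (nu * e) / nu)%R with (/ nu * gauss (nu * e))%R by (unfold Rdiv; ring).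
    eapply is_RInt_ext; [|apply is_CInt_RtoC, H1].
    intros x _. cbv beta. rewrite <- RtoC_mult, <- RtoC_opp, Cexp_RtoC, <- RtoC_mult. f_equal.
    replace (- (/ 2 * (nu * x) ^ 2))%R with (- ((nu * x + 0) ^ 2 / 2))%R by field.
    simpl. field. lra.
  - rewrite pow_1, <- RtoC_div by lra. rewrite <- RtoC_minus, Cmod_R.
    replace (gauss (nu * e) / nu - sqrt (PI / 2) / nu)%R with ((gauss (nu * e) - sqrt (PI / 2)) / nu)%R
      by (field; lra).
    rewrite Rabs_div, (Rabs_pos_eq nu) by lra.
    assert (B := gauss_limit_bound (nu * e) ltac:(nra)).
    apply Rle_trans with (2 * exp (- ((nu * e) ^ 2 / 2)) / 1)%R.
    + apply Rmult_le_compat; [apply Rabs_pos|left; apply Rinv_0_lt_compat; lra|exact B|].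
      apply Rinv_le_contravar; lra.
    + rewrite Rdiv_1_r. apply Rmult_le_compat_l; [lra|]. apply exp_le.
      assert (0 <= (nu - 1) * nu * (e * e))%R by (apply Rmult_le_pos; nra). simpl; nra.
Qed.

(** Moments of e^{-u^2/2} on the half-line. For [s = 0] the truncated subtraction yields
    [dfact 0 = 1], which is (-1)!!. *)
Definition gauss_moment (s : nat) : C :=
  RtoC (INR (dfact (s - 1)) * (if Nat.even s then sqrt (PI / 2) else 1)).

Lemma has_moments_gauss : has_moments 2 (RtoC (/ 2)) gauss_moment.
Proof.
  intros s. change (has_moment 2 (RtoC (/ 2)) s (gauss_moment s)).
  assert (H2 : (0 < fst (RtoC (/ 2)))%R) by (simpl; lra).
  assert (Hz : RtoC (/ 2) * RtoC (INR 2) = 1).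
  { rewrite <- RtoC_mult. f_equal. simpl; field. }
  (* The recursion advances by 2, so consecutive moments are proved in pairs: the Gaussian integral
     starts the even ones, an explicit primitive the odd ones. *)
  assert (H : has_moment 2 (RtoC (/ 2)) s (gauss_moment s) /\
              has_moment 2 (RtoC (/ 2)) (S s) (gauss_moment (S s))); [|apply H].
  induction s as [|s [IH1 IH2]].
  - split.
    + unfold gauss_moment; simpl. rewrite Rmult_1_l. apply has_moment_gauss.
    + replace (gauss_moment 1) with (/ (RtoC (/ 2) * RtoC (INR 2))); [now apply has_moment_base|].
      rewrite Hz. unfold gauss_moment; simpl. rewrite Rmult_1_l. field.
  - split; [exact IH2|].
    replace (S (S s)) with (s + 2)%nat at 1 by lia.
    replace (gauss_moment (S (S s))) with (RtoC (INR (S s)) / (RtoC (/ 2) * RtoC (INR 2)) * gauss_moment s).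
    + now apply has_moment_step.
    + rewrite Hz. unfold gauss_moment.
      replace (S (S s) - 1)%nat with (S s) by lia. change (Nat.even (S (S s))) with (Nat.even s).
      replace (INR (dfact (S s))) with (INR (S s) * INR (dfact (s - 1)))%R.
      * rewrite !RtoC_mult. field.
      * rewrite <- mult_INR. f_equal. destruct s as [|s]; [reflexivity|].
        replace (S s - 1)%nat with s by lia. reflexivity.
Qed.

(** * Incomplete gamma integrals *)

(* [Rcpow 0 s = 1] because [ln 0 = 0]; the continuous extension needs the case distinction. *)
Definition rpow (s : C) (z : R) : C := if Rlt_dec 0 z then Rcpow z s else 0.

Lemma rpow_pos s z : (0 < z)%R -> rpow s z = Cexp (s * RtoC (ln z)).
Proof. intros H; unfold rpow; destruct (Rlt_dec 0 z); [reflexivity|lra]. Qed.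

Lemma rpow_1 s : rpow s 1 = 1.
Proof. rewrite rpow_pos by lra. now rewrite ln_1, Cmult_0_r, Cexp_0. Qed.

Lemma rpow_mult s x y : (0 < x)%R -> rpow s (x * y) = Cexp (s * RtoC (ln x)) * rpow s y.
Proof.
  intros Hx. destruct (Rlt_dec 0 y) as [Hy|Hy].
  - rewrite !rpow_pos by (try apply Rmult_lt_0_compat; assumption).
    rewrite ln_mult by assumption. rewrite RtoC_plus, Cmult_plus_distr_l. apply Cexp_plus.
  - unfold rpow. destruct (Rlt_dec 0 (x * y)) as [H|H]; [|destruct (Rlt_dec 0 y); [lra|ring]].
    exfalso. apply Hy. nra.
Qed.

Lemma Cmod_rpow_le (s : C) z : (2 <= fst s)%R -> (0 <= z <= 1)%R -> (Cmod (rpow s z) <= z ^ 2)%R.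
Proof.
  intros Hs Hz. destruct (Rlt_dec 0 z) as [H|H].
  - rewrite rpow_pos, Cmod_Cexp by assumption.
    replace (z ^ 2)%R with (exp (2 * ln z)).
    + apply exp_le. simpl.
      assert (ln z <= 0)%R by (rewrite <- ln_1; apply ln_le; lra). nra.
    + replace (2 * ln z)%R with (ln z + ln z)%R by ring. rewrite exp_plus, exp_ln by assumption. ring.
  - unfold rpow; destruct (Rlt_dec 0 z); [lra|]. rewrite Cmod_0. apply pow2_ge_0.
Qed.

(* At [z = 0] the derivative exists because [|z^s| <= z^2]. *)
Lemma is_cderive_rpow (s : C) z : (2 <= fst s)%R ->
  exists l, is_cderive (rpow s) z l /\ RtoC z * l = s * rpow s z.
Proof.
  intros Hs. destruct (Rtotal_order 0 z) as [Hz|[Hz|Hz]].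
  - exists (s * RtoC (/ z) * Cexp (s * RtoC (ln z))). split.
    + apply is_cderive_ext_loc with (fun x => Cexp (s * RtoC (ln x))).
      * apply filter_imp with (fun x => 0 < x)%R; [|now apply (open_gt 0)].
        intros x Hx; now rewrite rpow_pos.
      * apply is_cderive_Cexp, is_cderive_scal, is_cderive_RtoC, is_derive_ln, Hz.
    + rewrite rpow_pos, RtoC_inv by lra. field. apply RtoC_neq_0; lra.
  - subst z. exists 0. split.
    + apply is_cderive_quadratic with 1%R. intros h Hh.
      assert (E : rpow s 0 = 0) by (unfold rpow; destruct (Rlt_dec 0 0); [lra|reflexivity]).
      rewrite E, Rplus_0_l. replace (rpow s h - 0 - RtoC h * 0) with (rpow s h) by ring.
      destruct (Rlt_dec 0 h) as [H|H].
      * rewrite Rabs_pos_eq in Hh by lra. eapply Rle_trans; [apply Cmod_rpow_le; lra|simpl; lra].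
      * unfold rpow; destruct (Rlt_dec 0 h); [lra|]. rewrite Cmod_0. nra.
    + unfold rpow; destruct (Rlt_dec 0 0); [lra|]. ring.
  - exists 0. split.
    + apply is_cderive_ext_loc with (fun _ => 0); [|apply is_cderive_const].
      apply filter_imp with (fun x => x < 0)%R; [|now apply (open_lt 0)].
      intros x Hx; unfold rpow; destruct (Rlt_dec 0 x); [lra|reflexivity].
    + unfold rpow; destruct (Rlt_dec 0 z); [lra|ring].
Qed.

Lemma ex_cderive_rpow (s : C) z : (2 <= fst s)%R -> ex_cderive (rpow s) z.
Proof. intros Hs; destruct (is_cderive_rpow s z Hs) as [l [H _]]; now exists l. Qed.

Lemma ex_cderive_mult f g t : ex_cderive f t -> ex_cderive g t -> ex_cderive (fun x => f x * g x) t.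
Proof. intros [a Ha] [b Hb]; eexists; apply is_cderive_mult; eassumption. Qed.

Lemma ex_cderive_Cexp_linear (c : C) t : ex_cderive (fun x => Cexp (c * RtoC x)) t.
Proof. eexists; apply is_cderive_Cexp, is_cderive_linear. Qed.

Definition CInt (f : R -> C) (a b : R) : C := @RInt C_R_CompleteNormedModule f a b.

Lemma CInt_correct f a b :
  (forall t, (Rmin a b <= t <= Rmax a b)%R -> ex_cderive f t) -> is_CInt f a b (CInt f a b).
Proof.
  intros H. destruct (ex_CInt f a b H) as [l Hl].
  unfold CInt. rewrite (@is_RInt_unique C_R_CompleteNormedModule f a b l Hl). exact Hl.
Qed.

(** With [n] in the exponent, its limit at infinity is n^{-s-1} times Gamma(s + 1), a quantity that
    does not involve [w]. *)
Definition gamma_int (n : R) (s : C) (x : R) : C :=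
  CInt (fun z => Cexp (- RtoC n * RtoC z) * rpow s z) 0 x.

Lemma is_CInt_gamma (n : R) (s : C) a b : (2 <= fst s)%R ->
  is_CInt (fun z => Cexp (- RtoC n * RtoC z) * rpow s z) a b (gamma_int n s b - gamma_int n s a).
Proof.
  intros Hs.
  assert (H : forall x y, is_CInt (fun z => Cexp (- RtoC n * RtoC z) * rpow s z) x y
     (CInt (fun z => Cexp (- RtoC n * RtoC z) * rpow s z) x y)).
  { intros x y. apply CInt_correct. intros t _.
    apply ex_cderive_mult; [apply ex_cderive_Cexp_linear|now apply ex_cderive_rpow]. }
  assert (H1 := @is_RInt_Chasles C_R_NormedModule _ _ _ _ _ _
    (@is_RInt_swap C_R_NormedModule _ _ _ _ (H 0%R a)) (H 0%R b)).
  replace (gamma_int n s b - gamma_int n s a) with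
    (plus (opp (CInt (fun z => Cexp (- RtoC n * RtoC z) * rpow s z) 0 a))
          (CInt (fun z => Cexp (- RtoC n * RtoC z) * rpow s z) 0 b)); [exact H1|].
  unfold gamma_int. apply Cplus_comm.
Qed.

Lemma is_cderive_CInt (f F : R -> C) x :
  (forall t, ex_cderive f t) -> (forall y, is_CInt f 0 y (F y)) -> is_cderive F x (f x).
Proof.
  intros Hf HF. destruct (Hf x) as [l [X1 X2]]. split.
  - apply (@is_derive_RInt R_NormedModule (fun t => fst (f t)) (fun y => fst (F y)) 0 x).
    + apply filter_forall. intros y. apply is_CInt_fst, HF.
    + apply (@ex_derive_continuous R_AbsRing R_NormedModule); eexists; exact X1.
  - apply (@is_derive_RInt R_NormedModule (fun t => snd (f t)) (fun y => snd (F y)) 0 x).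
    + apply filter_forall. intros y. apply is_CInt_snd, HF.
    + apply (@ex_derive_continuous R_AbsRing R_NormedModule); eexists; exact X2.
Qed.

Lemma is_cderive_comp (f : R -> C) (u : R -> R) (t du : R) l :
  is_cderive f (u t) l -> is_derive u t du -> is_cderive (fun x => f (u x)) t (RtoC du * l).
Proof.
  intros [H1 H2] Hu. split.
  - replace (fst (RtoC du * l)) with (du * fst l)%R by (simpl; ring).
    apply (is_derive_comp (fun x => fst (f x)) u); assumption.
  - replace (snd (RtoC du * l)) with (du * snd l)%R by (simpl; ring).
    apply (is_derive_comp (fun x => snd (f x)) u); assumption.
Qed.

Lemma ex_cderive_filterlim (f : R -> C) x : ex_cderive f x ->
  filterlim f (locally x) (@locally C_R_NormedModule (f x)).
Proof.
  intros [l [X1 X2]].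
  assert (C1 : continuous (fun z => fst (f z)) x)
    by (apply (@ex_derive_continuous R_AbsRing R_NormedModule); eexists; exact X1).
  assert (C2 : continuous (fun z => snd (f z)) x)
    by (apply (@ex_derive_continuous R_AbsRing R_NormedModule); eexists; exact X2).
  intros P [eps HP].
  assert (L1 := proj1 (filterlim_locally _ _) C1 eps).
  assert (L2 := proj1 (filterlim_locally _ _) C2 eps).
  apply (filter_imp (F := locally x)) with (2 := filter_and _ _ L1 L2).
  intros y [Y1 Y2]. apply HP. split; assumption.
Qed.

Lemma gamma_int_0 n s : gamma_int n s 0%R = 0.
Proof. unfold gamma_int, CInt. apply (@RInt_point C_R_CompleteNormedModule). Qed.

Lemma is_cderive_gamma_int (n : R) (s : C) x : (2 <= fst s)%R ->
  is_cderive (gamma_int n s) x (Cexp (- RtoC n * RtoC x) * rpow s x).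
Proof.
  intros Hs. apply (is_cderive_CInt (fun z => Cexp (- RtoC n * RtoC z) * rpow s z)).
  - intros t. apply ex_cderive_mult; [apply ex_cderive_Cexp_linear|now apply ex_cderive_rpow].
  - intros y. replace (gamma_int n s y) with (gamma_int n s y - gamma_int n s 0%R).
    + now apply is_CInt_gamma.
    + rewrite gamma_int_0; ring.
Qed.

(** Balls of the product space use the maximum of the coordinates; halving the radius covers the
    factor sqrt 2. *)
Lemma ball_Cmod (l z : C) (eps : R) : ball (M := C_R_NormedModule) l (eps / 2)%R z -> (Cmod (z - l) < eps)%R.
Proof.
  intros [B1 B2].
  change (Rabs (fst z - fst l) < eps / 2)%R in B1. change (Rabs (snd z - snd l) < eps / 2)%R in B2.
  eapply Rle_lt_trans; [apply Cmod_2Rmax|].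
  assert (S2 : (sqrt 2 < 2)%R) by (rewrite <- (sqrt_square 2) at 2; [apply sqrt_lt_1|]; lra).
  assert (M : (Rmax (Rabs (fst (z - l)%C)) (Rabs (snd (z - l)%C)) < eps / 2)%R)
    by (apply Rmax_lub_lt; assumption).
  assert (M0 : (0 <= Rmax (Rabs (fst (z - l)%C)) (Rabs (snd (z - l)%C)))%R)
    by (eapply Rle_trans; [apply Rabs_pos|apply Rmax_l]).
  assert (S0 := sqrt_pos 2). nra.
Qed.

(** * Limits at infinity and improper integrals *)

Definition ctends (f : R -> C) (l : C) : Prop :=
  forall eps, (0 < eps)%R -> exists X, forall A, (X <= A)%R -> (Cmod (f A - l) < eps)%R.

Lemma ctends_filterlim f l : ctends f l ->
  filterlim f (Rbar_locally p_infty) (@locally C_R_NormedModule l).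
Proof.
  intros H. apply filterlim_locally. intros eps. destruct (H eps (cond_pos eps)) as [X HX].
  exists X. intros A HA. specialize (HX A (Rlt_le _ _ HA)).
  split.
  - change (Rabs (fst (f A) - fst l) < eps)%R.
    eapply Rle_lt_trans; [|exact HX]. exact (re_le_Cmod (f A - l)).
  - change (Rabs (snd (f A) - snd l) < eps)%R.
    eapply Rle_lt_trans; [|exact HX]. exact (Cmod_snd (f A - l)).
Qed.

Lemma ctends_cauchy (f : R -> C) :
  (forall eps, (0 < eps)%R -> exists X, forall A B, (X <= A)%R -> (A <= B)%R -> (Cmod (f B - f A) < eps)%R) ->
  exists l, ctends f l.
Proof.
  intros H.
  destruct (proj1 (@filterlim_locally_cauchy R C_R_CompleteNormedModule (Rbar_locally p_infty) _ f)) as [l Hl].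
  - intros eps. destruct (H eps (cond_pos eps)) as [X HX].
    exists (fun A => X < A)%R. split; [now exists X|].
    assert (W : forall u v, (X < u)%R -> (u <= v)%R -> ball (M := C_R_NormedModule) (f u) eps (f v)).
    { intros u v Hu Huv. specialize (HX u v (Rlt_le _ _ Hu) Huv). split.
      - change (Rabs (fst (f v) - fst (f u)) < eps)%R.
        eapply Rle_lt_trans; [|exact HX]. exact (re_le_Cmod (f v - f u)).
      - change (Rabs (snd (f v) - snd (f u)) < eps)%R.
        eapply Rle_lt_trans; [|exact HX]. exact (Cmod_snd (f v - f u)). }
    intros u v Hu Hv. destruct (Rle_dec u v) as [Huv|Huv].
    + now apply W.
    + apply (@ball_sym C_R_NormedModule). apply W; lra.
  - exists l. intros eps He.
    assert (He2 : (0 < eps / 2)%R) by lra.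
    destruct (proj1 (filterlim_locally f l) Hl (mkposreal _ He2)) as [X HX].
    exists (X + 1)%R. intros A HA. apply ball_Cmod, HX. lra.
Qed.

(** Serves both improper integrals of the statement: the one of Gamma on the half-line and the one
    of [S_n] on the unit interval. *)
Lemma is_RInt_gen_primitive (f F : R -> C) (Fa Fb : (R -> Prop) -> Prop) (la lb : C) :
  Filter Fa -> Filter Fb -> (forall x y, is_CInt f x y (F y - F x)) ->
  filterlim F Fa (@locally C_R_NormedModule la) -> filterlim F Fb (@locally C_R_NormedModule lb) ->
  @is_RInt_gen C_R_NormedModule f Fa Fb (lb - la).
Proof.
  intros FFa FFb H Ha Hb P HP.
  assert (L : filterlim (fun ab => plus (F (snd ab)) (opp (F (fst ab)))) (filter_prod Fa Fb)
      (@locally C_R_NormedModule (plus lb (opp la)))).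
  { eapply filterlim_comp_2; [| |apply (@filterlim_plus R_AbsRing C_R_NormedModule)].
    - eapply filterlim_comp; [apply filterlim_snd|exact Hb].
    - eapply filterlim_comp; [eapply filterlim_comp; [apply filterlim_fst|exact Ha]|].
      apply (@filterlim_opp R_AbsRing C_R_NormedModule). }
  specialize (L P HP). unfold filtermapi, filtermap in *.
  apply filter_imp with (2 := L). intros [x y] Hxy. exists (F y - F x). split; [apply H|exact Hxy].
Qed.

(** The substitution t = n z carries the integral of Gamma to [gamma_int]. *)
Lemma CGamma_eq (n : R) (s G : C) : (0 < n)%R -> (2 <= fst s)%R -> ctends (gamma_int n s) G ->
  CGamma (s + 1) = Cexp ((s + 1) * RtoC (ln n)) * G.
Proof.
  intros Hn Hs HG. unfold CGamma.
  apply (@is_RInt_gen_unique C_R_CompleteNormedModule); try apply _.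
  set (c := Cexp ((s + 1) * RtoC (ln n))).
  set (F := fun y => c * gamma_int n s (y / n)).
  assert (HI : forall x y, is_CInt (fun t => rpow s t * RtoC (exp (- t))) x y (F y - F x)).
  { intros x y. assert (H1 := is_CInt_gamma n s (x / n) (y / n) Hs).
    assert (H2 := is_CInt_comp_lin
      (fun z => Cexp (- RtoC n * RtoC z) * rpow s z) (/ n) 0 x y
      (gamma_int n s (y / n) - gamma_int n s (x / n))).
    replace (/ n * x + 0)%R with (x / n)%R in H2 by (field; lra).
    replace (/ n * y + 0)%R with (y / n)%R in H2 by (field; lra).
    specialize (H2 H1).
    assert (H3 := is_CInt_cmult c _ _ _ _ H2).
    replace (F y - F x) with (c * (gamma_int n s (y / n) - gamma_int n s (x / n))) by (unfold F; ring).
    eapply is_RInt_ext; [|exact H3]. intros t _. cbv beta.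
    rewrite Rplus_0_r, rpow_mult by now apply Rinv_0_lt_compat.
    rewrite ln_Rinv by assumption.
    replace (- RtoC n * RtoC (/ n * t)) with (RtoC (- t))
      by (rewrite <- RtoC_opp, <- RtoC_mult; f_equal; field; lra).
    rewrite Cexp_RtoC.
    (* The three powers of [n] cancel: from [c], from dz = dt / n and from (t / n)^s. *)
    assert (E : c * RtoC (/ n) * Cexp (s * RtoC (- ln n)) = 1).
    { unfold c. rewrite <- (exp_ln (/ n)) by now apply Rinv_0_lt_compat.
      rewrite <- Cexp_RtoC, <- !Cexp_plus, ln_Rinv, RtoC_opp by assumption.
      match goal with |- Cexp ?X = _ => replace X with (RtoC 0) by ring end. apply Cexp_0. }
    match goal with |- ?a = ?b => change (@eq C a b) end.
    transitivity (c * RtoC (/ n) * Cexp (s * RtoC (- ln n)) * (RtoC (exp (- t)) * rpow s t)); [ring|].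
    rewrite E; ring. }
  replace (c * G) with (c * G - 0) by ring.
  apply (@is_RInt_gen_ext C_R_NormedModule _ _ _ _ (fun t => rpow s t * RtoC (exp (- t)))).
  (* [Rcpow] and [rpow] agree on positive reals; both filters eventually keep the endpoints, hence
     the whole interval, positive. *)
  - exists (fun x => 0 < x)%R (fun y => 0 < y)%R.
    + exists (mkposreal 1 Rlt_0_1). intros y _ Hy. exact Hy.
    + now exists 0%R.
    + intros x y Hx Hy t Ht. simpl in Ht. rewrite rpow_pos.
      * unfold Rcpow. do 3 f_equal. ring.
      * eapply Rlt_trans; [|apply Ht]. now apply Rmin_glb_lt.
  - apply is_RInt_gen_primitive with F; try apply _; [exact HI| |].
    + replace (RtoC 0) with (F 0%R) by (unfold F, Rdiv; rewrite Rmult_0_l, gamma_int_0; ring).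
      assert (HF : ex_cderive F 0).
      { eexists. apply is_cderive_scal.
        apply (is_cderive_comp (gamma_int n s) (fun y => y / n)%R); [now apply is_cderive_gamma_int|].
        apply Derive_correct. auto_derive; trivial. }
      eapply filterlim_filter_le_1 with (2 := ex_cderive_filterlim F 0%R HF).
      intros P [d Hd]. exists d. intros y Hy _. now apply Hd.
    + apply ctends_filterlim. intros eps He.
      assert (Hc : (0 < Cmod c)%R) by (apply Cmod_gt_0, Cexp_neq_0).
      destruct (HG (eps / Cmod c)%R) as [X HX]; [now apply Rdiv_lt_0_compat|].
      exists (X * n)%R. intros A HA. unfold F.
      replace (c * gamma_int n s (A / n) - c * G) with (c * (gamma_int n s (A / n) - G)) by ring.
      rewrite Cmod_mult. specialize (HX (A / n)%R).
      assert (X <= A / n)%R.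
      { apply Rmult_le_reg_r with n; [assumption|]. unfold Rdiv; rewrite Rmult_assoc, Rinv_l by lra. lra. }
      specialize (HX H). apply Rmult_lt_reg_l with (/ Cmod c)%R; [now apply Rinv_0_lt_compat|].
      rewrite <- Rmult_assoc, Rinv_l, Rmult_1_l by lra. unfold Rdiv in HX. lra.
Qed.

(** The integral in [S_n] without the factor e^{n w}. It is entire in [w], so the only branch in the
    incomplete gamma function built from it is that of w^{s+1}. *)
Definition K_int (n : R) (s w : C) : C := CInt (fun z => Cexp (- (RtoC n * w) * RtoC z) * rpow s z) 0 1.

Lemma is_CInt_K (n : R) (s w : C) : (2 <= fst s)%R ->
  is_CInt (fun z => Cexp (- (RtoC n * w) * RtoC z) * rpow s z) 0 1 (K_int n s w).
Proof.
  intros Hs. apply CInt_correct. intros t _.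
  apply ex_cderive_mult; [apply ex_cderive_Cexp_linear|now apply ex_cderive_rpow].
Qed.

Lemma S_n_eq (n : R) (w v : C) : (2 <= fst (RtoC n + v)%C)%R ->
  S_n n w v = 1 + RtoC n * w * (Cexp (RtoC n * w) * K_int n (RtoC n + v) w).
Proof.
  intros Hs. unfold S_n. f_equal. f_equal. set (s := RtoC n + v) in *.
  apply (@is_RInt_gen_unique C_R_CompleteNormedModule); try apply _.
  set (f := fun z => Cexp (- (RtoC n * w) * RtoC z) * rpow s z).
  assert (Hf : forall t, ex_cderive f t).
  { intros t. apply ex_cderive_mult; [apply ex_cderive_Cexp_linear|now apply ex_cderive_rpow]. }
  set (F := fun y => Cexp (RtoC n * w) * CInt f 0 y).
  assert (HC : forall x y, is_CInt f x y (CInt f x y)) by (intros; apply CInt_correct; auto).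
  apply (@is_RInt_gen_ext C_R_NormedModule _ _ _ _ (fun z => Cexp (RtoC n * w) * f z)).
  { exists (fun x => 0 < x)%R (fun y => 0 < y)%R.
    + exists (mkposreal 1 Rlt_0_1). intros y _ Hy. exact Hy.
    + exists (mkposreal 1 Rlt_0_1). intros y Hy _.
      change (Rabs (y - 1) < 1)%R in Hy. apply Rabs_def2 in Hy. lra.
    + intros x y Hx Hy t Ht. simpl in Ht. unfold f. rewrite rpow_pos.
      * unfold Rcpow. rewrite Cmult_assoc, <- Cexp_plus. do 2 f_equal. rewrite RtoC_minus. ring.
      * eapply Rlt_trans; [|apply Ht]. now apply Rmin_glb_lt. }
  replace (Cexp (RtoC n * w) * K_int n s w) with (F 1%R - F 0%R).
  2: { unfold F, CInt at 2. rewrite (@RInt_point C_R_CompleteNormedModule).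
       change (zero : C) with (RtoC 0). unfold K_int, f. ring. }
  assert (HF : forall x, ex_cderive F x).
  { intros x. eexists. apply is_cderive_scal. apply (is_cderive_CInt f); [assumption|]. intros; apply HC. }
  apply is_RInt_gen_primitive with F; try apply _.
  - intros x y. replace (F y - F x) with (Cexp (RtoC n * w) * (- CInt f 0 x + CInt f 0 y)) by (unfold F; ring).
    apply is_CInt_cmult.
    exact (@is_RInt_Chasles C_R_NormedModule _ _ _ _ _ _
      (@is_RInt_swap C_R_NormedModule _ _ _ _ (HC 0%R x)) (HC 0%R y)).
  - eapply filterlim_filter_le_1 with (2 := ex_cderive_filterlim F 0%R (HF 0%R)).
    intros P [d Hd]. exists d. intros y Hy _. now apply Hd.
  - eapply filterlim_filter_le_1 with (2 := ex_cderive_filterlim F 1%R (HF 1%R)).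
    intros P [d Hd]. exists d. intros y Hy _. now apply Hd.
Qed.

(** The power n^{-s} of [nw_pow] meets n^{s+1} from Gamma and leaves a single factor [n], so
    [T_n + 1] becomes a complete minus a lower incomplete gamma integral. *)
Lemma T_n_eq (n : R) (w v G : C) : (0 < n)%R -> (2 <= fst (RtoC n + v)%C)%R ->
  ctends (gamma_int n (RtoC n + v)) G ->
  T_n n w v = RtoC n * Cexp (RtoC n * w) *
    (Cexp (- (RtoC n + v) * Clog w) * G - w * K_int n (RtoC n + v) w) - 1.
Proof.
  intros Hn Hs HG. unfold T_n. rewrite (CGamma_eq n (RtoC n + v) G) by assumption.
  rewrite S_n_eq by assumption. unfold nw_pow. set (s := RtoC n + v) in *.
  assert (E : Cexp (- s * RtoC (ln n)) * Cexp ((s + 1) * RtoC (ln n)) = RtoC n).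
  { rewrite <- Cexp_plus. replace (- s * RtoC (ln n) + (s + 1) * RtoC (ln n)) with (RtoC (ln n)) by ring.
    rewrite Cexp_RtoC, exp_ln by assumption. reflexivity. }
  transitivity (Cexp (RtoC n * w) * (Cexp (- s * RtoC (ln n)) * Cexp ((s + 1) * RtoC (ln n)))
     * Cexp (- s * Clog w) * G - (1 + RtoC n * w * (Cexp (RtoC n * w) * K_int n s w))); [ring|].
  rewrite E. ring.
Qed.

Lemma Cexp_Clog (w : C) : (0 < fst w)%R -> Cexp (Clog w) = w.
Proof.
  intros Hw. unfold Cexp, Clog; simpl. unfold Carg. destruct (Rlt_dec 0 (fst w)) as [_|]; [|contradiction].
  assert (Hm : (0 < Cmod w)%R).
  { apply Cmod_gt_0. intros E; rewrite E in Hw; simpl in Hw; lra. }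
  rewrite exp_ln by assumption.
  assert (Hs : (sqrt (1 + (snd w / fst w)²) = Cmod w / fst w)%R).
  { apply sqrt_lem_1.
    - assert (A := Rle_0_sqr (snd w / fst w)). lra.
    - apply Rlt_le, Rdiv_lt_0_compat; assumption.
    - replace (Cmod w / fst w * (Cmod w / fst w))%R with (Cmod w * Cmod w / (fst w * fst w))%R by (field; lra).
      rewrite Cmod_sqr. unfold Rsqr. field. lra. }
  rewrite cos_atan, sin_atan, Hs.
  apply injective_projections; simpl; field; lra.
Qed.

(* The primitive of [e^{-n z} z^s] vanishing at [0], i.e. the lower incomplete gamma function. *)
Definition P_int (n : R) (s z : C) : C := Cexp ((s + 1) * Clog z) * K_int n s z.

(** Differentiation under the integral followed by integration by parts. The derivative is taken
    along a line, in place of a complex derivative, and the relation is multiplied by the point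
    itself so that nothing is divided. *)
Lemma is_cderive_K (n : R) (s a b : C) (tau : R) : (0 < n)%R -> (2 <= fst s)%R ->
  exists l, is_cderive (fun x => K_int n s (a + b * RtoC x)) tau l /\
    (a + b * RtoC tau) * l = b * (Cexp (- (RtoC n * (a + b * RtoC tau))) - (s + 1) * K_int n s (a + b * RtoC tau)).
Proof.
  intros Hn Hs.
  set (al := fun z => - (RtoC n * b) * RtoC z).
  set (g := fun z => Cexp (- (RtoC n * a) * RtoC z) * rpow s z).
  set (K1 := fun x => CInt (fun z => al z * (Cexp (RtoC x * al z) * g z)) 0 1).
  assert (Hex : forall x t, ex_cderive (fun z => Cexp (RtoC x * al z) * g z) t).
  { intros x t. apply ex_cderive_mult.
    - eexists. apply is_cderive_Cexp, is_cderive_scal, is_cderive_linear.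
    - apply ex_cderive_mult; [apply ex_cderive_Cexp_linear|now apply ex_cderive_rpow]. }
  assert (HK1 : forall x, is_CInt (fun z => al z * (Cexp (RtoC x * al z) * g z)) 0 1 (K1 x)).
  { intros x. apply CInt_correct. intros t _. apply ex_cderive_mult; [|apply Hex].
    eexists; apply is_cderive_linear. }
  exists (K1 tau). split.
  - apply (is_cderive_exp_param al g (Cmod (RtoC n * b)) (exp (Cmod (RtoC n * a)))
      (fun x => K_int n s (a + b * RtoC x)) K1).
    + intros z Hz. unfold al, g. rewrite !Cmod_mult, Cmod_opp, (Cmod_RtoC_nonneg z) by lra.
      rewrite !Cmod_mult. split.
      * assert (H0 : (0 <= Cmod (RtoC n) * Cmod b)%R) by (apply Rmult_le_pos; apply Cmod_ge_0). nra.
      * rewrite <- (Rmult_1_r (exp _)). apply Rmult_le_compat; try apply Cmod_ge_0.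
        -- rewrite Cmod_Cexp. apply exp_le. eapply Rle_trans; [apply Cmod_fst|].
           rewrite !Cmod_mult, Cmod_opp, Cmod_mult, (Cmod_RtoC_nonneg z) by lra.
           assert (H0 : (0 <= Cmod (RtoC n) * Cmod a)%R) by (apply Rmult_le_pos; apply Cmod_ge_0). nra.
        -- eapply Rle_trans; [apply Cmod_rpow_le; assumption|]. nra.
    + intros x. eapply is_RInt_ext; [|apply (is_CInt_K n s (a + b * RtoC x) Hs)].
      intros z _. cbv beta. unfold al, g. rewrite Cmult_assoc, <- Cexp_plus. do 2 f_equal. ring.
    + exact HK1.
  - set (ze := a + b * RtoC tau).
    assert (E : forall z, Cexp (RtoC tau * al z) * g z = Cexp (- (RtoC n * ze) * RtoC z) * rpow s z).
    { intros z. unfold al, g, ze. rewrite Cmult_assoc, <- Cexp_plus. do 2 f_equal. ring. }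
    (* [F] is e^{-n ze} at 1 and 0 at 0. Since z times the derivative of z^s is s z^s, also at 0,
       its derivative contributes the factor [s + 1]. *)
    set (F := fun z => RtoC z * (Cexp (- (RtoC n * ze) * RtoC z) * rpow s z)).
    assert (HD : is_CInt (fun z => (s + 1) * (Cexp (- (RtoC n * ze) * RtoC z) * rpow s z)
        - RtoC n * ze * (RtoC z * (Cexp (- (RtoC n * ze) * RtoC z) * rpow s z))) 0 1 (F 1%R - F 0%R)).
    { apply (is_CInt_derive F).
      - intros z _. destruct (is_cderive_rpow s z Hs) as [l [Hl El]].
        eapply is_cderive_eq.
        + apply is_cderive_mult; [apply is_cderive_id|].
          apply is_cderive_mult; [apply is_cderive_Cexp, is_cderive_linear|exact Hl].
        + transitivity (Cexp (- (RtoC n * ze) * RtoC z) * rpow s z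
             - RtoC n * ze * (RtoC z * (Cexp (- (RtoC n * ze) * RtoC z) * rpow s z))
             + Cexp (- (RtoC n * ze) * RtoC z) * (RtoC z * l)); [ring|].
          rewrite El; ring.
      - intros z _.
        assert (X : ex_cderive (fun z => Cexp (- (RtoC n * ze) * RtoC z) * rpow s z) z)
          by (apply ex_cderive_mult; [apply ex_cderive_Cexp_linear|now apply ex_cderive_rpow]).
        destruct X as [l Hl]. eexists. apply is_cderive_minus.
        + apply is_cderive_scal; exact Hl.
        + apply is_cderive_scal, is_cderive_mult; [apply is_cderive_id|exact Hl]. }
    assert (H2 := is_CInt_cminus _ _ _ _ _ _ (is_CInt_cmult (b * (s + 1)) _ _ _ _ (is_CInt_K n s ze Hs))
                    (is_CInt_cmult b _ _ _ _ HD)).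
    assert (H3 := is_CInt_cmult (- ze) _ _ _ _ (HK1 tau)).
    assert (H4 : - ze * K1 tau = b * (s + 1) * K_int n s ze - b * (F 1%R - F 0%R)).
    { apply (is_CInt_unique _ 0 1 _ _ H3). eapply is_RInt_ext; [|exact H2].
      intros z _. cbv beta. rewrite E. unfold al.
      match goal with |- ?x = ?y => change (@eq C x y) end. ring. }
    assert (F1 : F 1%R - F 0%R = Cexp (- (RtoC n * ze))).
    { unfold F. rewrite rpow_1. replace (- (RtoC n * ze) * 1) with (- (RtoC n * ze)) by ring. ring. }
    rewrite F1 in H4. transitivity (- (- ze * K1 tau)); [ring|]. rewrite H4. ring.
Qed.

(** The derivative is the direction [b] times e^{-n z} z^s at the point reached, whatever line leads
    there; this is the path independence that the change of contour relies on. *)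
Lemma is_cderive_P (n : R) (s a b : C) (tau : R) : (0 < n)%R -> (2 <= fst s)%R ->
  (0 < fst (a + b * RtoC tau)%C)%R ->
  is_cderive (fun x => P_int n s (a + b * RtoC x)) tau
    (b * (Cexp (- (RtoC n * (a + b * RtoC tau))) * Cexp (s * Clog (a + b * RtoC tau)))).
Proof.
  intros Hn Hs Hp. destruct (is_cderive_K n s a b tau Hn Hs) as [l [Hl El]].
  set (ze := a + b * RtoC tau) in *.
  assert (Hz : ze <> 0) by (intros E; rewrite E in Hp; simpl in Hp; lra).
  assert (HL : is_cderive (fun x => Clog (a + b * RtoC x)) tau (b / ze)).
  { apply (is_cderive_Clog (fun x => a + b * RtoC x)); [exact Hp|].
    eapply is_cderive_eq; [apply is_cderive_plus; [apply is_cderive_const|apply is_cderive_linear]|ring]. }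
  eapply is_cderive_eq.
  - apply is_cderive_mult; [apply is_cderive_Cexp, is_cderive_scal, HL|exact Hl].
  - cbv beta. fold ze. assert (E : Cexp ((s + 1) * Clog ze) = Cexp (s * Clog ze) * ze).
    { rewrite Cmult_plus_distr_r, Cexp_plus, Cmult_1_l, Cexp_Clog by assumption. reflexivity. }
    rewrite E.
    transitivity (Cexp (s * Clog ze) * (b * (s + 1) * K_int n s ze + ze * l)); [field; exact Hz|].
    rewrite El. ring.
Qed.

Lemma ln_le_linear (eps z : R) : (0 < eps)%R -> (0 < z)%R -> (ln z <= eps * z - ln eps)%R.
Proof.
  intros He Hz. assert (H : (0 < eps * z)%R) by now apply Rmult_lt_0_compat.
  assert (H1 := exp_ineq1_le (ln (eps * z))). rewrite exp_ln in H1 by assumption.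
  rewrite ln_mult in H1 by assumption. lra.
Qed.

Lemma Carg_bound (z : C) : (0 < fst z)%R -> (Rabs (Carg z) <= 2)%R.
Proof.
  intros H. unfold Carg. destruct (Rlt_dec 0 (fst z)); [|lra].
  assert (B := atan_bound (snd z / fst z)). assert (P := PI_4).
  apply Rabs_le. lra.
Qed.

(** In a sector around the positive axis half of the exponential decay dominates |z|^{Re s}, while
    the bounded argument contributes at most a constant factor. *)
Lemma Cmod_gamma_integrand (n B : R) (s : C) : (0 < n)%R -> (0 < fst s)%R -> (0 < B)%R ->
  exists M, (0 <= M)%R /\ forall z, (0 < fst z)%R -> (Cmod z <= B * fst z)%R ->
    (Cmod (Cexp (- (RtoC n * z)) * Cexp (s * Clog z)) <= M * exp (- (n / 2 * fst z)))%R.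
Proof.
  (* The slope [e] is chosen so that Re s times [e] times [B] is [n / 2]. *)
  intros Hn Hs HB. set (e := (n / (2 * fst s * B))%R).
  assert (He : (0 < e)%R).
  { unfold e. apply Rdiv_lt_0_compat; [assumption|]. repeat apply Rmult_lt_0_compat; lra. }
  exists (exp (- (fst s * ln e) + Rabs (snd s) * 2)). split; [left; apply exp_pos|].
  intros z Hz Hb. rewrite <- Cexp_plus, Cmod_Cexp, <- exp_plus. apply exp_le.
  assert (Hm : (0 < Cmod z)%R).
  { apply Cmod_gt_0. intros E; rewrite E in Hz; simpl in Hz; lra. }
  assert (HL := ln_le_linear e (Cmod z) He Hm).
  assert (HA := Carg_bound z Hz).
  assert (H1 : (- (snd s * Carg z) <= Rabs (snd s) * 2)%R).
  { eapply Rle_trans; [apply Rle_abs|]. rewrite Rabs_Ropp, Rabs_mult.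
    apply Rmult_le_compat_l; [apply Rabs_pos|exact HA]. }
  assert (H2 : (fst s * (e * Cmod z) <= n / 2 * fst z)%R).
  { apply Rle_trans with (fst s * (e * (B * fst z)))%R.
    - repeat (apply Rmult_le_compat_l; [lra|]). exact Hb.
    - right. unfold e. field. split; lra. }
  assert (H3 : (fst s * ln (Cmod z) <= fst s * (e * Cmod z - ln e))%R) by (apply Rmult_le_compat_l; lra).
  simpl. lra.
Qed.

Lemma exp_small (k M eps : R) : (0 < k)%R -> (0 <= M)%R -> (0 < eps)%R ->
  exists X, (0 <= X)%R /\ forall A, (X <= A)%R -> (M * exp (- (k * A)) < eps)%R.
Proof.
  intros Hk HM He. exists (M / eps / k)%R.
  assert (H0 : (0 <= M / eps / k)%R).
  { repeat apply Rmult_le_pos; try assumption; left; now apply Rinv_0_lt_compat. }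
  split; [assumption|]. intros A HA.
  assert (H1 : (M / eps <= k * A)%R).
  { apply Rle_trans with (k * (M / eps / k))%R; [right; field; lra|apply Rmult_le_compat_l; lra]. }
  assert (H2 := exp_ineq1_le (k * A)).
  rewrite exp_Ropp. apply Rmult_lt_reg_r with (exp (k * A)); [apply exp_pos|].
  rewrite Rmult_assoc, Rinv_l, Rmult_1_r by (apply Rgt_not_eq, exp_pos).
  apply Rlt_le_trans with (eps * (M / eps + 1))%R.
  - replace (eps * (M / eps + 1))%R with (M + eps)%R by (field; lra). lra.
  - apply Rmult_le_compat_l; lra.
Qed.

Lemma Clog_RtoC (x : R) : (0 < x)%R -> Clog (RtoC x) = RtoC (ln x).
Proof.
  intros H. unfold Clog. rewrite Cmod_RtoC_nonneg by lra. unfold Carg, RtoC; simpl.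
  destruct (Rlt_dec 0 x); [|lra]. unfold Rdiv. now rewrite Rmult_0_l, atan_0.
Qed.

Lemma ctends_gamma_int (n : R) (s : C) : (0 < n)%R -> (2 <= fst s)%R -> exists G, ctends (gamma_int n s) G.
Proof.
  intros Hn Hs. apply ctends_cauchy. intros eps He.
  destruct (Cmod_gamma_integrand n 1 s Hn ltac:(lra) ltac:(lra)) as [M [HM H]].
  destruct (exp_small (n / 2) (M / (n / 2)) eps) as [X [HX0 HX]]; [lra| |assumption|].
  { apply Rmult_le_pos; [assumption|left; apply Rinv_0_lt_compat; lra]. }
  exists (X + 1)%R. intros A B HA HAB.
  eapply Rle_lt_trans; [|apply (HX A); lra].
  replace (M / (n / 2) * exp (- (n / 2 * A)))%R with (M * exp (- (n / 2 * A)) / (n / 2))%R by (field; lra).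
  eapply (Cmod_CInt_exp_le _ A B); [lra|assumption|assumption| |now apply is_CInt_gamma].
  intros t Ht. cbv beta. rewrite rpow_pos by lra. rewrite <- Clog_RtoC by lra.
  replace (- RtoC n * RtoC t) with (- (RtoC n * RtoC t)) by ring.
  apply (H (RtoC t)); simpl; [lra|]. rewrite Cmod_RtoC_nonneg; lra.
Qed.

(** The scaling by [x] maps [0, 1] to [0, x], so on the positive axis the primitive is the real
    integral; this ties the shifted contour to Gamma. *)
Lemma P_int_RtoC (n x : R) (s : C) : (0 < x)%R -> (2 <= fst s)%R ->
  P_int n s (RtoC x) = gamma_int n s x.
Proof.
  intros Hx Hs. unfold P_int.
  assert (H := is_CInt_gamma n s (x * 0 + 0) (x * 1 + 0) Hs).
  apply is_CInt_comp_lin in H. rewrite Rmult_0_r, Rmult_1_r, !Rplus_0_r, gamma_int_0 in H.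
  replace (gamma_int n s x) with (gamma_int n s x - 0) by ring.
  eapply is_CInt_unique; [|exact H].
  eapply is_RInt_ext; [|apply is_CInt_cmult, (is_CInt_K n s (RtoC x) Hs)].
  intros z _. cbv beta. rewrite Rplus_0_r, rpow_mult, Clog_RtoC by assumption.
  rewrite Cmult_plus_distr_r, Cexp_plus, Cmult_1_l, Cexp_RtoC, exp_ln by assumption.
  replace (- RtoC n * RtoC (x * z)) with (- (RtoC n * RtoC x) * RtoC z) by (rewrite RtoC_mult; ring).
  match goal with |- ?x = ?y => change (@eq C x y) end. ring.
Qed.

(** This closes the contour at infinity: [w + A] and [1 + A] are joined by a segment of fixed length
    |w - 1|, on which the integrand decays exponentially in [A]. *)
Lemma ctends_P_int (n : R) (s w G : C) : (0 < n)%R -> (2 <= fst s)%R -> (1 <= fst w)%R ->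
  ctends (gamma_int n s) G -> ctends (fun A => P_int n s (w + RtoC A)) G.
Proof.
  intros Hn Hs Hw HG eps He.
  assert (Hc := Cmod_ge_0 (w - 1)).
  (* On the segment |z| <= 1 + A + |w - 1| and Re z >= 1 + A, which gives the sector constant 1 + |w
     - 1|. *)
  destruct (Cmod_gamma_integrand n (1 + Cmod (w - 1)) s Hn ltac:(lra) ltac:(lra)) as [M [HM H]].
  destruct (HG (eps / 2)%R ltac:(lra)) as [X1 HX1].
  destruct (exp_small (n / 2) (Cmod (w - 1) * M) (eps / 2)) as [X2 [HX20 HX2]];
    [lra|apply Rmult_le_pos; assumption|lra|].
  exists (Rmax 0 (Rmax X1 X2)). intros A HA.
  assert (m1 := Rmax_l 0 (Rmax X1 X2)). assert (m2 := Rmax_r 0 (Rmax X1 X2)).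
  assert (m3 := Rmax_l X1 X2). assert (m4 := Rmax_r X1 X2).
  replace (P_int n s (w + RtoC A) - G) with
    ((P_int n s (w + RtoC A) - P_int n s (RtoC (1 + A))) + (gamma_int n s (1 + A) - G))
    by (rewrite P_int_RtoC by (assumption || lra); ring).
  eapply Rle_lt_trans; [apply Cmod_triangle|].
  assert (B1 := HX1 (1 + A)%R ltac:(lra)).
  assert (B2 := HX2 A ltac:(lra)).
  assert (B3 := Cmod_mean_value (fun x => P_int n s (RtoC (1 + A) + (w - 1) * RtoC x))
     (fun x => (w - 1) * (Cexp (- (RtoC n * (RtoC (1 + A) + (w - 1) * RtoC x)))
          * Cexp (s * Clog (RtoC (1 + A) + (w - 1) * RtoC x)))) 0 1
     (Cmod (w - 1) * M * exp (- (n / 2 * A)))).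
  cbv beta in B3.
  replace (RtoC (1 + A) + (w - 1) * 1) with (w + RtoC A) in B3 by (rewrite RtoC_plus; ring).
  replace (RtoC (1 + A) + (w - 1) * 0) with (RtoC (1 + A)) in B3 by ring.
  assert (Hre : forall x, (0 <= x)%R -> (1 + A <= fst (RtoC (1 + A) + (w - 1) * RtoC x)%C)%R).
  { intros x Hx. simpl. nra. }
  specialize (B3 ltac:(lra)).
  assert (B : (Cmod (P_int n s (w + RtoC A) - P_int n s (RtoC (1 + A)))
     <= Cmod (w - 1) * M * exp (- (n / 2 * A)) * (1 - 0))%R).
  { apply B3.
    - intros x Hx. apply is_cderive_P; try assumption. specialize (Hre x (proj1 Hx)). lra.
    - intros x Hx. specialize (Hre x (proj1 Hx)).
      set (z := RtoC (1 + A) + (w - 1) * RtoC x) in *.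
      rewrite Cmod_mult, Rmult_assoc. apply Rmult_le_compat_l; [assumption|].
      eapply Rle_trans; [apply H|].
      + lra.
      + unfold z at 1. eapply Rle_trans; [apply Cmod_triangle|].
        rewrite Cmod_mult, !Cmod_RtoC_nonneg by lra. nra.
      + apply Rmult_le_compat_l; [assumption|]. apply exp_le. nra. }
  lra.
Qed.

(** This is log (1 + t / w), written as a difference so that its derivative and its combination with
    w^s follow from [Clog] in the right half-plane. *)
Definition log_shift (w : C) (t : R) : C := Clog (w + RtoC t) - Clog w.

(** Along the ray from [w] parallel to the real axis [P_int] tends to the full gamma integral, so
    its increments give the upper part; [c] normalises the integrand to 1 at the start. The summand
    1 is the constant term of [S_n]. *)
Lemma T_n_upper (n : R) (w v : C) : (0 < n)%R -> (2 <= fst (RtoC n + v)%C)%R -> (1 <= fst w)%R ->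
  exists J, (forall A, (0 <= A)%R ->
      is_CInt (fun t => Cexp (RtoC n * (log_shift w t - 1 * RtoC t) + v * log_shift w t)) 0 A (J A)) /\
    ctends J ((T_n n w v + 1) / RtoC n).
Proof.
  intros Hn Hs Hw. set (s := RtoC n + v) in *.
  destruct (ctends_gamma_int n s Hn Hs) as [G HG].
  set (c := Cexp (RtoC n * w) * Cexp (- s * Clog w)).
  exists (fun A => c * (P_int n s (w + RtoC A) - P_int n s w)). split.
  - intros A HA.
    eapply is_RInt_ext with (fun u => c * (1 * (Cexp (- (RtoC n * (w + 1 * RtoC u)))
         * Cexp (s * Clog (w + 1 * RtoC u))))).
    { intros u _. unfold c, log_shift. rewrite Cmult_1_l, !Cmult_1_l.
      rewrite <- !Cexp_plus. f_equal. unfold s. ring. }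
    apply is_CInt_cmult.
    replace (P_int n s (w + RtoC A) - P_int n s w) with
      (P_int n s (w + 1 * RtoC A) - P_int n s (w + 1 * RtoC 0)) by (do 2 f_equal; ring).
    apply (is_CInt_derive (fun u => P_int n s (w + 1 * RtoC u))).
    + intros t Ht. rewrite Rmin_left, Rmax_right in Ht by lra.
      apply is_cderive_P; try assumption. simpl; lra.
    + intros t Ht. rewrite Rmin_left, Rmax_right in Ht by lra.
      assert (HD : is_cderive (fun u => w + 1 * RtoC u) t (0 + 1))
        by (apply is_cderive_plus; [apply is_cderive_const|apply is_cderive_linear]).
      eexists. apply is_cderive_scal, is_cderive_mult.
      * apply is_cderive_Cexp, is_cderive_opp, is_cderive_scal, HD.
      * apply is_cderive_Cexp, is_cderive_scal.
        apply (is_cderive_Clog (fun u => w + 1 * RtoC u)); [simpl; lra|exact HD].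
  - rewrite (T_n_eq n w v G) by assumption. fold s.
    replace (_ / RtoC n) with (c * (G - P_int n s w)).
    + intros eps He. assert (Hc : (0 < Cmod c)%R).
      { apply Cmod_gt_0. unfold c. apply Cmult_neq_0; apply Cexp_neq_0. }
      destruct (ctends_P_int n s w G Hn Hs Hw HG (eps / Cmod c)%R) as [X HX]; [now apply Rdiv_lt_0_compat|].
      exists X. intros A HA. specialize (HX A HA).
      replace (c * (P_int n s (w + RtoC A) - P_int n s w) - c * (G - P_int n s w)) with
        (c * (P_int n s (w + RtoC A) - G)) by ring.
      rewrite Cmod_mult. apply Rmult_lt_reg_l with (/ Cmod c)%R; [now apply Rinv_0_lt_compat|].
      rewrite <- Rmult_assoc, Rinv_l, Rmult_1_l by lra. unfold Rdiv in HX. lra.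
    + unfold P_int, c. rewrite Cmult_plus_distr_r, (Cexp_plus (s * Clog w)), Cmult_1_l, Cexp_Clog by lra.
      assert (E : Cexp (- s * Clog w) * Cexp (s * Clog w) = 1).
      { rewrite <- Cexp_plus. replace (- s * Clog w + s * Clog w) with (RtoC 0) by ring. apply Cexp_0. }
      transitivity (Cexp (RtoC n * w) * Cexp (- s * Clog w) * G -
        Cexp (RtoC n * w) * (Cexp (- s * Clog w) * Cexp (s * Clog w)) * w * K_int n s w); [ring|].
      rewrite E. field. apply RtoC_neq_0; lra.
Qed.

Lemma ex_cderive_eps (f : R -> C) x eps : ex_cderive f x -> (0 < eps)%R ->
  exists d, (0 < d)%R /\ forall y, (Rabs (y - x) < d)%R -> (Cmod (f y - f x) < eps)%R.
Proof.
  intros Hf He. assert (He2 : (0 < eps / 2)%R) by lra.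
  destruct (proj1 (filterlim_locally f (f x : C_R_NormedModule)) (ex_cderive_filterlim f x Hf) (mkposreal _ He2))
    as [d Hd].
  exists d. split; [apply cond_pos|]. intros y Hy. apply ball_Cmod, Hd, Hy.
Qed.

(** The integrand written through [ln (1 - t)] is correct for [t < 1] only, since [ln 0] is 0 by
    default; so the integral stops at [A < 1] and the value at 1 is reached by continuity. *)
Lemma K_int_lower (n : R) (w v : C) : (0 < n)%R -> (2 <= fst (RtoC n + v)%C)%R ->
  exists J, (forall A, (0 <= A < 1)%R ->
      is_CInt (fun t => Cexp (RtoC n * (RtoC (ln (1 - t)) - - w * RtoC t) + v * RtoC (ln (1 - t)))) 0 A (J A)) /\
    forall eps, (0 < eps)%R -> exists X, (0 <= X < 1)%R /\ forall A, (X <= A < 1)%R ->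
      (Cmod (J A - Cexp (RtoC n * w) * K_int n (RtoC n + v) w) < eps)%R.
Proof.
  intros Hn Hs. set (s := RtoC n + v) in *.
  set (h := fun t => Cexp (RtoC n * w * RtoC t) * rpow s (1 - t)).
  assert (Hh : forall t, ex_cderive h t).
  { intros t. apply ex_cderive_mult; [apply ex_cderive_Cexp_linear|].
    destruct (ex_cderive_rpow s (1 - t) Hs) as [l Hl].
    eexists. apply (is_cderive_comp (rpow s) (fun x => 1 - x)%R); [exact Hl|].
    apply Derive_correct. auto_derive; trivial. }
  assert (HC : forall y, is_CInt h 0 y (CInt h 0 y)) by (intros; apply CInt_correct; auto).
  exists (fun A => CInt h 0 A). split.
  - intros A HA. eapply is_RInt_ext; [|apply HC].
    intros t Ht. rewrite Rmin_left, Rmax_right in Ht by lra.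
    unfold h. rewrite rpow_pos by lra. rewrite <- Cexp_plus. f_equal. unfold s. ring.
  - intros eps He.
    assert (E : CInt h 0 1 = Cexp (RtoC n * w) * K_int n s w).
    { assert (H1 := is_CInt_cmult (- Cexp (RtoC n * w)) _ _ _ _
        (@is_RInt_swap C_R_NormedModule _ _ _ _ (is_CInt_K n s w Hs))).
      apply (is_CInt_unique h 0 1); [apply HC|].
      assert (H2 := is_CInt_comp_lin (fun z => - Cexp (RtoC n * w) * (Cexp (- (RtoC n * w) * RtoC z) * rpow s z))
         (- (1)) 1 0 1 (- Cexp (RtoC n * w) * opp (K_int n s w))).
      replace (- (1) * 0 + 1)%R with 1%R in H2 by ring. replace (- (1) * 1 + 1)%R with 0%R in H2 by ring.
      specialize (H2 H1).
      replace (Cexp (RtoC n * w) * K_int n s w) with (- Cexp (RtoC n * w) * opp (K_int n s w)).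
      - eapply is_RInt_ext; [|exact H2]. intros t _. cbv beta. unfold h.
        replace (- (1) * t + 1)%R with (1 - t)%R by ring.
        replace (RtoC n * w * RtoC t) with (RtoC n * w + - (RtoC n * w) * RtoC (1 - t))
          by (rewrite RtoC_minus; ring).
        rewrite Cexp_plus, RtoC_opp. match goal with |- ?x = ?y => change (@eq C x y) end. ring.
      - change (opp (K_int n s w)) with (- K_int n s w). ring. }
    rewrite <- E.
    assert (HD : ex_cderive (fun y => CInt h 0 y) 1) by (eexists; apply (is_cderive_CInt h); auto).
    destruct (ex_cderive_eps _ _ eps HD He) as [d [Hd H]].
    exists (Rmax 0 (1 - d / 2)). split.
    + split; [apply Rmax_l|]. apply Rmax_lub_lt; lra.
    + intros A HA. assert (m := Rmax_r 0 (1 - d / 2)). apply H.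
      rewrite Rabs_minus_sym, Rabs_pos_eq; lra.
Qed.

(** * Expansions of the incomplete gamma integrals *)

Definition laplace_term (l : nat) (v d : C) (mu : nat -> C) (Q q : nat) : C :=
  Csum_lt Q (fun k => laplace_coef l v d q k / RtoC (INR (fact k)) * mu (l * k + q)%nat).

Lemma le_pow_self (nu : R) l : (1 <= nu)%R -> (1 <= l)%nat -> (nu <= nu ^ l)%R.
Proof. intros H Hl. rewrite <- (pow_1 nu) at 1. apply Rle_pow; assumption. Qed.

Lemma RtoC_plus_re_ge (n : R) (v : C) : (2 + Rabs (fst v) <= n)%R -> (2 <= fst (RtoC n + v)%C)%R.
Proof.
  intros H. simpl. assert (A := Rle_abs (- fst v)). rewrite Rabs_Ropp in A. lra.
Qed.

Lemma is_log_shift (w : C) : (1 <= fst w)%R -> is_log (/ w) (log_shift w) 1.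
Proof.
  intros Hw. assert (Hn : w <> 0) by (intros E; rewrite E in Hw; simpl in Hw; lra).
  split.
  - unfold log_shift. rewrite Cplus_0_r. ring.
  - intros t Ht. assert (Hp : (0 < fst (w + RtoC t)%C)%R) by (simpl; lra).
    assert (Hm : w + RtoC t <> 0) by (intros E; rewrite E in Hp; simpl in Hp; lra).
    eapply is_cderive_eq.
    + apply is_cderive_minus; [|apply is_cderive_const].
      apply (is_cderive_Clog (fun x => w + RtoC x)); [exact Hp|].
      apply is_cderive_plus; [apply is_cderive_const|apply is_cderive_id].
    + field. repeat split; try assumption.
Qed.

Lemma log_shift_bounds (w : C) t : (1 <= fst w)%R -> (0 <= t)%R ->
  (0 <= fst (log_shift w t))%R /\ (Rabs (snd (log_shift w t)) <= 4)%R.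
Proof.
  intros Hw Ht. split.
  - simpl. assert (Hm : (0 < Cmod w)%R).
    { apply Cmod_gt_0. intros E; rewrite E in Hw; simpl in Hw; lra. }
    assert (Hl : (Cmod w <= Cmod (w + RtoC t))%R).
    { unfold Cmod. apply sqrt_le_1_alt. simpl. nra. }
    assert (ln (Cmod w) <= ln (Cmod (w + RtoC t)))%R by (apply ln_le; assumption). lra.
  - assert (B1 := Carg_bound (w + RtoC t) ltac:(simpl; lra)). assert (B2 := Carg_bound w ltac:(lra)).
    change (snd (log_shift w t)) with (Carg (w + RtoC t) + - Carg w)%R.
    eapply Rle_trans; [apply Rabs_triang|]. rewrite Rabs_Ropp. lra.
Qed.

(** The tail condition makes Re log (1 + t / w) fall short of [t] by a fixed proportion beyond any
    [e]; the factor (1 + t / w)^v is then absorbed for large [nu]. *)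
Lemma upper_expansion l (w c v : C) mu Q :
  (1 <= l)%nat -> (0 < fst c)%R -> (1 <= fst w)%R -> has_moments l c mu ->
  (forall t, log_poly (/ w) l t - 1 * RtoC t = - (c * RtoC (t ^ l))) ->
  (forall e, (0 < e)%R -> exists k, (0 < k)%R /\ forall t, (e <= t)%R -> (fst (log_shift w t) <= (1 - k) * t)%R) ->
  exists M N, forall nu, (N <= nu)%R ->
    (Cmod ((T_n (nu ^ l) w v + 1) / RtoC (nu ^ l)
       - Csum_lt Q (fun q => laplace_term l v (/ w) mu Q q / RtoC (nu ^ S q)))%C <= M / nu ^ S Q)%R.
Proof.
  intros Hl Hc Hw Hmu Hb Htail.
  destruct (laplace_expansion l 1 c (/ w) v (log_shift w) 1 mu (fun _ => True) Q) as (M & N & e & He & H);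
    try assumption; try lra; [now apply is_log_shift|auto| |].
  { intros e He. destruct (Htail e He) as [k [Hk Ht]].
    assert (Hv0 := Rabs_pos (fst v)).
    (* Half of the rate [k] is spent on Re v times Re L, at most |Re v| t, which fixes the threshold
       for [nu]; the constant comes from |Im L| <= 4. *)
    exists (exp (4 * Rabs (snd v))), (k / 2)%R, (Rmax 1 (2 * Rabs (fst v) / k)).
    split; [lra|]. split; [left; apply exp_pos|].
    intros nu t Hnu Het _. specialize (Ht t Het).
    assert (m1 := Rmax_l 1 (2 * Rabs (fst v) / k)). assert (m2 := Rmax_r 1 (2 * Rabs (fst v) / k)).
    destruct (log_shift_bounds w t Hw ltac:(lra)) as [B1 B2].
    set (L := log_shift w t) in *.
    rewrite Cmod_Cexp, <- exp_plus. apply exp_le.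
    replace (fst (RtoC (nu ^ l) * (L - 1 * RtoC t) + v * L)) with
      (nu ^ l * (fst L - t) + (fst v * fst L - snd v * snd L))%R
      by (generalize (nu ^ l)%R; intros x; simpl; ring).
    assert (Hnl := le_pow_self nu l ltac:(lra) Hl).
    assert (Hkn : (2 * Rabs (fst v) <= k * nu)%R).
    { apply Rle_trans with (k * (2 * Rabs (fst v) / k))%R; [right; field; lra|apply Rmult_le_compat_l; lra]. }
    assert (H1 : (- (snd v * snd L) <= 4 * Rabs (snd v))%R).
    { eapply Rle_trans; [apply Rle_abs|]. rewrite Rabs_Ropp, Rabs_mult.
      assert (A := Rabs_pos (snd v)). nra. }
    assert (Hkt : (k <= 1)%R).
    { assert (0 <= (1 - k) * t)%R by lra. assert (0 < t)%R by lra. nra. }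
    assert (H2 : (fst v * fst L <= Rabs (fst v) * t)%R).
    { apply Rle_trans with (Rabs (fst v) * fst L)%R.
      - apply Rmult_le_compat_r; [assumption|apply Rle_abs].
      - apply Rmult_le_compat_l; [assumption|]. nra. }
    assert (H3 : (nu ^ l * (fst L - t) <= nu * (- (k * t)))%R).
    { apply Rle_trans with (nu ^ l * (- (k * t)))%R.
      - apply Rmult_le_compat_l; lra.
      - assert (0 <= k * t)%R by nra. nra. }
    assert (H4 : (Rabs (fst v) * t <= k * nu / 2 * t)%R) by (apply Rmult_le_compat_r; lra).
    nra. }
  exists M, (Rmax (Rmax 1 N) (2 + Rabs (fst v))). intros nu Hnu.
  assert (m1 := Rmax_l (Rmax 1 N) (2 + Rabs (fst v))). assert (m2 := Rmax_r (Rmax 1 N) (2 + Rabs (fst v))).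
  assert (m3 := Rmax_l 1 N). assert (m4 := Rmax_r 1 N).
  assert (Hnl := le_pow_self nu l ltac:(lra) Hl).
  destruct (T_n_upper (nu ^ l) w v) as [J [HJ HT]]; [lra|apply RtoC_plus_re_ge; lra|assumption|].
  (* The bound on [J A] is uniform in [A], so it passes to the limit. *)
  apply le_epsilon. intros eps Heps. destruct (HT eps Heps) as [X HX].
  set (A := Rmax X e). assert (n1 := Rmax_l X e). assert (n2 := Rmax_r X e).
  specialize (HX A n1). specialize (H nu A (J A) ltac:(lra) n2 I (HJ A ltac:(unfold A; lra))).
  match goal with |- (Cmod (?a - ?b) <= _)%R => replace (a - b) with ((J A - b) - (J A - a)) by ring end.
  eapply Rle_trans; [apply Cmod_minus_le|]. apply Rplus_le_compat; [exact H|lra].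
Qed.

(** The counterpart with d = -1 and upper ends [t < 1]; the condition on [ln (1 - t)] makes its sum
    with Re w times [t] decrease linearly away from 0. *)
Lemma lower_expansion l (w c v : C) mu Q :
  (1 <= l)%nat -> (0 < fst c)%R -> has_moments l c mu ->
  (forall t, log_poly (- (1)) l t - - w * RtoC t = - (c * RtoC (t ^ l))) ->
  (forall e, (0 < e)%R -> exists k, (0 < k)%R /\
     forall t, (e <= t < 1)%R -> (ln (1 - t) <= - ((fst w + k) * t))%R) ->
  exists M N, forall nu, (N <= nu)%R ->
    (Cmod (Cexp (RtoC (nu ^ l) * w) * K_int (nu ^ l) (RtoC (nu ^ l) + v) w
       - Csum_lt Q (fun q => laplace_term l v (- (1)) mu Q q / RtoC (nu ^ S q)))%C <= M / nu ^ S Q)%R.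
Proof.
  intros Hl Hc Hmu Hb Htail.
  destruct (laplace_expansion l (- w) c (- (1)) v (fun t => RtoC (ln (1 - t))) (/ 2) mu (fun t => t < 1)%R Q)
    as (M & N & e & He & H); try assumption; try lra.
  { split.
    - rewrite Rminus_0_r, ln_1. reflexivity.
    - intros t Ht. eapply is_cderive_eq.
      + apply is_cderive_RtoC. instantiate (1 := (- / (1 - t))%R). auto_derive; [lra|field; lra].
      + replace (1 + - (1) * RtoC t) with (RtoC (1 - t)) by (rewrite RtoC_minus; ring).
        rewrite RtoC_opp, RtoC_inv by lra. unfold Cdiv; ring. }
  { intros; lra. }
  { intros e He. destruct (Htail e He) as [k [Hk Ht]].
    assert (Hv0 := Rabs_pos (fst v)). assert (Hw0 := Rabs_pos (fst w + k)).
    set (X := (2 * (Rabs (fst v) * Rabs (fst w + k)) / k)%R).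
    exists 1%R, (k / 2)%R, (Rmax (Rmax 1 (Rabs (fst v))) X).
    split; [lra|]. split; [lra|]. intros nu t Hnu Het Ht1. specialize (Ht t ltac:(lra)).
    assert (m1 := Rmax_l (Rmax 1 (Rabs (fst v))) X). assert (m2 := Rmax_r (Rmax 1 (Rabs (fst v))) X).
    assert (m3 := Rmax_l 1 (Rabs (fst v))). assert (m4 := Rmax_r 1 (Rabs (fst v))).
    rewrite Cmod_Cexp, Rmult_1_l. apply exp_le.
    assert (Hnl := le_pow_self nu l ltac:(lra) Hl).
    replace (fst (RtoC (nu ^ l) * (RtoC (ln (1 - t)) - - w * RtoC t) + v * RtoC (ln (1 - t)))) with
      ((nu ^ l + fst v) * ln (1 - t) + nu ^ l * (fst w * t))%R
      by (generalize (nu ^ l)%R; intros x; simpl; ring).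
    assert (Hkn : (2 * (Rabs (fst v) * Rabs (fst w + k)) <= k * nu)%R).
    { apply Rle_trans with (k * X)%R; [right; unfold X; field; lra|apply Rmult_le_compat_l; lra]. }
    (* [ln (1 - t)] is unbounded below near 1, so Re v times it is not estimated alone: it is kept
       together with [nu ^ l], whose sum with Re v is nonnegative. The remaining Re v (Re w + k) is
       at most [k * nu / 2] by the choice of [X]. *)
    assert (Hnv : (0 <= nu ^ l + fst v)%R).
    { assert (A := Rle_abs (- fst v)). rewrite Rabs_Ropp in A. lra. }
    assert (H1 : ((nu ^ l + fst v) * ln (1 - t) <= (nu ^ l + fst v) * - ((fst w + k) * t))%R)
      by (apply Rmult_le_compat_l; assumption).
    assert (H2 : (- (fst v * (fst w + k)) <= Rabs (fst v) * Rabs (fst w + k))%R).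
    { rewrite <- Rabs_mult, <- Rabs_Ropp. apply Rle_abs. }
    assert (H3 : (- (fst v * (fst w + k)) * t <= k * nu / 2 * t)%R) by (apply Rmult_le_compat_r; lra).
    assert (H4 : (0 <= (nu ^ l - nu) * (k * t))%R) by (apply Rmult_le_pos; nra).
    nra. }
  exists M, (Rmax (Rmax 1 N) (2 + Rabs (fst v))). intros nu Hnu.
  assert (m1 := Rmax_l (Rmax 1 N) (2 + Rabs (fst v))). assert (m2 := Rmax_r (Rmax 1 N) (2 + Rabs (fst v))).
  assert (m3 := Rmax_l 1 N). assert (m4 := Rmax_r 1 N).
  assert (Hnl := le_pow_self nu l ltac:(lra) Hl).
  destruct (K_int_lower (nu ^ l) w v) as [J [HJ HT]]; [lra|apply RtoC_plus_re_ge; lra|].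
  apply le_epsilon. intros eps Heps. destruct (HT eps Heps) as [X [HX0 HX]].
  set (A := Rmax X e). assert (n1 := Rmax_l X e). assert (n2 := Rmax_r X e).
  assert (HA : (X <= A < 1)%R) by (split; [exact n1|apply Rmax_lub_lt; lra]).
  specialize (HX A HA). specialize (H nu A (J A) ltac:(lra) n2 ltac:(lra) (HJ A ltac:(lra))).
  match goal with |- (Cmod (?a - ?b) <= _)%R => replace (a - b) with ((J A - b) - (J A - a)) by ring end.
  eapply Rle_trans; [apply Cmod_minus_le|]. apply Rplus_le_compat; [exact H|lra].
Qed.

(** Exchanging the sums puts the weight [m] of the De Moivre polynomial outside, as in the stated
    coefficients; the powers of [d] combine to [d ^ q], leaving the sign (-1)^m. *)
Lemma laplace_term_eq l (v d : C) mu Q q : (q < Q)%nat ->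
  laplace_term l v d mu Q q =
  Csum q (fun m => RtoC ((-1) ^ m) * Cbinom v (q - m) *
    Csum m (fun k => RtoC (deMoivre (log_rem_coef l) m k) / RtoC (INR (fact k)) *
      ((d * (- d) ^ (l - 1)) ^ k * d ^ q * mu (l * k + q)%nat))).
Proof.
  intros Hq. unfold laplace_term.
  set (X := fun m k => RtoC ((-1) ^ m) * Cbinom v (q - m) *
      (RtoC (deMoivre (log_rem_coef l) m k) / RtoC (INR (fact k)) *
      ((d * (- d) ^ (l - 1)) ^ k * d ^ q * mu (l * k + q)%nat))).
  transitivity (Csum_lt Q (fun k => Csum_lt (S q) (fun m => X m k))).
  - apply Csum_lt_ext; intros k _. unfold laplace_coef, conv.
    rewrite Csum_Csum_lt. unfold Cdiv at 1. rewrite <- !Csum_lt_mult_r.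
    apply Csum_lt_ext; intros m Hm. unfold X, Cpow_coef, binom_coef.
    replace (d ^ q) with (d ^ m * d ^ (q - m)) by (rewrite <- Cpow_add_r; f_equal; lia).
    replace ((- d) ^ m) with (RtoC ((-1) ^ m) * d ^ m)
      by (rewrite RtoC_pow, <- Cpow_mult_l; f_equal; ring).
    unfold Cdiv. ring.
  - rewrite Csum_lt_exchange, Csum_Csum_lt. apply Csum_lt_ext; intros m Hm.
    (* For [k > m] the De Moivre polynomial vanishes, so the range of [k] no longer depends on
       [Q]. *)
    rewrite (Csum_lt_trunc (S m)) by (try lia; intros k Hk; unfold X; rewrite deMoivre_zero by lia;
      unfold Cdiv; ring).
    rewrite Csum_Csum_lt, <- Csum_lt_mult_l. reflexivity.
Qed.

(** The parameters [x] and [y] put both integrals into the shape of [U_r]: d = 1/w, c = 1 - 1/w give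
    x = w, and d = -1, c = 1 - w give x = -1, each time with y = w - 1. *)
Lemma laplace_term_linear (v d c x y : C) Q q : (q < Q)%nat -> c <> 0 -> y <> 0 ->
  (forall s, d ^ s / c ^ S s = x / y ^ S s) ->
  laplace_term 1 v d (fun s => RtoC (INR (fact s)) / c ^ S s) Q q =
  Csum q (fun m => RtoC ((-1) ^ m) * Cbinom v (q - m) *
    Csum m (fun k => x / y ^ (q + k + 1)
        * RtoC (INR (fact (q + k)) / INR (fact k) * deMoivre a2 m k)%R)).
Proof.
  intros Hq Hc Hy Hx. rewrite laplace_term_eq by assumption.
  apply Csum_ext; intros m _. f_equal. apply Csum_ext; intros k _.
  replace (1 * k + q)%nat with (q + k)%nat by lia. replace (q + k + 1)%nat with (S (q + k)) by lia.
  replace (d * (- d) ^ (1 - 1)) with d by (simpl; ring).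
  replace (d ^ k * d ^ q * (RtoC (INR (fact (q + k))) / c ^ S (q + k))) with
    (RtoC (INR (fact (q + k))) * (d ^ (q + k) / c ^ S (q + k)))
    by (rewrite Cpow_add_r; unfold Cdiv; ring).
  rewrite Hx, RtoC_mult, RtoC_div by apply INR_fact_neq_0.
  change (log_rem_coef 1) with a2. unfold Cdiv. ring.
Qed.

Lemma Rinv_neg1_pow k : (/ (-1) ^ k = (-1) ^ k)%R.
Proof.
  assert (H : ((-1) ^ k * (-1) ^ k = 1)%R).
  { rewrite <- Rpow_mult_distr. replace (-1 * -1)%R with 1%R by ring. apply pow1. }
  apply Rmult_eq_reg_l with ((-1) ^ k)%R.
  - rewrite Rinv_r; [now rewrite H|]. intros E; rewrite E in H; lra.
  - intros E; rewrite E in H; lra.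
Qed.

(** The condition d^2 = 1 covers d = 1 for the upper and d = -1 for the lower integral. The leading
    factor of [log_rem] is then -1 in both cases, and the two sides differ by [d ^ q] only. *)
Lemma laplace_term_gauss (v d : C) Q q (c : nat -> R) : (q < Q)%nat -> d * d = 1 ->
  (forall k, gauss_moment (2 * k + q) = RtoC (c k)) ->
  laplace_term 2 v d gauss_moment Q q =
  d ^ q * Csum q (fun m => RtoC ((-1) ^ m) * Cbinom v (q - m) *
    Csum m (fun k => RtoC (c k / ((-1) ^ k * INR (fact k)) * deMoivre a3 m k)%R)).
Proof.
  intros Hq Hd Hc. rewrite laplace_term_eq by assumption. rewrite <- Csum_mult_l.
  apply Csum_ext; intros m _.
  match goal with |- _ * ?A = d ^ q * (?B * ?D) => transitivity (B * (d ^ q * D)); [|ring] end.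
  f_equal. rewrite <- Csum_mult_l. apply Csum_ext; intros k _.
  rewrite Hc. replace (d * (- d) ^ (2 - 1)) with (RtoC (-1))
    by (simpl; transitivity (- (d * d)); [rewrite Hd; apply injective_projections; simpl; ring|ring]).
  rewrite <- RtoC_pow. change (log_rem_coef 2) with a3.
  unfold Rdiv. rewrite Rinv_mult, Rinv_neg1_pow, !RtoC_mult, RtoC_inv by apply INR_fact_neq_0.
  unfold Cdiv. ring.
Qed.

Lemma laplace_term_gauss_even (v d : C) Q r : (2 * r < Q)%nat -> d * d = 1 ->
  laplace_term 2 v d gauss_moment Q (2 * r) = RtoC (sqrt (PI / 2)) * gamma_c r v.
Proof.
  intros Hq Hd.
  rewrite (laplace_term_gauss v d Q (2 * r) (fun k => sqrt (PI / 2) * INR (dfact (2 * r + 2 * k - 1)))%R) by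
    (try assumption; intros k; unfold gauss_moment;
     replace (Nat.even (2 * k + 2 * r)) with true
       by (symmetry; apply Nat.even_spec; exists (k + r)%nat; lia);
     replace (2 * k + 2 * r - 1)%nat with (2 * r + 2 * k - 1)%nat by lia; f_equal; ring).
  replace (d ^ (2 * r)) with (RtoC 1).
  - rewrite Cmult_1_l. unfold gamma_c. rewrite <- Csum_mult_l. apply Csum_ext; intros m _.
    match goal with |- _ * _ = ?c * (?B * ?D) => transitivity (B * (c * D)); [|ring] end.
    f_equal. rewrite <- Csum_mult_l. apply Csum_ext; intros k _. rewrite <- RtoC_mult. f_equal.
    unfold Rdiv; ring.
  - rewrite Cpow_mult_r. simpl (d ^ 2). rewrite Cmult_1_r, Hd. now rewrite Cpow_1_l.
Qed.

(** The sign [d] is what later makes the [rho] terms of the two sides cancel. *)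
Lemma laplace_term_gauss_odd (v d : C) Q r : (2 * r + 1 < Q)%nat -> d * d = 1 ->
  laplace_term 2 v d gauss_moment Q (2 * r + 1) = d * (delta0 r - rho r v).
Proof.
  intros Hq Hd.
  rewrite (laplace_term_gauss v d Q (2 * r + 1) (fun k => INR (dfact (2 * r + 2 * k)))).
  - replace (d ^ (2 * r + 1)) with d.
    + unfold rho. ring.
    + rewrite Cpow_add_r, Cpow_mult_r. simpl (d ^ 2). rewrite Cmult_1_r, Hd, Cpow_1_l. simpl; ring.
  - assumption.
  - assumption.
  - intros k. unfold gauss_moment.
    replace (Nat.even (2 * k + (2 * r + 1))) with false.
    + replace (2 * k + (2 * r + 1) - 1)%nat with (2 * r + 2 * k)%nat by lia. f_equal; ring.
    + symmetry. rewrite <- Nat.negb_odd. apply Bool.negb_false_iff, Nat.odd_spec. exists (k + r)%nat; lia.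
Qed.

(** * Expansions of S_n and T_n *)

Lemma ln_lt_sub_1 (x : R) : (0 < x)%R -> (x <> 1)%R -> (ln x < x - 1)%R.
Proof.
  intros H0 H1. assert (H : (ln x <> 0)%R).
  { intros E. apply H1. rewrite <- (exp_ln x H0), E. apply exp_0. }
  assert (A := exp_ineq1 (ln x) H). rewrite exp_ln in A by assumption. lra.
Qed.

Lemma ln_le_sub_1 (x : R) : (0 < x)%R -> (ln x <= x - 1)%R.
Proof. intros H. assert (A := exp_ineq1_le (ln x)). rewrite exp_ln in A by assumption. lra. Qed.

(* Beyond [a] the tangent of [ln] at [a] bounds it with slope [/ a <> 1], so the gap between
   [x - 1] and [ln x] grows linearly. *)
Lemma ln_tail (a : R) : (0 < a)%R -> (a <> 1)%R ->
  exists k, (0 < k)%R /\ forall x, (0 < x)%R -> ((x - a) * (a - 1) >= 0)%R ->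
    (ln x <= x - 1 - k * Rabs (x - 1))%R.
Proof.
  intros Ha Hn.
  assert (Hs : (0 < Rabs (a - 1))%R) by (apply Rabs_pos_lt; lra).
  assert (H1 := ln_lt_sub_1 a Ha Hn).
  set (k1 := ((a - 1 - ln a) / Rabs (a - 1))%R). set (k2 := (Rabs (a - 1) / a)%R).
  assert (Hk1 : (0 < k1)%R) by (apply Rdiv_lt_0_compat; lra).
  assert (Hk2 : (0 < k2)%R) by (apply Rdiv_lt_0_compat; lra).
  exists (Rmin k1 k2). split; [now apply Rmin_glb_lt|]. intros x Hx Hxa.
  assert (m1 := Rmin_l k1 k2). assert (m2 := Rmin_r k1 k2). set (k := Rmin k1 k2) in *.
  assert (T : (ln x <= ln a + (x - a) / a)%R).
  { assert (A := ln_le_sub_1 (x / a) ltac:(now apply Rdiv_lt_0_compat)).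
    rewrite ln_div in A by assumption. replace ((x - a) / a)%R with (x / a - 1)%R by (field; lra). lra. }
  assert (E1 : (k1 * Rabs (a - 1) = a - 1 - ln a)%R) by (unfold k1; field; lra).
  assert (E2 : (k2 * Rabs (x - a) = (x - a) - (x - a) / a)%R).
  { unfold k2. destruct (Rle_dec 1 a) as [H|H].
    - assert (0 <= x - a)%R by nra. rewrite !Rabs_pos_eq by lra. field. lra.
    - assert (x - a <= 0)%R by nra. rewrite !Rabs_left1 by lra. field. lra. }
  assert (E3 : (Rabs (x - 1) <= Rabs (x - a) + Rabs (a - 1))%R).
  { replace (x - 1)%R with ((x - a) + (a - 1))%R by ring. apply Rabs_triang. }
  assert (P1 := Rabs_pos (x - a)). assert (P2 : (0 < k)%R) by now apply Rmin_glb_lt.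
  assert (k * Rabs (x - 1) <= k * Rabs (x - a) + k * Rabs (a - 1))%R by nra.
  assert (k * Rabs (x - a) <= k2 * Rabs (x - a))%R by (apply Rmult_le_compat_r; lra).
  assert (k * Rabs (a - 1) <= k1 * Rabs (a - 1))%R by (apply Rmult_le_compat_r; lra).
  lra.
Qed.

(** From |w + t| <= |w| + t and log (1 + t / |w|) <= t / |w|; the gain is 1 - 1 / |w|. *)
Lemma upper_tail_linear (w : C) : (1 <= fst w)%R -> (1 < Cmod w)%R -> forall e, (0 < e)%R ->
  exists k, (0 < k)%R /\ forall t, (e <= t)%R -> (fst (log_shift w t) <= (1 - k) * t)%R.
Proof.
  intros Hw Hm e He. exists (1 - / Cmod w)%R.
  assert (Hi : (/ Cmod w < 1)%R) by (rewrite <- Rinv_1; apply Rinv_lt_contravar; lra).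
  split; [lra|]. intros t Ht.
  assert (Hmt : (Cmod (w + RtoC t) <= Cmod w + t)%R).
  { eapply Rle_trans; [apply Cmod_triangle|]. rewrite Cmod_RtoC_nonneg by lra. lra. }
  assert (Hp : (0 < Cmod (w + RtoC t))%R).
  { apply Cmod_gt_0. intros E. apply (f_equal fst) in E. simpl in E. lra. }
  simpl. assert (A := ln_le_sub_1 (Cmod (w + RtoC t) / Cmod w) ltac:(apply Rdiv_lt_0_compat; lra)).
  rewrite ln_div in A by lra.
  assert (Cmod (w + RtoC t) / Cmod w <= (Cmod w + t) / Cmod w)%R
    by (apply Rmult_le_compat_r; [left; apply Rinv_0_lt_compat; lra|exact Hmt]).
  replace ((Cmod w + t) / Cmod w)%R with (1 + / Cmod w * t)%R in H by (field; lra).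
  lra.
Qed.

Lemma upper_tail_gauss : forall e, (0 < e)%R ->
  exists k, (0 < k)%R /\ forall t, (e <= t)%R -> (fst (log_shift 1 t) <= (1 - k) * t)%R.
Proof.
  intros e He. destruct (ln_tail (1 + e) ltac:(lra) ltac:(lra)) as [k [Hk H]].
  exists k. split; [assumption|]. intros t Ht.
  specialize (H (1 + t)%R ltac:(lra) ltac:(nra)).
  replace (1 + t - 1)%R with t in H by ring. rewrite Rabs_pos_eq in H by lra.
  unfold log_shift. rewrite <- RtoC_plus, !Clog_RtoC, ln_1 by lra. simpl. lra.
Qed.

Lemma lower_tail_linear (w : C) : (fst w < 1)%R -> forall e, (0 < e)%R ->
  exists k, (0 < k)%R /\ forall t, (e <= t < 1)%R -> (ln (1 - t) <= - ((fst w + k) * t))%R.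
Proof.
  intros Hw e He. exists (1 - fst w)%R. split; [lra|]. intros t Ht.
  assert (A := ln_le_sub_1 (1 - t) ltac:(lra)). lra.
Qed.

Lemma lower_tail_gauss : forall e, (0 < e)%R ->
  exists k, (0 < k)%R /\ forall t, (e <= t < 1)%R -> (ln (1 - t) <= - ((fst (RtoC 1) + k) * t))%R.
Proof.
  (* The tangent point [1 - e] must be positive; for [e >= 1] the range of [t] is empty. *)
  intros e He. destruct (Rlt_dec e 1) as [He1|He1].
  - destruct (ln_tail (1 - e) ltac:(lra) ltac:(lra)) as [k [Hk H]].
    exists k. split; [assumption|]. intros t Ht.
    specialize (H (1 - t)%R ltac:(lra) ltac:(nra)).
    replace (1 - t - 1)%R with (- t)%R in H by ring.
    rewrite Rabs_Ropp, Rabs_pos_eq in H by lra. simpl. lra.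
  - exists 1%R. split; [lra|]. intros t Ht; lra.
Qed.

Lemma Csum_lt_delta0 K (n : R) : (1 <= K)%nat -> Csum_lt K (fun r => delta0 r / RtoC (n ^ r)) = 1.
Proof.
  intros HK. destruct K as [|K]; [lia|]. rewrite Csum_lt_S_l, Csum_lt_zero.
  - unfold delta0; simpl. field.
  - intros i _. unfold delta0; simpl. unfold Cdiv; ring.
Qed.

Definition U_sum (x y : C) (q : nat) (v : C) : C :=
  Csum q (fun m => RtoC ((-1) ^ m) * Cbinom v (q - m) *
    Csum m (fun k => x / y ^ (q + k + 1)
        * RtoC (INR (fact (q + k)) / INR (fact k) * deMoivre a2 m k)%R)).

Lemma U_sum_scal c x y q v : c * U_sum x y q v = U_sum (c * x) y q v.
Proof.
  unfold U_sum. rewrite <- Csum_mult_l. apply Csum_ext; intros m _.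
  match goal with |- c * (?B * ?D) = _ => transitivity (B * (c * D)); [ring|] end.
  f_equal. rewrite <- Csum_mult_l. apply Csum_ext; intros k _. unfold Cdiv; ring.
Qed.

Lemma U_r_eq r w v : U_r r w v = delta0 r - U_sum w (w - 1) r v.
Proof. reflexivity. Qed.

(** Multiplying the integral by [n] lowers each power by one, and the [- 1] of the representation
    supplies [delta0]. *)
Lemma T_n_upper_expansion (w v : C) K : (1 <= K)%nat -> (1 <= fst w)%R -> w <> 1 ->
  exists M N, forall n, (N <= n)%R ->
    (Cmod (T_n n w v - - Csum_lt K (fun r => U_r r w v / RtoC (n ^ r)))%C <= M / n ^ K)%R.
Proof.
  intros HK Hw Hw1.
  assert (Hw0 : w <> 0) by (intros E; rewrite E in Hw; simpl in Hw; lra).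
  assert (Hw2 : w - 1 <> 0).
  { intros E; apply Hw1. replace w with (w - 1 + 1) by ring. rewrite E; ring. }
  (* Re w < |w|^2 is the only way in which [w <> 1] enters the estimates; it yields both |w| > 1 for
     the tail and Re (1 - 1 / w) > 0 for the moments, on the line Re w = 1 as well. *)
  assert (Hsq : (fst w < fst w * fst w + snd w * snd w)%R).
  { destruct (Req_dec (snd w) 0) as [E|E]; [|nra].
    assert (fst w <> 1)%R; [|nra].
    intros E1. apply Hw1. apply injective_projections; simpl; assumption. }
  assert (Hm : (1 < Cmod w)%R).
  { assert (A := Cmod_sqr w). assert (B := Cmod_ge_0 w). nra. }
  assert (Hc : (0 < fst (1 - / w)%C)%R).
  { simpl. replace (fst w / (fst w * (fst w * 1) + snd w * (snd w * 1)))%R with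
      (fst w / (fst w * fst w + snd w * snd w))%R by (do 2 f_equal; ring).
    assert (fst w / (fst w * fst w + snd w * snd w) < 1)%R; [|lra].
    apply Rmult_lt_reg_r with (fst w * fst w + snd w * snd w)%R; [lra|].
    unfold Rdiv; rewrite Rmult_assoc, Rinv_l by lra. lra. }
  assert (Hcn : 1 - / w <> 0) by (intros E; rewrite E in Hc; simpl in Hc; lra).
  destruct (upper_expansion 1 w (1 - / w) v _ K ltac:(lia) Hc Hw (has_moments_linear _ Hc)) as (M & N & H).
  - intros t. unfold log_poly. simpl. rewrite Rmult_1_r. field. exact Hw0.
  - now apply upper_tail_linear.
  - exists M, (Rmax 1 N). intros n Hn. assert (m1 := Rmax_l 1 N). assert (m2 := Rmax_r 1 N).
    specialize (H n ltac:(lra)). rewrite pow_1 in H.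
    assert (Hnz : RtoC n <> 0) by (apply RtoC_neq_0; lra).
    match type of H with (Cmod ?X <= _)%R =>
      replace (T_n n w v - _) with (RtoC n * X) end.
    + rewrite Cmod_mult, Cmod_RtoC_nonneg by lra.
      eapply Rle_trans; [apply Rmult_le_compat_l; [lra|exact H]|].
      right. simpl. field. split; [apply pow_nonzero|]; lra.
    + rewrite (Csum_lt_ext K (fun r => U_r r w v / RtoC (n ^ r))
        (fun r => delta0 r / RtoC (n ^ r) - RtoC n * (laplace_term 1 v (/ w)
           (fun s => RtoC (INR (fact s)) / (1 - / w) ^ S s) K r / RtoC (n ^ S r)))).
      * rewrite Csum_lt_minus, Csum_lt_delta0, Csum_lt_mult_l by assumption. field. exact Hnz.
      * intros r Hr. rewrite U_r_eq.
        rewrite (laplace_term_linear v (/ w) (1 - / w) w (w - 1)); try assumption.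
        -- fold (U_sum w (w - 1) r v). rewrite RtoC_pow_S. field.
           split; [apply RtoC_neq_0, pow_nonzero; lra|exact Hnz].
        -- intros s. replace (1 - / w) with ((w - 1) * / w) by (field; exact Hw0).
           rewrite Cpow_mult_l, !Cpow_inv by exact Hw0. simpl (w ^ S s). simpl ((w - 1) ^ S s).
           field. repeat split; try apply Cpow_nz; assumption.
Qed.

Lemma S_n_lower_expansion (w v : C) K : (1 <= K)%nat -> (fst w < 1)%R ->
  exists M N, forall n, (N <= n)%R ->
    (Cmod (S_n n w v - Csum_lt K (fun r => U_r r w v / RtoC (n ^ r)))%C <= M / n ^ K)%R.
Proof.
  intros HK Hw.
  assert (Hw2 : w - 1 <> 0).
  { intros E. apply (f_equal fst) in E. simpl in E. lra. }
  assert (Hc : (0 < fst (1 - w)%C)%R) by (simpl; lra).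
  assert (Hcn : 1 - w <> 0) by (intros E; rewrite E in Hc; simpl in Hc; lra).
  destruct (lower_expansion 1 w (1 - w) v _ K ltac:(lia) Hc (has_moments_linear _ Hc)) as (M & N & H).
  - intros t. unfold log_poly. simpl. rewrite Rmult_1_r. field.
  - now apply lower_tail_linear.
  - exists (Cmod w * M)%R, (Rmax (2 + Rabs (fst v)) N). intros n Hn.
    assert (m1 := Rmax_l (2 + Rabs (fst v)) N). assert (m2 := Rmax_r (2 + Rabs (fst v)) N).
    assert (Hv := Rabs_pos (fst v)).
    specialize (H n ltac:(lra)). rewrite pow_1 in H.
    assert (Hnz : RtoC n <> 0) by (apply RtoC_neq_0; lra).
    rewrite S_n_eq by (apply RtoC_plus_re_ge; lra).
    match type of H with (Cmod ?X <= _)%R =>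
      replace (1 + _ - _) with (RtoC n * w * X) end.
    + rewrite !Cmod_mult, Cmod_RtoC_nonneg by lra.
      assert (Hmw := Cmod_ge_0 w).
      eapply Rle_trans; [apply Rmult_le_compat_l; [nra|exact H]|].
      right. simpl. field. split; [apply pow_nonzero|]; lra.
    + rewrite (Csum_lt_ext K (fun r => U_r r w v / RtoC (n ^ r))
        (fun r => delta0 r / RtoC (n ^ r) + RtoC n * w * (laplace_term 1 v (- (1))
           (fun s => RtoC (INR (fact s)) / (1 - w) ^ S s) K r / RtoC (n ^ S r)))).
      * rewrite Csum_lt_plus, Csum_lt_delta0, Csum_lt_mult_l by assumption. ring.
      * intros r Hr. rewrite U_r_eq.
        rewrite (laplace_term_linear v (- (1)) (1 - w) (- (1)) (w - 1)); try assumption.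
        -- fold (U_sum (- (1)) (w - 1) r v).
           replace (U_sum w (w - 1) r v) with (- w * U_sum (- (1)) (w - 1) r v)
             by (rewrite U_sum_scal; f_equal; ring).
           rewrite RtoC_pow_S. field.
           split; [apply RtoC_neq_0, pow_nonzero; lra|exact Hnz].
        -- intros s. replace (1 - w) with (- (1) * (w - 1)) by ring.
           rewrite Cpow_mult_l. simpl (_ ^ S s).
           assert (X : (- (1)) ^ s <> 0).
           { apply Cpow_nz. intros E. apply (f_equal fst) in E. simpl in E. lra. }
           field. repeat split; first [assumption|now apply Cpow_nz].
Qed.

Lemma Csum_lt_double K f : Csum_lt (2 * K) f = Csum_lt K (fun r => f (2 * r)%nat + f (2 * r + 1)%nat).
Proof.
  induction K as [|K IH]; [reflexivity|].
  replace (2 * S K)%nat with (S (S (2 * K))) by lia. simpl Csum_lt at 1.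
  change (Csum_lt (K + (K + 0)) f) with (Csum_lt (2 * K) f). rewrite IH. simpl Csum_lt.
  replace (K + (K + 0) + 1)%nat with (S (K + (K + 0))) by lia. ring.
Qed.

(** With nu = sqrt n the error n / nu^{2K+1} is sqrt n / n^K. The orders 2r and 2r + 1 are paired,
    and sqrt (PI / 2) sqrt n is half of sqrt (2 PI n). *)
Lemma gauss_expansion (v d : C) K (Z : R -> C) M N : d * d = 1 ->
  (forall nu, (N <= nu)%R -> (Cmod (Z nu - Csum_lt (2 * K) (fun q =>
     laplace_term 2 v d gauss_moment (2 * K) q / RtoC (nu ^ S q)))%C <= M / nu ^ S (2 * K))%R) ->
  exists N', forall n, (N' <= n)%R ->
    (Cmod (RtoC n * Z (sqrt n) - Csum_lt K (fun r => / RtoC (n ^ r) *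
       (d * (delta0 r - rho r v) + gamma_c r v / 2 * RtoC (sqrt (2 * PI * n)))))%C
     <= M * (sqrt n / n ^ K))%R.
Proof.
  intros Hd H. exists (Rmax 1 (N * N)). intros n Hn.
  assert (m1 := Rmax_l 1 (N * N)). assert (m2 := Rmax_r 1 (N * N)).
  assert (Hs0 : (0 < sqrt n)%R) by (apply sqrt_lt_R0; lra).
  assert (HN : (N <= sqrt n)%R).
  { destruct (Rle_dec N 0) as [H0|H0]; [lra|]. rewrite <- (sqrt_square N) by lra. apply sqrt_le_1; nra. }
  specialize (H (sqrt n) HN).
  assert (Hsq : (sqrt n * sqrt n = n)%R) by (apply sqrt_sqrt; lra).
  assert (Hp : forall r, (sqrt n ^ (2 * r) = n ^ r)%R).
  { intros r. rewrite pow_mult. f_equal. simpl. rewrite Rmult_1_r. exact Hsq. }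
  match type of H with (Cmod ?X <= _)%R =>
    replace (RtoC n * Z (sqrt n) - _) with (RtoC n * X) end.
  - rewrite Cmod_mult, Cmod_RtoC_nonneg by lra.
    eapply Rle_trans; [apply Rmult_le_compat_l; [lra|exact H]|].
    right. simpl (sqrt n ^ S (2 * K))%R. change (K + (K + 0))%nat with (2 * K)%nat. rewrite Hp.
    rewrite <- Hsq at 1. field. split; [apply pow_nonzero|]; lra.
  - rewrite Csum_lt_double.
    match goal with |- RtoC n * (?a - ?b) = ?c - ?e =>
      cut (RtoC n * b = e); [intros <-; ring|] end.
    rewrite <- Csum_lt_mult_l. apply Csum_lt_ext; intros r Hr.
    rewrite laplace_term_gauss_even, laplace_term_gauss_odd by (assumption || lia).
    replace (S (2 * r + 1)) with (2 * (S r))%nat by lia. rewrite Hp.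
    simpl (sqrt n ^ S (2 * r))%R. change (r + (r + 0))%nat with (2 * r)%nat. rewrite Hp.
    replace (sqrt (2 * PI * n)) with (2 * (sqrt (PI / 2) * sqrt n))%R.
    + rewrite !RtoC_mult. simpl (n ^ S r)%R. rewrite RtoC_mult.
      replace (RtoC n) with (RtoC (sqrt n) * RtoC (sqrt n)) by (now rewrite <- RtoC_mult, Hsq).
      field. split; apply RtoC_neq_0; first [lra|apply pow_nonzero; lra].
    + assert (HPI := PI_RGT_0). rewrite <- sqrt_mult by lra.
      rewrite <- (sqrt_square 2) at 1 by lra. rewrite <- sqrt_mult by nra. f_equal. field.
Qed.

Lemma log_poly_2 d t : log_poly d 2 t = d * RtoC t - d * d / 2 * RtoC (t * t).
Proof. unfold log_poly. simpl. rewrite !Rmult_1_r. rewrite RtoC_mult. replace (RtoC (1 + 1)) with (RtoC 2) by (f_equal; ring). field. Qed.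

Lemma T_n_1_expansion (v : C) K : (1 <= K)%nat ->
  exists M N, forall n, (N <= n)%R ->
    (Cmod (T_n n 1 v - Csum_lt K (fun r => / RtoC (n ^ r) *
       (- rho r v + gamma_c r v / 2 * RtoC (sqrt (2 * PI * n)))))%C <= M * (sqrt n / n ^ K))%R.
Proof.
  intros HK.
  assert (H1 : / RtoC 1 = 1) by (field).
  destruct (upper_expansion 2 1 (RtoC (/ 2)) v gauss_moment (2 * K)) as (M & N & H).
  - lia.
  - simpl; lra.
  - simpl; lra.
  - apply has_moments_gauss.
  - intros t. rewrite H1, log_poly_2, RtoC_inv by lra. simpl. rewrite Rmult_1_r. field.
  - apply upper_tail_gauss.
  - rewrite H1 in H.
    destruct (gauss_expansion v 1 K _ M N ltac:(ring) H) as [N' H'].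
    exists M, (Rmax 1 N'). intros n Hn. assert (m1 := Rmax_l 1 N'). assert (m2 := Rmax_r 1 N').
    specialize (H' n ltac:(lra)). cbv beta in H'.
    replace (sqrt n ^ 2)%R with n in H' by (simpl; rewrite Rmult_1_r, sqrt_sqrt; lra).
    match type of H' with (Cmod ?X <= _)%R => replace (T_n n 1 v - _) with X; [exact H'|] end.
    rewrite (Csum_lt_ext K _ (fun r => delta0 r / RtoC (n ^ r) + / RtoC (n ^ r) *
       (- rho r v + gamma_c r v / 2 * RtoC (sqrt (2 * PI * n))))) by (intros; unfold Cdiv; ring).
    rewrite Csum_lt_plus, Csum_lt_delta0 by assumption. field. apply RtoC_neq_0; lra.
Qed.

Lemma S_n_1_expansion (v : C) K : (1 <= K)%nat ->
  exists M N, forall n, (N <= n)%R ->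
    (Cmod (S_n n 1 v - Csum_lt K (fun r => / RtoC (n ^ r) *
       (rho r v + gamma_c r v / 2 * RtoC (sqrt (2 * PI * n)))))%C <= M * (sqrt n / n ^ K))%R.
Proof.
  intros HK.
  destruct (lower_expansion 2 1 (RtoC (/ 2)) v gauss_moment (2 * K)) as (M & N & H).
  - lia.
  - simpl; lra.
  - apply has_moments_gauss.
  - intros t. rewrite log_poly_2, RtoC_inv by lra. simpl. rewrite Rmult_1_r. field.
  - apply lower_tail_gauss.
  - destruct (gauss_expansion v (- (1)) K (fun nu => Cexp (RtoC (nu ^ 2) * 1) *
        K_int (nu ^ 2) (RtoC (nu ^ 2) + v) 1) M N ltac:(ring) H) as [N' H'].
    exists M, (Rmax (2 + Rabs (fst v)) N'). intros n Hn.
    assert (m1 := Rmax_l (2 + Rabs (fst v)) N'). assert (m2 := Rmax_r (2 + Rabs (fst v)) N').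
    assert (Hv := Rabs_pos (fst v)).
    specialize (H' n ltac:(lra)). cbv beta in H'.
    replace (sqrt n ^ 2)%R with n in H' by (simpl; rewrite Rmult_1_r, sqrt_sqrt; lra).
    rewrite S_n_eq by (apply RtoC_plus_re_ge; lra).
    match type of H' with (Cmod ?X <= _)%R => match goal with |- (Cmod ?Y <= _)%R =>
      replace Y with X; [exact H'|] end end.
    rewrite (Csum_lt_ext K (fun r => / RtoC (n ^ r) * (- (1) * (delta0 r - rho r v) + _))
      (fun r => / RtoC (n ^ r) * (rho r v + gamma_c r v / 2 * RtoC (sqrt (2 * PI * n)))
         - delta0 r / RtoC (n ^ r))) by (intros; unfold Cdiv; ring).
    rewrite Csum_lt_minus, Csum_lt_delta0 by assumption. ring.
Qed.

(** * The regions *)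

Lemma div_Rpower (M n : R) K : (0 < n)%R -> (M / Rpower n (INR K - / 2) = M * (sqrt n / n ^ K))%R.
Proof.
  intros Hn. unfold Rminus. rewrite Rpower_plus, Rpower_Ropp, Rpower_sqrt, Rpower_pow by assumption.
  assert (H := sqrt_lt_R0 n Hn). assert (H1 := pow_lt n K Hn). field. lra.
Qed.

(** By definition of [T_n] this is e^n n^{-(n+v)} Gamma(n + v + 1). *)
Definition stirling (v : C) (n : R) : C := T_n n 1 v + S_n n 1 v.

(** The [rho] terms have opposite signs in the two expansions and cancel, and the two halves of
    [gamma_c] add up. *)
Lemma stirling_expansion (v : C) K : (1 <= K)%nat ->
  exists M N, (0 <= M)%R /\ forall n, (N <= n)%R ->
    (Cmod (stirling v n - RtoC (sqrt (2 * PI * n)) * Csum_lt K (fun r => gamma_c r v / RtoC (n ^ r)))%C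
     <= M * (sqrt n / n ^ K))%R.
Proof.
  intros HK. destruct (T_n_1_expansion v K HK) as (M1 & N1 & H1).
  destruct (S_n_1_expansion v K HK) as (M2 & N2 & H2).
  exists (Rmax 0 (M1 + M2))%R, (Rmax 1 (Rmax N1 N2)).
  split; [apply Rmax_l|]. intros n Hn.
  assert (m1 := Rmax_l 1 (Rmax N1 N2)). assert (m2 := Rmax_r 1 (Rmax N1 N2)).
  assert (m3 := Rmax_l N1 N2). assert (m4 := Rmax_r N1 N2). assert (m5 := Rmax_r 0 (M1 + M2)).
  specialize (H1 n ltac:(lra)). specialize (H2 n ltac:(lra)).
  assert (Hp : (0 <= sqrt n / n ^ K)%R).
  { apply Rmult_le_pos; [apply sqrt_pos|left; apply Rinv_0_lt_compat, pow_lt; lra]. }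
  apply Rle_trans with ((M1 + M2) * (sqrt n / n ^ K))%R; [|now apply Rmult_le_compat_r].
  rewrite Rmult_plus_distr_r.
  match type of H1 with (Cmod ?X <= _)%R => match type of H2 with (Cmod ?Y <= _)%R =>
    replace (stirling v n - _) with (X + Y) end end.
  - eapply Rle_trans; [apply Cmod_triangle|]. now apply Rplus_le_compat.
  - unfold stirling. rewrite <- Csum_lt_mult_l.
    match goal with |- ?a - ?b + (?c - ?d) = _ - ?e => cut (b + d = e); [intros <-; ring|] end.
    rewrite <- Csum_lt_plus. apply Csum_lt_ext; intros r _.
    unfold Cdiv.
    transitivity (/ RtoC (n ^ r) * (gamma_c r v * (/ 2 + / 2) * RtoC (sqrt (2 * PI * n)))); [ring|].
    replace (/ 2 + / 2) with (RtoC 1) by field. ring.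
Qed.

(** A crude bound suffices where an exponentially small factor multiplies it; the constant 8 comes
    from [PI <= 4]. *)
Lemma stirling_bound (v : C) : exists M N, (0 <= M)%R /\ forall n, (N <= n)%R -> (Cmod (stirling v n) <= M * n)%R.
Proof.
  destruct (stirling_expansion v 1 ltac:(lia)) as (M & N & HM & H).
  assert (HP := PI_RGT_0). assert (HP4 := PI_4). assert (Hg := Cmod_ge_0 (gamma_c 0 v)).
  exists (M + 8 * Cmod (gamma_c 0 v))%R, (Rmax 1 N). split; [lra|]. intros n Hn.
  assert (m1 := Rmax_l 1 N). assert (m2 := Rmax_r 1 N). specialize (H n ltac:(lra)).
  assert (Hs : (sqrt n <= n)%R).
  { rewrite <- (sqrt_square n) at 2 by lra. apply sqrt_le_1; nra. }
  assert (Hs2 : (sqrt (2 * PI * n) <= 8 * n)%R).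
  { rewrite <- (sqrt_square (8 * n)) by lra. apply sqrt_le_1; nra. }
  assert (Hs0 := sqrt_pos (2 * PI * n)).
  replace (stirling v n) with ((stirling v n - RtoC (sqrt (2 * PI * n)) * Csum_lt 1 (fun r => gamma_c r v / RtoC (n ^ r)))
     + RtoC (sqrt (2 * PI * n)) * gamma_c 0 v) by (simpl; field).
  eapply Rle_trans; [apply Cmod_triangle|]. rewrite Rmult_plus_distr_r. apply Rplus_le_compat.
  - eapply Rle_trans; [exact H|]. apply Rmult_le_compat_l; [assumption|]. rewrite pow_1.
    apply Rmult_le_reg_r with n; [lra|]. unfold Rdiv; rewrite Rmult_assoc, Rinv_l by lra. nra.
  - rewrite Cmod_mult, Cmod_RtoC_nonneg by assumption. nra.
Qed.

Lemma S_n_bound (w v : C) : (fst w < 1)%R ->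
  exists M N, (0 <= M)%R /\ forall n, (N <= n)%R -> (Cmod (S_n n w v) <= M)%R.
Proof.
  intros Hw. destruct (S_n_lower_expansion w v 1 ltac:(lia) Hw) as (M & N & H).
  assert (Hu := Cmod_ge_0 (U_r 0 w v)). assert (HM := Rabs_pos M).
  exists (Rabs M + Cmod (U_r 0 w v))%R, (Rmax 1 N). split; [lra|]. intros n Hn.
  assert (m1 := Rmax_l 1 N). assert (m2 := Rmax_r 1 N). specialize (H n ltac:(lra)).
  replace (S_n n w v) with ((S_n n w v - Csum_lt 1 (fun r => U_r r w v / RtoC (n ^ r))) + U_r 0 w v)
    by (simpl; field).
  eapply Rle_trans; [apply Cmod_triangle|]. apply Rplus_le_compat_r.
  eapply Rle_trans; [exact H|]. rewrite pow_1. assert (A := Rle_abs M).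
  apply Rmult_le_reg_r with n; [lra|]. unfold Rdiv; rewrite Rmult_assoc, Rinv_l by lra. nra.
Qed.

(** The limit [G] of the gamma integral is the same at [w] and at 1. Eliminating it gives an exact
    relation, and the quotient of the two prefactors is (w e^{1-w})^{-n} w^{-v}. *)
Lemma T_n_stirling (w v : C) (n : R) : (2 + Rabs (fst v) <= n)%R ->
  T_n n w v = stirling v n / (wpow_n n w * Ccpow w v) - S_n n w v.
Proof.
  intros Hn. assert (Hv := Rabs_pos (fst v)). assert (Hs := RtoC_plus_re_ge n v Hn).
  destruct (ctends_gamma_int n (RtoC n + v)) as [G HG]; [lra|assumption|].
  unfold stirling. rewrite !(T_n_eq n _ v G) by (assumption || lra).
  rewrite !S_n_eq by assumption. unfold wpow_n, Ccpow. rewrite Clog_RtoC, ln_1 by lra.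
  rewrite Cmult_0_r, Cexp_0, <- Cexp_plus. unfold Cdiv. rewrite <- Cexp_opp.
  assert (E : Cexp (RtoC n * 1) * Cexp (- (RtoC n * Clog w + RtoC n * (1 - w) + v * Clog w)) =
    Cexp (RtoC n * w) * Cexp (- (RtoC n + v) * Clog w)).
  { rewrite <- !Cexp_plus. f_equal. ring. }
  transitivity (RtoC n * G * (Cexp (RtoC n * w) * Cexp (- (RtoC n + v) * Clog w))
    - (1 + RtoC n * w * (Cexp (RtoC n * w) * K_int n (RtoC n + v) w))); [ring|].
  rewrite <- E. ring.
Qed.

Lemma modwe_eq (w : C) : modwe w = (Cmod w * exp (1 - fst w))%R.
Proof. unfold modwe. rewrite Cmod_mult, Cmod_Cexp. reflexivity. Qed.

Lemma modwe_neq_0 (w : C) : (0 < modwe w)%R -> w <> 0.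
Proof. intros H E. rewrite E, modwe_eq, Cmod_0, Rmult_0_l in H. lra. Qed.

Lemma fst_wpow_exponent (w : C) (n : R) : w <> 0 ->
  fst (RtoC n * Clog w + RtoC n * (1 - w)) = (n * ln (modwe w))%R.
Proof.
  intros Hw. apply Cmod_gt_0 in Hw. rewrite modwe_eq, ln_mult, ln_exp by (assumption || apply exp_pos).
  simpl. ring.
Qed.

Lemma Cmod_wpow_n (w : C) n : w <> 0 -> Cmod (wpow_n n w) = exp (n * ln (modwe w)).
Proof. intros Hw. unfold wpow_n. now rewrite Cmod_Cexp, fst_wpow_exponent. Qed.

(** Here |w e^{1-w}| > 1 makes the Stirling part exponentially small, and the expansion is that of
    [- S_n]. *)
Lemma T_n_regX_left (w v : C) K : (1 <= K)%nat -> regX w -> (fst w < 1)%R ->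
  exists M N, forall n, (N <= n)%R ->
    (Cmod (T_n n w v - - Csum_lt K (fun r => U_r r w v / RtoC (n ^ r)))%C <= M / n ^ K)%R.
Proof.
  intros HK HX Hw. unfold regX in HX. assert (Hw0 := modwe_neq_0 w ltac:(lra)).
  assert (Hk : (0 < ln (modwe w))%R) by (rewrite <- ln_1; apply ln_increasing; lra).
  destruct (S_n_lower_expansion w v K HK Hw) as (M1 & N1 & H1).
  destruct (stirling_bound v) as (M2 & N2 & HM2 & H2).
  destruct (pow_exp_le_inv 1 K (ln (modwe w)) Hk) as [M3 [HM3 H3]].
  assert (Hc := proj1 (Cmod_gt_0 _) (Cexp_neq_0 (v * Clog w))). fold (Ccpow w v) in Hc.
  assert (Hci := Rinv_0_lt_compat _ Hc).
  exists (M2 / Cmod (Ccpow w v) * M3 + M1)%R, (Rmax (2 + Rabs (fst v)) (Rmax N1 N2)). intros n Hn.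
  assert (m1 := Rmax_l (2 + Rabs (fst v)) (Rmax N1 N2)). assert (m2 := Rmax_r (2 + Rabs (fst v)) (Rmax N1 N2)).
  assert (m3 := Rmax_l N1 N2). assert (m4 := Rmax_r N1 N2). assert (Hv := Rabs_pos (fst v)).
  specialize (H1 n ltac:(lra)). specialize (H2 n ltac:(lra)). specialize (H3 n ltac:(lra)).
  rewrite T_n_stirling by lra.
  match type of H1 with (Cmod ?X <= _)%R => match goal with |- (Cmod ?Y <= _)%R =>
    replace Y with (stirling v n / (wpow_n n w * Ccpow w v) - X) by ring end end.
  eapply Rle_trans; [apply Cmod_minus_le|]. unfold Rdiv in *. rewrite Rmult_plus_distr_r.
  apply Rplus_le_compat; [|exact H1].
  rewrite Cmod_div by (apply Cmult_neq_0; apply Cexp_neq_0).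
  rewrite Cmod_mult, Cmod_wpow_n by assumption. unfold Rdiv. rewrite Rinv_mult, <- exp_Ropp.
  rewrite pow_1 in H3. rewrite (Rmult_comm (ln _)) in H3.
  apply Rle_trans with (M2 * n * (exp (- (n * ln (modwe w))) * / Cmod (Ccpow w v)))%R.
  - apply Rmult_le_compat_r; [|exact H2]. apply Rmult_le_pos; [left; apply exp_pos|lra].
  - replace (M2 * n * (exp (- (n * ln (modwe w))) * / Cmod (Ccpow w v)))%R with
      (M2 * / Cmod (Ccpow w v) * (n * exp (- (n * ln (modwe w)))))%R by ring.
    rewrite (Rmult_assoc _ M3). apply Rmult_le_compat_l; [nra|exact H3].
Qed.

(** On the curve (w e^{1-w})^n has modulus 1, so both parts contribute; the error of the Stirling
    part, larger by sqrt n, decides. *)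
Lemma T_n_regS (w v : C) K : (1 <= K)%nat -> regS w ->
  exists M N, forall n, (N <= n)%R ->
    (Cmod (T_n n w v - Csum_lt K (fun r => / RtoC (n ^ r) *
       (- U_r r w v + gamma_c r v * (Cexp (0%R, (n * phi w)%R) / Ccpow w v) * RtoC (sqrt (2 * PI * n)))))%C
     <= M * (sqrt n / n ^ K))%R.
Proof.
  intros HK [HS Hw]. assert (Hw0 := modwe_neq_0 w ltac:(lra)).
  destruct (S_n_lower_expansion w v K HK Hw) as (M1 & N1 & H1).
  destruct (stirling_expansion v K HK) as (M2 & N2 & HM2 & H2).
  assert (Hcn := Cexp_neq_0 (v * Clog w)). fold (Ccpow w v) in Hcn.
  assert (Hc := proj1 (Cmod_gt_0 _) Hcn). assert (Hci := Rinv_0_lt_compat _ Hc).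
  exists (M2 / Cmod (Ccpow w v) + Rabs M1)%R, (Rmax (2 + Rabs (fst v)) (Rmax N1 N2)). intros n Hn.
  assert (m1 := Rmax_l (2 + Rabs (fst v)) (Rmax N1 N2)). assert (m2 := Rmax_r (2 + Rabs (fst v)) (Rmax N1 N2)).
  assert (m3 := Rmax_l N1 N2). assert (m4 := Rmax_r N1 N2). assert (Hv := Rabs_pos (fst v)).
  specialize (H1 n ltac:(lra)). specialize (H2 n ltac:(lra)).
  rewrite T_n_stirling by lra.
  assert (Ew : wpow_n n w = Cexp (- (0%R, (n * phi w)%R))).
  { unfold wpow_n. f_equal. apply injective_projections.
    - rewrite fst_wpow_exponent, HS, ln_1 by assumption. simpl; ring.
    - simpl. unfold phi. ring. }
  assert (Ei : stirling v n / (wpow_n n w * Ccpow w v) = stirling v n * (Cexp (0%R, (n * phi w)%R) / Ccpow w v)).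
  { rewrite Ew, Cexp_opp. field. split; [exact Hcn|apply Cexp_neq_0]. }
  rewrite Ei. set (u := Cexp (0%R, (n * phi w)%R) / Ccpow w v) in *.
  assert (Hu : Cmod u = (/ Cmod (Ccpow w v))%R).
  { unfold u. rewrite Cmod_div, Cmod_Cexp by exact Hcn. simpl fst. rewrite exp_0. unfold Rdiv; ring. }
  set (X1 := S_n n w v - Csum_lt K (fun r => U_r r w v / RtoC (n ^ r))) in *.
  set (X2 := stirling v n - RtoC (sqrt (2 * PI * n)) * Csum_lt K (fun r => gamma_c r v / RtoC (n ^ r))) in *.
  match goal with |- (Cmod ?Y <= _)%R => replace Y with (X2 * u - X1) end.
  - eapply Rle_trans; [apply Cmod_minus_le|]. rewrite Rmult_plus_distr_r. apply Rplus_le_compat.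
    + rewrite Cmod_mult, Hu.
      replace (M2 / Cmod (Ccpow w v) * (sqrt n / n ^ K))%R with (M2 * (sqrt n / n ^ K) * / Cmod (Ccpow w v))%R
        by (unfold Rdiv; ring).
      apply Rmult_le_compat_r; lra.
    + eapply Rle_trans; [exact H1|].
      assert (Hp : (0 < / n ^ K)%R) by (apply Rinv_0_lt_compat, pow_lt; lra).
      assert (Hs : (1 <= sqrt n)%R) by (rewrite <- sqrt_1 at 1; apply sqrt_le_1; lra).
      assert (A := Rle_abs M1). assert (A0 := Rabs_pos M1). unfold Rdiv.
      apply Rle_trans with (Rabs M1 * / n ^ K)%R; [apply Rmult_le_compat_r; lra|].
      apply Rmult_le_compat_l; [assumption|]. nra.
  - unfold X1, X2.
    rewrite (Csum_lt_ext K (fun r => / RtoC (n ^ r) * (- U_r r w v + gamma_c r v * u * RtoC (sqrt (2 * PI * n))))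
      (fun r => RtoC (sqrt (2 * PI * n)) * u * (gamma_c r v / RtoC (n ^ r)) - U_r r w v / RtoC (n ^ r)))
      by (intros; unfold Cdiv; ring).
    rewrite Csum_lt_minus, Csum_lt_mult_l. ring.
Qed.

(** Here the Stirling part dominates, and [S_n], being bounded, is exponentially small relative to
    it. *)
Lemma T_n_regY (w v : C) K : (1 <= K)%nat -> regY w -> w <> 0 ->
  exists (M N : R) (E : R -> C), forall n : R, (N <= n)%R ->
     (Cmod (E n) <= M / n ^ K)%R /\
     T_n n w v = RtoC (sqrt (2 * PI * n)) / (wpow_n n w * Ccpow w v)
                 * (Csum_lt K (fun r => gamma_c r v / RtoC (n ^ r)) + E n).
Proof.
  intros HK [HY Hw] Hw0.
  assert (Hmp : (0 < modwe w)%R).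
  { rewrite modwe_eq. apply Rmult_lt_0_compat; [now apply Cmod_gt_0|apply exp_pos]. }
  assert (Hk : (0 < - ln (modwe w))%R).
  { assert (ln (modwe w) < 0)%R by (rewrite <- ln_1; apply ln_increasing; lra). lra. }
  destruct (S_n_bound w v Hw) as (M1 & N1 & HM1 & H1).
  destruct (stirling_expansion v K HK) as (M2 & N2 & HM2 & H2).
  destruct (pow_exp_le_inv 0 K (- ln (modwe w)) Hk) as [M3 [HM3 H3]].
  assert (Hcn := Cexp_neq_0 (v * Clog w)). fold (Ccpow w v) in Hcn.
  assert (Hc := Cmod_ge_0 (Ccpow w v)).
  exists (M2 + M1 * Cmod (Ccpow w v) * M3)%R, (Rmax (2 + Rabs (fst v)) (Rmax N1 N2)).
  (* The relative error is obtained by solving the claimed identity for it, so that only its size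
     remains to be bounded. *)
  exists (fun n => (T_n n w v * (wpow_n n w * Ccpow w v)) / RtoC (sqrt (2 * PI * n))
     - Csum_lt K (fun r => gamma_c r v / RtoC (n ^ r))).
  intros n Hn.
  assert (m1 := Rmax_l (2 + Rabs (fst v)) (Rmax N1 N2)). assert (m2 := Rmax_r (2 + Rabs (fst v)) (Rmax N1 N2)).
  assert (m3 := Rmax_l N1 N2). assert (m4 := Rmax_r N1 N2). assert (Hv := Rabs_pos (fst v)).
  specialize (H1 n ltac:(lra)). specialize (H2 n ltac:(lra)). specialize (H3 n ltac:(lra)).
  assert (HP := PI_RGT_0). assert (HP2 := PI2_1).
  assert (Hs : (sqrt n <= sqrt (2 * PI * n))%R) by (apply sqrt_le_1; nra).
  assert (Hs1 : (1 <= sqrt n)%R) by (rewrite <- sqrt_1 at 1; apply sqrt_le_1; lra).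
  set (q := sqrt (2 * PI * n)) in *.
  assert (Hq : RtoC q <> 0) by (apply RtoC_neq_0; lra).
  assert (Hwp : wpow_n n w <> 0) by apply Cexp_neq_0.
  split; [|field; repeat split; assumption].
  rewrite T_n_stirling by lra.
  match type of H2 with (Cmod ?X <= _)%R => match goal with |- (Cmod ?Y <= _)%R =>
    replace Y with (X / RtoC q - S_n n w v * (wpow_n n w * Ccpow w v) / RtoC q)
      by (field; repeat split; assumption) end end.
  eapply Rle_trans; [apply Cmod_minus_le|]. unfold Rdiv at 1. rewrite Rmult_plus_distr_r.
  rewrite !Cmod_div, !Cmod_mult, Cmod_wpow_n, (Cmod_RtoC_nonneg q) by (assumption || lra).
  assert (Hqi : (0 < / q)%R) by (apply Rinv_0_lt_compat; lra).
  assert (Hpk : (0 < / n ^ K)%R) by (apply Rinv_0_lt_compat, pow_lt; lra).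
  apply Rplus_le_compat.
  - apply Rle_trans with (M2 * (sqrt n / n ^ K) * / q)%R; [apply Rmult_le_compat_r; lra|].
    replace (M2 * (sqrt n / n ^ K) * / q)%R with (M2 * / n ^ K * (sqrt n * / q))%R by (unfold Rdiv; ring).
    assert (sqrt n * / q <= 1)%R.
    { rewrite <- (Rinv_r q) by lra. apply Rmult_le_compat_r; lra. }
    assert (0 <= M2 * / n ^ K)%R by nra. nra.
  - simpl pow in H3 at 1. rewrite Rmult_1_l in H3.
    replace (- (- ln (modwe w) * n))%R with (n * ln (modwe w))%R in H3 by ring.
    assert (Hqi1 : (/ q <= 1)%R) by (rewrite <- Rinv_1; apply Rinv_le_contravar; lra).
    apply Rle_trans with (M1 * (M3 / n ^ K * Cmod (Ccpow w v)) * 1)%R; [|right; unfold Rdiv; ring].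
    assert (He := exp_pos (n * ln (modwe w))).
    unfold Rdiv at 1. apply Rmult_le_compat; [|lra| |exact Hqi1].
    + repeat apply Rmult_le_pos; try apply Cmod_ge_0; lra.
    + apply Rmult_le_compat; [apply Cmod_ge_0|apply Rmult_le_pos; lra|exact H1|].
      apply Rmult_le_compat_r; assumption.
Qed.

Theorem theorem5p4 (w v : C) (K : nat) (HK : (1 <= K)%nat) :
  (exists M N : R, forall n : R, (N <= n)%R ->
     (Cmod ((T_n n 1 v
            - Csum_lt K (fun r => / RtoC (n ^ r) *
                 (- rho r v + gamma_c r v / 2 * RtoC (sqrt (2 * PI * n)))))%C)
      <= M / Rpower n (INR K - / 2))%R)
  /\
  ((regX w \/ regZ w \/ regT w) ->
   exists M N : R, forall n : R, (N <= n)%R ->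
     (Cmod ((T_n n w v - (- Csum_lt K (fun r => U_r r w v / RtoC (n ^ r))))%C)
      <= M / n ^ K)%R)
  /\
  (regS w ->
   exists M N : R, forall n : R, (N <= n)%R ->
     (Cmod ((T_n n w v
            - Csum_lt K (fun r => / RtoC (n ^ r) *
                 (- U_r r w v
                  + gamma_c r v * (Cexp (0%R, (n * phi w)%R) / Ccpow w v)
                    * RtoC (sqrt (2 * PI * n)))))%C)
      <= M / Rpower n (INR K - / 2))%R)
  /\
  (regY w -> w <> 0 ->
   exists (M N : R) (E : R -> C), forall n : R, (N <= n)%R ->
     (Cmod (E n) <= M / n ^ K)%R /\
     T_n n w v = RtoC (sqrt (2 * PI * n)) / (wpow_n n w * Ccpow w v)
                 * (Csum_lt K (fun r => gamma_c r v / RtoC (n ^ r)) + E n)).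
Proof.
  split; [|split; [|split]].
  - destruct (T_n_1_expansion v K HK) as (M & N & H). exists M, (Rmax 1 N). intros n Hn.
    assert (m1 := Rmax_l 1 N). assert (m2 := Rmax_r 1 N). rewrite div_Rpower by lra. apply H; lra.
  (* The case distinction follows Re w, not the regions: X meets both half-planes, while Z and T lie
     in Re w > 1. *)
  - intros HR. destruct (Rlt_dec (fst w) 1) as [Hw|Hw].
    + destruct HR as [HX|[[_ HZ]|[_ HT]]]; [now apply T_n_regX_left|lra|lra].
    (* The point w = 1 lies in none of the three regions, since |w e^{1-w}| = 1 and Re w = 1
       there. *)
    + apply T_n_upper_expansion; [assumption|lra|]. intros ->.
      destruct HR as [HX|[[_ HZ]|[_ HT]]]; [|simpl in HZ; lra|simpl in HT; lra].
      unfold regX in HX. rewrite modwe_eq, Cmod_1 in HX. simpl fst in HX.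
      replace (1 - 1)%R with 0%R in HX by ring. rewrite exp_0 in HX. lra.
  - intros HS. destruct (T_n_regS w v K HK HS) as (M & N & H). exists M, (Rmax 1 N). intros n Hn.
    assert (m1 := Rmax_l 1 N). assert (m2 := Rmax_r 1 N). rewrite div_Rpower by lra. apply H; lra.
  - apply T_n_regY; assumption.
Qed.
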